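(* Let $0<\mu<L$. The sine–Jacobi Chebyshev method with horizon $N\ge1$ is final-Chebyshev exact and satisfies the finite identity $$A_N(J_N^{\sin})=\frac{2\epsilon_N^\star}{\Delta}\Bigl(\sum_{s=0}^{N-1}d_s^2\Bigr)^{1/2}.$$ Consequently, as $N\to\infty$ with $\mu,L$ fixed, $$A_N(J_N^{\sin})=2\sqrt{c_{\sin}}\,\frac{N^{3/2}}{\Delta}\,\epsilon_N^\star\,(1+o(1)).$$
   Context: $T_N$ is the Chebyshev polynomial of the first kind. Put $\Delta=L-\mu$, $\eta=\frac{L+\mu}{L-\mu}$, $z(\lambda)=\eta-\frac{2\lambda}{\Delta}$, $p_N^\star(\lambda)=T_N(z(\lambda))/T_N(\eta)$, $\epsilon_N^\star=1/|T_N(\eta)|$. Sine–Jacobi matrix: $J_N^{\sin}$ is the unique $N\times N$ Jacobi matrix (real symmetric tridiagonal, positive off-diagonal entries, sites $0,\dots,N-1$) whose spectral measure at $e_0$ is $\sum_{j=1}^N w_j\delta_{\zeta_j}$, where $\zeta_j=\cos\theta_j$, $\theta_j=\frac{(2j-1)\pi}{2N}$, $w_j=\frac{\sin\theta_j}{\sum_{k=1}^N\sin\theta_k}$. It has zero diagonal and off-diagonal coefficients $a_{s,N}>0$ with $$a_{s,N}^2=\frac14\,\frac{\sin^2(\pi s/N)}{\sin(\pi(s-\frac12)/N)\,\sin(\pi(s+\frac12)/N)},\quad 1\le s\le N-1.$$ Its endpoint Green profile is $d_s=[(I-J_N^{\sin})^{-1}]_{ss}$, $0\le s\le N-1$. Sine–Jacobi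 Chebyshev method: with $p_0=1$, $p_1=\eta$, $p_{s+1}=\eta p_s-a_{s,N}^2p_{s-1}$ (all positive), set $x_1=x_0-\frac{2}{L+\mu}\nabla f(x_0)$ and, for $1\le s\le N-1$, $$x_{s+1}=\frac{\eta p_s}{p_{s+1}}x_s-\frac{a_{s,N}^2p_{s-1}}{p_{s+1}}x_{s-1}-\frac{2p_s}{\Delta p_{s+1}}\nabla f(x_s).$$ Final-Chebyshev exact means: on $f(x)=\frac12\lambda x^2$, $x_N=p_N^\star(\lambda)x_0$ for all $\lambda\in[\mu,L]$. First-variation kernel and gain: with $\gamma_s=\frac{2p_s}{\Delta p_{s+1}}$, $e_1=(1,0)^\top$, and $$C_s(\lambda)=\begin{pmatrix}\frac{\eta p_s}{p_{s+1}}-\gamma_s\lambda & -\frac{a_{s,N}^2p_{s-1}}{p_{s+1}}\\1&0\end{pmatrix}\ (s\ge1),\qquad C_0(\lambda)=\begin{pmatrix}1-\gamma_0\lambda&0\\1&0\end{pmatrix},$$ put $$K_s(\lambda,\nu)=-\,\gamma_s\; e_1^\top C_{N-1}(\lambda)\cdots C_{s+1}(\lambda)\,e_1\; e_1^\top C_{s-1}(\nu)\cdots C_0(\nu)\,e_1$$ (empty products equal the identity), and $$A_N(J_N^{\sin})=\sup_{\lambda,\nu\in[\mu,L]}\Bigl(\sum_{s=0}^{N-1}|K_s(\lambda,\nu)|^2\Bigr)^{1/2}.$$ Constant: let $f$ (on $(0,1)$) be the positive non-logarithmic solution of $f''(t)+\frac{\pi^2}{4\sin^2(\pi t)}f(t)=0$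 with $f(t)\sim\sqrt t$ as $t\downarrow0$; let $I_{\sin}=\int_0^1f(u)f(1-u)\,du$, $\varphi_{\sin}(t)=f(t)f(1-t)/I_{\sin}$, $c_{\sin}=\int_0^1\varphi_{\sin}(t)^2\,dt$. *)

(* Defs.v *)
From HB Require Import structures.
From mathcomp Require Import all_boot all_order all_algebra.
From mathcomp Require Import all_classical all_reals all_analysis.
From mathcomp Require Import lra.

Set Implicit Arguments.
Unset Strict Implicit.
Unset Printing Implicit Defensive.

Import Order.TTheory GRing.Theory Num.Theory.
Import numFieldNormedType.Exports.

Local Open Scope classical_set_scope.
Local Open Scope ring_scope.

(* Matrices of order N >= 1 are indexed by n with N = n.+1, so that 'I_n.+1 is
   the set of sites 0, ..., N-1. *)

Fixpoint chebyshevT (R : nzRingType) (N : nat) : {poly R} :=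
  match N with
  | 0 => 1
  | N1.+1 => match N1 with
             | 0 => 'X
             | N2.+1 => 2%:R *: ('X * chebyshevT R N1) - chebyshevT R N2
             end
  end.

Definition Delta (R : realType) (mu L : R) : R := L - mu.

Definition eta (R : realType) (mu L : R) : R := (L + mu) / (L - mu).

Definition zmap (R : realType) (mu L lam : R) : R :=
  eta mu L - 2 * lam / Delta mu L.

Definition pstar (R : realType) (mu L : R) (N : nat) (lam : R) : R :=
  (chebyshevT R N).[zmap mu L lam] / (chebyshevT R N).[eta mu L].

Definition epsstar (R : realType) (mu L : R) (N : nat) : R :=
  `|(chebyshevT R N).[eta mu L]|^-1.

Definition is_jacobi (R : realType) (n : nat) (J : 'M[R]_n.+1) : Prop :=
  [/\ J^T = J,
      (forall i j : 'I_n.+1, (i.+1 < j)%N -> J i j = 0) &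
      (forall i j : 'I_n.+1, j = i.+1 :> nat -> 0 < J i j)].

(* m is the spectral measure of J at e_0: <e_0, p(J) e_0> = \int p dm for every
   polynomial p.  The equality in \bar R forces every polynomial to be
   m-integrable, and (with p the square of the characteristic polynomial) m to
   be carried by the spectrum of J, so m is determined by J. *)
Definition is_spectral_measure (R : realType) (n : nat) (J : 'M[R]_n.+1)
    (m : {measure set R -> \bar R}) : Prop :=
  forall p : {poly R},
    (horner_mx J p ord0 ord0)%:E = (\int[m]_(x in setT) (p.[x])%:E)%E.

(* The index j : 'I_n.+1 stands for the 1-based index j.+1. *)
Definition sine_angle (R : realType) (n : nat) (j : 'I_n.+1) : R :=
  (2 * j.+1%:R - 1) * pi / (2 * n.+1%:R).

Definition sine_node (R : realType) (n : nat) (j : 'I_n.+1) : R :=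
  cos (sine_angle R j).

Definition sine_weight (R : realType) (n : nat) (j : 'I_n.+1) : R :=
  sin (sine_angle R j) / \sum_(k < n.+1) sin (sine_angle R k).

Lemma sin_sine_angle_ge0 (R : realType) (n : nat) (j : 'I_n.+1) :
  0 <= sin (sine_angle R j).
Proof.
have jn : (j.+1%:R : R) <= n.+1%:R by rewrite ler_nat.
have j1 : (1 : R) <= j.+1%:R by rewrite ler1n.
have n1 : (0 : R) < 2 * n.+1%:R by rewrite mulr_gt0 ?ltr0n.
have p0 := pi_ge0 R.
apply: sin_ge0_pi; rewrite /sine_angle; apply/andP; split.
  by rewrite divr_ge0 ?(ltW n1)// mulr_ge0//; lra.
by rewrite ler_pdivrMr// mulrC ler_wpM2l//; lra.
Qed.

Lemma sine_weight_ge0 (R : realType) (n : nat) (j : 'I_n.+1) :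
  0 <= sine_weight R j.
Proof.
rewrite /sine_weight divr_ge0 ?sin_sine_angle_ge0// sumr_ge0// => k _.
exact: sin_sine_angle_ge0.
Qed.

Definition sine_measure (R : realType) (n : nat) :
    {measure set R -> \bar R} :=
  msum (fun k => mscale (NngNum (sine_weight_ge0 R (inord k : 'I_n.+1)))
                        (dirac (sine_node R (inord k : 'I_n.+1)))) n.+1.

Definition sine_jacobi (R : realType) (n : nat) : 'M[R]_n.+1 :=
  xget 0 [set J : 'M[R]_n.+1 |
    is_jacobi J /\ is_spectral_measure J (sine_measure R n)].

(* Meaningful for 1 <= s <= N - 1 only. *)
Definition sine_coef (R : realType) (n : nat) (s : nat) : R :=
  sine_jacobi R n (inord s.-1) (inord s).

Definition green_profile (R : realType) (n : nat) (s : 'I_n.+1) : R :=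
  invmx (1%:M - sine_jacobi R n) s s.

Fixpoint pseq (R : realType) (h : R) (a : nat -> R) (s : nat) : R :=
  match s with
  | 0 => 1
  | s1.+1 => match s1 with
             | 0 => h
             | s2.+1 => h * pseq h a s1 - a s1 ^+ 2 * pseq h a s2
             end
  end.

Fixpoint method (R : realType) (mu L : R) (a : nat -> R) (f : R -> R) (x0 : R)
    (s : nat) : R :=
  let p := pseq (eta mu L) a in
  match s with
  | 0 => x0
  | s1.+1 =>
    let x := method mu L a f x0 s1 in
    match s1 with
    | 0 => x - 2 / (L + mu) * derive1 f x
    | s2.+1 =>
      eta mu L * p s1 / p s1.+1 * x
      - a s1 ^+ 2 * p s2 / p s1.+1 * method mu L a f x0 s2
      - 2 * p s1 / (Delta mu L * p s1.+1) * derive1 f x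
    end
  end.

Definition sine_method (R : realType) (mu L : R) (n : nat) :=
  method mu L (@sine_coef R n).

(* meth f x0 s is the s-th iterate of the method on f started at x0. *)
Definition final_chebyshev_exact (R : realType) (mu L : R) (N : nat)
    (meth : (R -> R) -> R -> nat -> R) : Prop :=
  forall lam x0 : R, mu <= lam <= L ->
    meth (fun x => 2^-1 * lam * x ^+ 2) x0 N = pstar mu L N lam * x0.

Definition gamma (R : realType) (mu L : R) (a : nat -> R) (s : nat) : R :=
  let p := pseq (eta mu L) a in 2 * p s / (Delta mu L * p s.+1).

Definition mx22 (R : realType) (a b c d : R) : 'M[R]_2 :=
  \matrix_(i, j) if i == 0 then (if j == 0 then a else b)
                 else (if j == 0 then c else d).

Definition Cmx (R : realType) (mu L : R) (a : nat -> R) (s : nat) (lam : R) :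
    'M[R]_2 :=
  let p := pseq (eta mu L) a in
  if s is s1.+1 then
    mx22 (eta mu L * p s / p s.+1 - gamma mu L a s * lam)
         (- (a s ^+ 2 * p s1 / p s.+1))
         1 0
  else mx22 (1 - gamma mu L a 0 * lam) 0 1 0.

(* C_(q-1)(lam) ... C_m(lam), with decreasing indices from left to right. *)
Definition Cprod (R : realType) (mu L : R) (a : nat -> R) (m q : nat)
    (lam : R) : 'M[R]_2 :=
  \prod_(i <- rev (index_iota m q)) Cmx mu L a i lam.

Definition kernelK (R : realType) (mu L : R) (a : nat -> R) (N s : nat)
    (lam nu : R) : R :=
  - gamma mu L a s * Cprod mu L a s.+1 N lam ord0 ord0
                   * Cprod mu L a 0 s nu ord0 ord0.

Definition gain (R : realType) (mu L : R) (a : nat -> R) (N : nat) : R :=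
  sup [set Num.sqrt (\sum_(0 <= s < N) `|kernelK mu L a N s lam nu| ^+ 2)
      | lam in `[mu, L] & nu in `[mu, L]].

Definition sine_gain (R : realType) (mu L : R) (n : nat) : R :=
  gain mu L (@sine_coef R n) n.+1.

(* Near 0 the solutions behave like combinations of sqrt t and sqrt t * ln t;
   f t ~ sqrt t excludes the logarithmic one and fixes the normalization.
   Only the values of f on ]0, 1[ matter. *)
Definition is_sine_solution (R : realType) (f : R -> R) : Prop :=
  [/\ forall t : R, 0 < t < 1 -> 0 < f t,
      forall t : R, 0 < t < 1 -> derivable f t 1 /\ derivable (derive1 f) t 1,
      forall t : R, 0 < t < 1 ->
        derive1n 2 f t + pi ^+ 2 / (4 * sin (pi * t) ^+ 2) * f t = 0 &
      f t / Num.sqrt t @[t --> 0^'+] --> (1 : R)].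

Definition Isin (R : realType) (f : R -> R) : R :=
  \int[@lebesgue_measure R]_(u in `]0, 1[) (f u * f (1 - u)).

Definition phisin (R : realType) (f : R -> R) (t : R) : R :=
  f t * f (1 - t) / Isin f.

Definition csin (R : realType) (f : R -> R) : R :=
  \int[@lebesgue_measure R]_(t in `]0, 1[) (phisin f t ^+ 2).

(* Main.v *)
Require Import Defs.
From HB Require Import structures.
From mathcomp Require Import all_boot all_order all_algebra.
From mathcomp Require Import all_classical all_reals all_analysis.
From mathcomp Require Import measurable_realfun ring lra zify.

Set Implicit Arguments.
Unset Strict Implicit.
Unset Printing Implicit Defensive.

Import Order.TTheory GRing.Theory Num.Theory.
Import numFieldNormedType.Exports.

Local Open Scope classical_set_scope.
Local Open Scope ring_scope.

(* The monic recurrence polynomials p_s of the sine-Jacobi matrix are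
   q-ultraspherical polynomials at a root of unity: 2^s p_s is a combination of
   Chebyshev polynomials T_|s-2k| with nonnegative coefficients, and for s = N
   all of them but the extreme ones vanish, so p_N = 2^(1-N) T_N. This gives
   final-Chebyshev exactness. Since a_s = a_(N-s), the associated polynomials
   are the p_s again, so that
     |K_s(lambda, nu)| = 2/(Delta p_N(eta)) |p_(N-1-s)(z(lambda)) p_s(z(nu))|;
   by nonnegativity the supremum is attained at z = 1, where the product is
   p_N(1) d_s. The same mirror symmetry identifies the spectral measure: it
   forces p_(N-1)^2 to be constant on the zeros of p_N, whence weights
   proportional to 1/|p_N'|, that is, to sin(theta_j).

   For the asymptotics, d_s = C sin(pi(s+1/2)/N) G_s G_(N-1-s), where C does not
   depend on s and G solves a discretization of Legendre's equation
   (sin(pi t) v')' = (pi^2/4) sin(pi t) v, which is the equation of f after the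
   substitution v = sqrt(pi) f / sqrt(sin(pi t)). G and v are compared step by
   step, which gives G_s -> v(t) as s/N -> t, and dominated convergence yields
   the limits of N^-1 sum D_s and N^-1 sum D_s^2 for D_s = d_s / C. The unknown
   C is eliminated by the trace identity sum d_s = p_N'(1)/p_N(1) = N^2. *)

(** * Chebyshev polynomials and three-term recurrences *)

(** Two obstacles shape the asymptotic part. The limit v is P_(-1/2)(cos(pi t)), with a logarithmic
    singularity at t = 1; so G is not uniformly bounded and is compared with v only on [0, T] with T
    < 1. The domination therefore rests on D: of the indices s and N-1-s one lies in the left half,
    where G is bounded, and the sine factor compensates the growth of G at the other. At t = 0 the
    equation is singular too, and all that is known of v there is v -> 1; that sin(pi t) v' tends to
    0 has to be derived, by excluding logarithmic growth. Once this is known, v, sin(pi t) v' and v'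
    are all nondecreasing, so every comparison with a sum over the grid is one-sided and no second
    derivative has to be estimated. The constant C is a product of sine ratios, whose own
    asymptotics are never computed. On the algebraic side the matrix is never diagonalized: the sine
    measure is recognized as a linear functional, by its values on p_0, ..., p_(N-1) and on the
    multiples of p_N. *)

Lemma chebyshevTSS (R : nzRingType) (m : nat) :
  chebyshevT R m.+2 = 2%:R *: ('X * chebyshevT R m.+1) - chebyshevT R m.
Proof. by []. Qed.

Lemma chebyshevTSS_horner (R : comNzRingType) (m : nat) (x : R) :
  (chebyshevT R m.+2).[x]
  = 2 * x * (chebyshevT R m.+1).[x] - (chebyshevT R m).[x].
Proof. by rewrite chebyshevTSS !(hornerD, hornerN, hornerZ, hornerM, hornerX) mulrA. Qed.

Lemma nat_ind2 (P : nat -> Prop) :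
  P 0%N -> P 1%N -> (forall n, P n -> P n.+1 -> P n.+2) -> forall n, P n.
Proof.
move=> P0 P1 PS n; suff [] : P n /\ P n.+1 by [].
by elim: n => // n [Pn Pn1]; split => //; exact: PS.
Qed.

Lemma chebyshevT_cos (R : realType) (m : nat) (x : R) :
  (chebyshevT R m).[cos x] = cos (m%:R * x).
Proof.
elim/nat_ind2: m => [||m IH0 IH1].
- by rewrite hornerE mul0r cos0.
- by rewrite hornerE mul1r.
- rewrite chebyshevTSS_horner IH0 IH1.
  have -> : m.+2%:R * x = m.+1%:R * x + x by rewrite -[m.+2]addn1 natrD mulrDl mul1r.
  have -> : m%:R * x = m.+1%:R * x - x by rewrite -[m.+1]addn1 natrD mulrDl mul1r addrK.
  by rewrite cosB cosD; ring.
Qed.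

Lemma chebyshevT_norm_le1 (R : realType) (m : nat) (x : R) :
  -1 <= x <= 1 -> `|(chebyshevT R m).[x]| <= 1.
Proof.
by move=> /acosK <-; rewrite chebyshevT_cos ler_norml cos_geN1 cos_le1.
Qed.

Lemma chebyshevT_at1 (R : comNzRingType) (m : nat) : (chebyshevT R m).[1] = 1.
Proof.
elim/nat_ind2: m => [||m IH0 IH1]; [by rewrite hornerE | by rewrite hornerE |].
by rewrite chebyshevTSS_horner IH0 IH1; ring.
Qed.

Lemma chebyshevT_ge1 (R : realDomainType) (m : nat) (x : R) :
  1 <= x -> 1 <= (chebyshevT R m).[x].
Proof.
(* The induction carries monotonicity in m as well: T_(m+2) - T_(m+1) = 2 (x - 1) T_(m+1) + (T_(m+1)
   - T_m). *)
move=> x1; suff [] : 1 <= (chebyshevT R m).[x] /\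
    (chebyshevT R m).[x] <= (chebyshevT R m.+1).[x] by [].
elim: m => [|m [T1 T2]]; first by rewrite !hornerE.
split; first exact: le_trans T2.
by rewrite chebyshevTSS_horner; nra.
Qed.

Lemma deriv_chebyshevTSS (R : comNzRingType) (m : nat) (x : R) :
  ((chebyshevT R m.+2)^`()).[x]
  = 2 * (chebyshevT R m.+1).[x] + 2 * x * ((chebyshevT R m.+1)^`()).[x]
    - ((chebyshevT R m)^`()).[x].
Proof.
rewrite chebyshevTSS derivB derivZ derivM derivX mul1r.
by rewrite !(hornerD, hornerN, hornerZ, hornerM, hornerX); ring.
Qed.

Lemma deriv_chebyshevT_at1 (R : comNzRingType) (m : nat) :
  ((chebyshevT R m)^`()).[1] = m%:R ^+ 2.
Proof.
elim/nat_ind2: m => [||m IH0 IH1].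
- by rewrite derivC hornerE expr0n.
- by rewrite derivX hornerE expr1n.
- by rewrite deriv_chebyshevTSS IH0 IH1 chebyshevT_at1 -[m.+2]addn2 -[m.+1]addn1 !natrD; ring.
Qed.

(** The derivative of T_m(cos x) = cos(m x), kept free of division. It evaluates |p_N'| at the
    nodes, where |sin(N theta)| = 1. *)
Lemma deriv_chebyshevT_cos (R : realType) (m : nat) (x : R) :
  sin x * ((chebyshevT R m)^`()).[cos x] = m%:R * sin (m%:R * x).
Proof.
elim/nat_ind2: m => [||m IH0 IH1].
- by rewrite derivC hornerE !mul0r mulr0.
- by rewrite derivX hornerE !mul1r mulr1.
- rewrite deriv_chebyshevTSS mulrBr mulrDr [sin x * (2 * _ * _)]mulrCA IH0 IH1.
  rewrite chebyshevT_cos.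
  have -> : m.+2%:R * x = m.+1%:R * x + x by rewrite -[m.+2]addn1 natrD mulrDl mul1r.
  have -> : m%:R * x = m.+1%:R * x - x by rewrite -[m.+1]addn1 natrD mulrDl mul1r addrK.
  by rewrite sinB sinD -[m.+2]addn2 -[m.+1]addn1 !natrD; ring.
Qed.

(* T_m extended to negative indices by T_(-m) = T_m, which makes the three-term
   recurrence valid for every integer index. *)
Definition chebyshevZ (R : nzRingType) (m : int) : {poly R} :=
  chebyshevT R `|m|%N.

Lemma chebyshevZ_rec (R : comNzRingType) (m : int) :
  2%:R *: ('X * chebyshevZ R m) = chebyshevZ R (m + 1) + chebyshevZ R (m - 1).
Proof.
rewrite /chebyshevZ; case: m => [[|m]|[|m]].
- by rewrite !mulr1 /= scaler_nat mulr2n.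
- have -> : `|(m.+1%:Z + 1)%R|%N = m.+2 by lia.
  have -> : `|(m.+1%:Z - 1)%R|%N = m by lia.
  by rewrite chebyshevTSS subrK.
- have -> : `|(Negz 0 + 1)%R|%N = 0%N by lia.
  have -> : `|(Negz 0 - 1)%R|%N = 2%N by lia.
  by rewrite (chebyshevTSS R 0) addrC subrK.
- have -> : `|(Negz m.+1 + 1)%R|%N = m.+1 by lia.
  have -> : `|(Negz m.+1 - 1)%R|%N = m.+3 by lia.
  have -> : `|Negz m.+1|%N = m.+2 by lia.
  by rewrite (chebyshevTSS R m.+1) addrC subrK.
Qed.

Fixpoint jpoly (R : nzRingType) (a : nat -> R) (s : nat) : {poly R} :=
  match s with
  | 0 => 1
  | s1.+1 => match s1 with
             | 0 => 'X
             | s2.+1 => 'X * jpoly a s1 - a s1 ^+ 2 *: jpoly a s2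
             end
  end.

Lemma jpolySS (R : nzRingType) (a : nat -> R) (s : nat) :
  jpoly a s.+2 = 'X * jpoly a s.+1 - a s.+1 ^+ 2 *: jpoly a s.
Proof. by []. Qed.

Lemma pseqSS (R : realType) (h : R) (a : nat -> R) (s : nat) :
  pseq h a s.+2 = h * pseq h a s.+1 - a s.+1 ^+ 2 * pseq h a s.
Proof. by []. Qed.

Lemma horner_jpoly (R : realType) (a : nat -> R) (h : R) (s : nat) :
  (jpoly a s).[h] = pseq h a s.
Proof.
elim/nat_ind2: s => [||s IH0 IH1]; [by rewrite hornerE | by rewrite hornerE |].
by rewrite jpolySS pseqSS !(hornerD, hornerN, hornerZ, hornerM, hornerX) IH0 IH1.
Qed.

Lemma jpoly_monic_size (R : idomainType) (a : nat -> R) (s : nat) :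
  jpoly a s \is monic /\ size (jpoly a s) = s.+1.
Proof.
elim/nat_ind2: s => [||s [m0 s0] [m1 s1]].
- by rewrite monic1 size_poly1.
- by rewrite monicX size_polyX.
rewrite jpolySS; have n1 : jpoly a s.+1 != 0 by rewrite -size_poly_gt0 s1.
have sX : size ('X * jpoly a s.+1) = s.+3 by rewrite mulrC size_mulX// s1.
have sl : (size (- (a s.+1 ^+ 2 *: jpoly a s))%R < size ('X * jpoly a s.+1)%R)%N.
  by rewrite size_polyN sX (leq_ltn_trans (size_scale_leq _ _))// s0.
split; last by rewrite size_polyDl.
by rewrite monicE lead_coefDl// lead_coefM lead_coefX mul1r -monicE.
Qed.

Lemma size_jpoly (R : idomainType) (a : nat -> R) (s : nat) :
  size (jpoly a s) = s.+1.
Proof. by have [] := jpoly_monic_size a s. Qed.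

Lemma jpoly_monic (R : idomainType) (a : nat -> R) (s : nat) :
  jpoly a s \is monic.
Proof. by have [] := jpoly_monic_size a s. Qed.

Lemma pseq_ext (R : realType) (h : R) (a b : nat -> R) (s : nat) :
  (forall i, (0 < i < s)%N -> a i ^+ 2 = b i ^+ 2) -> pseq h a s = pseq h b s.
Proof.
elim/nat_ind2: s => [//|//|s IH0 IH1] ab.
rewrite !pseqSS ab ?ltnS ?leqnn// IH0 ?IH1// => i /andP[i0 si]; apply: ab.
- by rewrite i0 (ltn_trans si).
- by rewrite i0 (ltn_trans si).
Qed.

(** p_s is the determinant of a tridiagonal matrix; this is its expansion along the first row, where
    the definition expands along the last. *)
Lemma pseq_left (R : realType) (h : R) (a : nat -> R) (s : nat) :
  pseq h a s.+2 = h * pseq h (fun i => a i.+1) s.+1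
                  - a 1%N ^+ 2 * pseq h (fun i => a i.+2) s.
Proof.
elim/nat_ind2: s => [||s IH0 IH1]; [by rewrite /= !mulr1 | by rewrite /=; ring|].
by rewrite [LHS]pseqSS IH0 IH1 !pseqSS; ring.
Qed.

(** The last k sites, read backwards, carry the coefficients of the first k, and the determinant
    does not see the reversal. *)
Lemma pseq_mirror (R : realType) (h : R) (a : nat -> R) (N k : nat) :
  (forall i, (0 < i < N)%N -> a (N - i)%N ^+ 2 = a i ^+ 2) -> (k <= N)%N ->
  pseq h (fun i => a (N - k + i)%N) k = pseq h a k.
Proof.
move=> aN; elim/nat_ind2: k => [//|//|k IH0 IH1] kN.
rewrite pseq_left [RHS]pseqSS -IH0 -?IH1 ?(ltnW kN) ?(ltnW (ltnW kN))//.
rewrite -(aN k.+1) ?ltnS ?kN//.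
congr (h * _ - _ * _).
- by apply: pseq_ext => i _; do 2 f_equal; lia.
- by do 2 f_equal; lia.
- by apply: pseq_ext => i _; do 2 f_equal; lia.
Qed.

(** * The sine-Jacobi coefficients *)

Definition sg (R : realType) (N : nat) (x : R) : R := sin (x * (pi / N%:R)).

(* The recurrence coefficients of the q-ultraspherical (Rogers) polynomials with
   beta = q^(1/2), at the root of unity q = e^(2 pi i / N). *)
Definition acoef (R : realType) (N s : nat) : R :=
  2^-1 * sg N s%:R / Num.sqrt (sg N (s%:R - 2^-1) * sg N (s%:R + 2^-1)).

Lemma sinM_exchange (R : realType) (p q r : R) :
  sin (p + q) * sin (p + r) - sin p * sin (p + q + r) = sin q * sin r.
Proof.
rewrite !sinD cosD.
transitivity ((cos p ^+ 2 + sin p ^+ 2) * (sin q * sin r)); first by ring.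
by rewrite cos2Dsin2 mul1r.
Qed.

(** What remains of the coefficient recurrence [bcoef_step] after the common products are cancelled;
    there a and b are half-integer multiples of pi/N and d is pi/(2N). *)
Lemma sinM3_exchange (R : realType) (a b d : R) :
  sin a * sin b * sin (a + b + 2 * d) =
  sin (a + b + d) * (sin a * sin (b + d) + sin b * sin (a + d))
  - sin (a + b) * sin (a + d) * sin (b + d).
Proof.
have e1 := sinM_exchange a b d; have e2 := sinM_exchange a d (b + d).
have -> : a + b + 2 * d = a + d + (b + d) by ring.
have E : a + (b + d) = a + b + d by ring.
rewrite E in e2.
have -> : sin a * sin b * sin (a + d + (b + d))
    = sin b * (sin (a + d) * sin (a + b + d) - sin d * sin (b + d)) by rewrite -e2; ring.
have -> : sin (a + b) * sin (a + d) * sin (b + d)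
    = (sin b * sin d + sin a * sin (a + b + d)) * sin (b + d) by rewrite -e1; ring.
by ring.
Qed.

Section SineCoef.
Variables (R : realType) (N : nat).
Hypothesis N0 : (0 < N)%N.
Implicit Types (s k n : nat) (x : R).
Local Notation S := (@sg R N).

Lemma natN_gt0 : 0 < N%:R :> R. Proof. by rewrite ltr0n. Qed.

Lemma sg_gt0 x : 0 < x < N%:R -> 0 < S x.
Proof.
move=> /andP[x0 xN]; apply: sin_gt0_pi; have p0 := pi_gt0 R; have n0 := natN_gt0.
apply/andP; split; first by rewrite mulr_gt0// divr_gt0.
by rewrite mulrCA gtr_pMr// ltr_pdivrMr// mul1r.
Qed.

Lemma sg0 : S 0 = 0. Proof. by rewrite /sg mul0r sin0. Qed.

Lemma sgB x : S (N%:R - x) = S x.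
Proof.
rewrite /sg mulrBl mulrCA divff ?mulr1; last by rewrite gt_eqF// natN_gt0.
by rewrite sinB sinpi cospi mul0r mulN1r sub0r opprK.
Qed.

Lemma sgN : S N%:R = 0.
Proof. by rewrite -[N%:R]subr0 sgB sg0. Qed.

Lemma sg_ord_gt0 s : (0 < s < N)%N -> 0 < S s%:R.
Proof. by move=> /andP[s0 sN]; apply: sg_gt0; rewrite ltr0n s0 ltr_nat. Qed.

Lemma sg_half_gt0 s : (s < N)%N -> 0 < S (s%:R + 2^-1).
Proof.
move=> sN; apply: sg_gt0; have : s.+1%:R <= N%:R :> R by rewrite ler_nat.
by rewrite -addn1 natrD; have := ler0n R s; lra.
Qed.

Lemma sg_halfB_gt0 s : (0 < s <= N)%N -> 0 < S (s%:R - 2^-1).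
Proof.
case: s => // s /andP[_ sN]; have -> : s.+1%:R - 2^-1 = s%:R + 2^-1 :> R.
  by rewrite -addn1 natrD; lra.
exact: sg_half_gt0.
Qed.

Lemma acoef_sqr s : (0 < s < N)%N ->
  acoef R N s ^+ 2 = 4^-1 * (S s%:R ^+ 2 / (S (s%:R - 2^-1) * S (s%:R + 2^-1))).
Proof.
move=> /andP[s0 sN]; have h1 := sg_half_gt0 sN.
have h2 : 0 < S (s%:R - 2^-1) by rewrite sg_halfB_gt0// s0 ltnW.
rewrite /acoef exprMn exprVn sqr_sqrtr ?mulr_ge0 ?ltW// exprMn -mulrA.
by congr (_ * _); rewrite expr2; lra.
Qed.

Lemma acoef_gt0 s : (0 < s < N)%N -> 0 < acoef R N s.
Proof.
move=> sN; have s1 := sg_ord_gt0 sN; case/andP: sN => s0 sN.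
rewrite /acoef divr_gt0 ?mulr_gt0 ?invr_gt0// sqrtr_gt0 mulr_gt0 ?sg_half_gt0//.
by rewrite sg_halfB_gt0// s0 ltnW.
Qed.

Lemma acoef_mirror s : (0 < s < N)%N -> acoef R N (N - s) ^+ 2 = acoef R N s ^+ 2.
Proof.
move=> sN; rewrite !acoef_sqr//; last by lia.
have -> : (N - s)%:R = N%:R - s%:R :> R by rewrite natrB//; lia.
have e1 : N%:R - s%:R - 2^-1 = N%:R - (s%:R + 2^-1) :> R by ring.
have e2 : N%:R - s%:R + 2^-1 = N%:R - (s%:R - 2^-1) :> R by ring.
by rewrite e1 e2 !sgB [S (s%:R + _) * _]mulrC.
Qed.

(** With q = e^(2 pi i/N) this is (q; q)_n / (q^(1/2); q)_n up to the phase q^(n/4). Rogers'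
    polynomials have the Fourier coefficients 1/(qprod k * qprod (n - k)), and the phases cancel
    after normalization by qprod n. *)
Definition qprod n : R := \prod_(0 <= j < n) (S j.+1%:R / S (j%:R + 2^-1)).

Lemma qprod0 : qprod 0 = 1. Proof. by rewrite /qprod big_geq. Qed.

Lemma qprodS n : qprod n.+1 = qprod n * (S n.+1%:R / S (n%:R + 2^-1)).
Proof. by rewrite /qprod big_nat_recr. Qed.

Lemma qprod_gt0 n : (n < N)%N -> 0 < qprod n.
Proof.
elim: n => [|n IH] nN; first by rewrite qprod0.
rewrite qprodS mulr_gt0 ?IH ?(ltnW nN)//.
by rewrite divr_gt0 ?sg_ord_gt0 ?sg_half_gt0// ltnW.
Qed.

Lemma qprodN : qprod N = 0.
Proof.
have [m Nm] : exists m, N = m.+1 by exists N.-1; lia.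
by rewrite {1}Nm qprodS -Nm sgN mul0r mulr0.
Qed.

(* For n = N the numerator qprod N vanishes, so only the two extreme terms
   survive; they are defined separately because q_N / (q_0 q_N) is the junk
   value 0 / 0 = 0. *)
Definition bcoef n k : R :=
  if (k == 0)%N || (k == n) then 1 else qprod n / (qprod k * qprod (n - k)).

Lemma bcoef_lt n k : (k <= n < N)%N -> bcoef n k = qprod n / (qprod k * qprod (n - k)).
Proof.
move=> /andP[kn nN]; have q := qprod_gt0 nN; rewrite /bcoef.
case: eqVneq => [->|k0] /=; first by rewrite subn0 qprod0 mul1r divff// gt_eqF.
case: eqVneq => [->|//]; by rewrite subnn qprod0 mulr1 divff// gt_eqF.
Qed.

Lemma bcoef_ge0 n k : (n <= N)%N -> (k <= n)%N -> 0 <= bcoef n k.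
Proof.
rewrite leq_eqVlt => /predU1P[->|nN] kn.
  by rewrite /bcoef; case: ifP => //; rewrite qprodN mul0r.
rewrite bcoef_lt ?kn// ltW// divr_gt0 ?mulr_gt0// qprod_gt0//; lia.
Qed.

(** Comparison of the coefficients of T_(n+1-2k) in the three-term recurrence. The case n + 1 = N,
    where the left side is 0, is included: it is the one that produces T_N. *)
Lemma bcoef_step n k : (0 < k <= n)%N -> (n < N)%N ->
  bcoef n.+1 k = bcoef n k + bcoef n k.-1
                 - 4 * acoef R N n ^+ 2 * bcoef n.-1 k.-1.
Proof.
case: k => // k /andP[_ kn] nN.
have [m nm] : exists m, n = (k + m).+1 by exists (n - k.+1)%N; lia.
rewrite acoef_sqr; last by rewrite nN; lia.
rewrite (@bcoef_lt n k.+1) ?(@bcoef_lt n k.+1.-1) ?(@bcoef_lt n.-1 k.+1.-1); [|lia..].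
rewrite /bcoef; have -> : ((k.+1 == 0) || (k.+1 == n.+1))%N = false by lia.
have -> : (n.+1 - k.+1 = m.+1)%N by lia.
have -> : (n - k.+1 = m)%N by lia.
have -> : (n - k.+1.-1 = m.+1)%N by lia.
have -> : (n.-1 - k.+1.-1 = m)%N by lia.
rewrite [k.+1.-1]/= [qprod n.+1]qprodS !(qprodS k) !(qprodS m).
have qE : qprod n = qprod n.-1 * (S n%:R / S (n.-1%:R + 2^-1)).
  by rewrite -[in LHS](prednK (n := n)) ?qprodS ?prednK//; lia.
rewrite qE.
have [qn qk qm] : [/\ qprod n.-1 != 0, qprod k != 0 & qprod m != 0].
  by split; rewrite gt_eqF// qprod_gt0//; lia.
have e1 : S k.+1%:R != 0 by rewrite gt_eqF// sg_ord_gt0//; lia.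
have e2 : S m.+1%:R != 0 by rewrite gt_eqF// sg_ord_gt0//; lia.
have e3 : S (k%:R + 2^-1) != 0 by rewrite gt_eqF// sg_half_gt0//; lia.
have e4 : S (m%:R + 2^-1) != 0 by rewrite gt_eqF// sg_half_gt0//; lia.
have e5 : S (n.-1%:R + 2^-1) != 0 by rewrite gt_eqF// sg_half_gt0//; lia.
have e6 : S (n%:R + 2^-1) != 0 by rewrite gt_eqF// sg_half_gt0//; lia.
have -> : n%:R - 2^-1 = n.-1%:R + 2^-1 :> R.
  by rewrite nm /= -[(k+m).+1]addn1 natrD; lra.
have e7 : S n%:R != 0 by rewrite gt_eqF// sg_ord_gt0//; lia.
have key : S (k%:R + 2^-1) * S (m%:R + 2^-1) * S n.+1%:R =
  S (n%:R + 2^-1) * (S (k%:R + 2^-1) * S m.+1%:R + S (m%:R + 2^-1) * S k.+1%:R)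
  - S n%:R * S k.+1%:R * S m.+1%:R.
  have := sinM3_exchange ((k%:R + 2^-1) * (pi / N%:R)) ((m%:R + 2^-1) * (pi / N%:R))
    (2^-1 * (pi / N%:R)).
  rewrite /sg nm; set u := pi / N%:R.
  have -> : (k + m).+2%:R * u = (k%:R + 2^-1) * u + (m%:R + 2^-1) * u + 2 * (2^-1 * u).
    by rewrite -[(k + m).+2]addn2 !natrD; lra.
  have -> : (k + m).+1%:R * u = (k%:R + 2^-1) * u + (m%:R + 2^-1) * u.
    by rewrite -[(k + m).+1]addn1 !natrD; lra.
  have -> : ((k + m).+1%:R + 2^-1) * u = (k%:R + 2^-1) * u + (m%:R + 2^-1) * u + 2^-1 * u.
    by rewrite -[(k + m).+1]addn1 !natrD; lra.
  have -> : m.+1%:R * u = (m%:R + 2^-1) * u + 2^-1 * u.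
    by rewrite -[m.+1]addn1 !natrD; lra.
  have -> : k.+1%:R * u = (k%:R + 2^-1) * u + 2^-1 * u.
    by rewrite -[k.+1]addn1 !natrD; lra.
  by [].
move: key qn qk qm e1 e2 e3 e4 e5 e6 e7.
move: (S k.+1%:R) (S m.+1%:R) (S (k%:R + 2^-1)) (S (m%:R + 2^-1)).
move: (S (n.-1%:R + 2^-1)) (S (n%:R + 2^-1)) (S n%:R) (S n.+1%:R).
move: (qprod n.-1) (qprod k) (qprod m) => Qn Qk Qm A B C D E F G H key *.
(* [D] stands for [S n.+1%:R], which vanishes when n + 1 = N; it is eliminated through the identity,
   never divided by. *)
have -> : D = (B * (G * F + H * E) - C * E * F) / (G * H).
  by rewrite -key mulrAC divff ?mul1r// mulf_neq0.
by field; do ?(apply/andP; split).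
Qed.

End SineCoef.

(** * Chebyshev expansion of the recurrence polynomials *)

Section Expansion.
Variables (R : realType) (N : nat).
Hypothesis N0 : (0 < N)%N.
Local Notation a := (acoef R N).
Local Notation b := (bcoef R N).

Lemma bcoef_0 n : b n 0 = 1. Proof. by []. Qed.
Lemma bcoef_n n : b n n = 1. Proof. by rewrite /bcoef eqxx orbT. Qed.

(** Rogers' Fourier expansion with e^(i(n-2k)x) replaced by cos((n-2k)x). The sum over all k from 0
    to n keeps the induction a mere shift of indices; the terms k and n - k carry the same T. *)
Lemma jpoly_expansion n : (n <= N)%N ->
  2 ^+ n *: jpoly a n =
  \sum_(0 <= k < n.+1) b n k *: chebyshevZ R (n%:Z - (2 * k)%:Z).
Proof.
elim/nat_ind2: n => [||n IH0 IH1] nN.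
- by rewrite big_nat1 bcoef_0 expr0 !scale1r /chebyshevZ.
- rewrite big_nat_recl// big_nat1 bcoef_0 bcoef_n !scale1r expr1.
  have eX (m : int) : `|m|%N = 1%N -> chebyshevZ R m = 'X by rewrite /chebyshevZ => ->.
  by rewrite !eX ?scaler_nat ?mulr2n//; lia.
rewrite jpolySS.
have -> : 2 ^+ n.+2 *: ('X * jpoly a n.+1 - a n.+1 ^+ 2 *: jpoly a n) =
    2%:R *: ('X * (2 ^+ n.+1 *: jpoly a n.+1))
    - (4 * a n.+1 ^+ 2) *: (2 ^+ n *: jpoly a n).
  rewrite scalerBr -scalerAr !scalerA; by congr (_ *: _ - _ *: _); rewrite !exprS; ring.
rewrite IH0 ?IH1//; [|lia..].
rewrite mulr_sumr scaler_sumr.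
under eq_bigr do rewrite -scalerAr scalerA mulrC -scalerA chebyshevZ_rec scalerDr.
rewrite big_split /= [X in X + _ - _]big_nat_recl//.
rewrite [X in _ + X - _]big_nat_recr//=.
rewrite [RHS]big_nat_recl// [X in _ = _ + X]big_nat_recr//= scaler_sumr.
rewrite !bcoef_0 !bcoef_n !scale1r.
have eR (x y z u w : {poly R}) : x + y + (z + u) - w = x + (y + z - w + u) by ring.
rewrite eR; congr (_ + (_ + _)).
- by congr (chebyshevZ _ _); lia.
- rewrite -big_split /= -sumrB; apply: eq_big_nat => k /andP[_ kn].
  rewrite (@bcoef_step R N N0 n.+1 k.+1); [|lia..]; rewrite /= scalerA.
  have -> : n.+1%:Z - (2 * k.+1)%:Z + 1 = n.+2%:Z - (2 * k.+1)%:Z by lia.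
  have -> : n.+1%:Z - (2 * k)%:Z - 1 = n.+2%:Z - (2 * k.+1)%:Z by lia.
  have -> : n%:Z - (2 * k)%:Z = n.+2%:Z - (2 * k.+1)%:Z by lia.
  by rewrite -scalerDl -scalerBl.
- by congr (chebyshevZ _ _); lia.
Qed.

Lemma jpoly_last : jpoly a N = (2 ^+ N.-1)^-1 *: chebyshevT R N.
Proof.
have [m Nm] : exists m, N = m.+1 by exists N.-1; lia.
have two (k : nat) : (2 : R) ^+ k != 0 by rewrite expf_neq0.
have := jpoly_expansion (leqnn N).
rewrite [in RHS]big_nat_recl// [X in \sum_(0 <= i < X) _]Nm [X in _ + X]big_nat_recr//=.
rewrite -Nm bcoef_0 bcoef_n !scale1r big_nat big1 ?add0r; last first.
  move=> k /andP[_ km]; rewrite /bcoef (qprodN R N0) mul0r.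
  have -> : ((k.+1 == 0) || (k.+1 == N))%N = false by lia.
  by rewrite scale0r.
have eT (i : int) : `|i|%N = N -> chebyshevZ R i = chebyshevT R N by rewrite /chebyshevZ => ->.
rewrite !eT; [|lia..].
rewrite -mulr2n -[chebyshevT R N *+ 2]scaler_nat => /(congr1 (fun p => (2 ^+ N)^-1 *: p)).
rewrite /= !scalerA mulVf// scale1r => ->; congr (_ *: _).
by rewrite [X in 2 ^+ X]Nm exprS invfM mulrC mulrA divff ?mul1r// Nm.
Qed.

Lemma jpoly_horner n (x : R) : (n <= N)%N ->
  pseq x a n = (2 ^+ n)^-1 *
  \sum_(0 <= k < n.+1) b n k * (chebyshevZ R (n%:Z - (2 * k)%:Z)).[x].
Proof.
move=> nN; rewrite -horner_jpoly.
have := congr1 (fun p => (2 ^+ n)^-1 *: p) (jpoly_expansion nN).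
rewrite /= scalerA mulVf ?expf_neq0// scale1r => ->.
by rewrite hornerZ horner_sum; congr (_ * _); apply: eq_bigr => k _; rewrite hornerZ.
Qed.

Lemma pseq_last (x : R) : pseq x a N = (2 ^+ N.-1)^-1 * (chebyshevT R N).[x].
Proof. by rewrite -horner_jpoly jpoly_last hornerZ. Qed.

Lemma pseq_norm_le n (x : R) : (n <= N)%N -> -1 <= x <= 1 ->
  `|pseq x a n| <= pseq 1 a n.
Proof.
move=> nN x1; rewrite !jpoly_horner// normrM ger0_norm ?invr_ge0 ?exprn_ge0//.
rewrite ler_wpM2l ?invr_ge0 ?exprn_ge0// (le_trans (ler_norm_sum _ _ _))//.
rewrite big_nat [leRHS]big_nat; apply: ler_sum => k /andP[_ kn].
have b0 : 0 <= b n k by apply: bcoef_ge0.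
rewrite normrM ger0_norm// ler_wpM2l//.
by rewrite /chebyshevZ chebyshevT_at1 chebyshevT_norm_le1.
Qed.

Lemma pseq_gt0 n (x : R) : (n <= N)%N -> 1 <= x -> 0 < pseq x a n.
Proof.
move=> nN x1; rewrite jpoly_horner// mulr_gt0 ?invr_gt0 ?exprn_gt0//.
rewrite big_nat_recl// ltr_pwDl//.
  by rewrite bcoef_0 mul1r (lt_le_trans ltr01)// chebyshevT_ge1.
rewrite big_nat sumr_ge0// => k /andP[_ kn]; rewrite mulr_ge0 ?bcoef_ge0//.
by rewrite (le_trans ler01)// chebyshevT_ge1.
Qed.

Lemma pseq_acoef_mirror n s (x : R) : (s <= n)%N ->
  n.+1 = N -> pseq x (fun i => a (s.+1 + i)%N) (n - s) = pseq x a (n - s).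
Proof.
move=> sn nN; rewrite -(@pseq_mirror _ _ a N (n - s)); [|move=> i iN; exact: acoef_mirror|lia].
by apply: pseq_ext => i _; do 2 f_equal; lia.
Qed.

End Expansion.

(** * The method on quadratics and its first-variation kernel *)

Section Method.
Variables (R : realType) (mu L : R).
Hypotheses (hmu : 0 < mu) (hL : mu < L).
Local Notation e := (Defs.eta mu L).
Local Notation z := (zmap mu L).

Lemma Delta_gt0 : 0 < Delta mu L. Proof. by rewrite /Delta subr_gt0. Qed.

Lemma eta_gt1 : 1 < e.
Proof. rewrite /Defs.eta ltr_pdivlMr ?subr_gt0// mul1r; have mu0 := hmu; lra. Qed.

Lemma zmap_mu : z mu = 1.
Proof.
have D0 := Delta_gt0; rewrite /zmap /Defs.eta -/(Delta mu L) -mulrBl.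
by apply: (canLR (mulfK _)); rewrite ?gt_eqF// /Delta mul1r; ring.
Qed.

Lemma zmap_itv lam : mu <= lam <= L -> -1 <= z lam <= 1.
Proof.
move=> lamI; have D0 := Delta_gt0; rewrite /zmap /Defs.eta -/(Delta mu L) -mulrBl.
by rewrite ler_pdivlMr// ler_pdivrMr// /Delta; have [mu0 muL] := (hmu, hL); lra.
Qed.

Lemma derive1_quadratic (lam x : R) :
  derive1 (fun x => 2^-1 * lam * x ^+ 2) x = lam * x.
Proof.
rewrite derive1E derive_val /GRing.scale /=.
by lra.
Qed.

Variables (a : nat -> R) (N : nat).
Local Notation p := (pseq e a).
Hypothesis pN0 : forall s, (s <= N)%N -> p s != 0.

(** On a quadratic the momentum and gradient terms merge into z(lambda), so p_s(eta) x_s obeys the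
    recurrence of p_s evaluated at z(lambda). *)
Lemma stepE lam s : (s < N)%N ->
  e * p s / p s.+1 - gamma mu L a s * lam = z lam * (p s / p s.+1).
Proof.
move=> sN; have D0 := Delta_gt0; have p1 := pN0 sN; have D1 : Delta mu L != 0 by rewrite gt_eqF.
by rewrite /gamma /zmap; field; rewrite p1 D1.
Qed.

(** As p_1 = eta, the coefficient eta p_0 / p_1 is 1: the separate first step fits the general
    pattern. *)
Lemma step0E lam : (0 < N)%N -> 1 - gamma mu L a 0 * lam = z lam / p 1%N.
Proof.
move=> N0; have := stepE lam N0; have p1 := pN0 N0.
by rewrite /= in p1 *; rewrite mulr1 divff// mul1r.
Qed.

Lemma method_quadratic lam x0 s : (s <= N)%N ->
  method mu L a (fun x => 2^-1 * lam * x ^+ 2) x0 s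
  = pseq (z lam) a s / p s * x0.
Proof.
elim/nat_ind2: s => [_|N0|s IH0 IH1 sN].
- by rewrite /= divr1 mul1r.
- have -> : method mu L a (fun x => 2^-1 * lam * x ^+ 2) x0 1
     = x0 - 2 / (L + mu) * derive1 (fun x => 2^-1 * lam * x ^+ 2) x0 by [].
  rewrite derive1_quadratic.
  have -> : pseq (z lam) a 1 / p 1%N = z lam / p 1%N by [].
  rewrite -step0E// /gamma.
  have -> : 2 * p 0%N / (Delta mu L * p 1%N) = 2 / (L + mu).
    have D0 := Delta_gt0; have LM : 0 < L + mu by have [mu0 muL] := (hmu, hL); lra.
    rewrite /= mulr1 /Defs.eta -/(Delta mu L); congr (_ / _).
    by rewrite mulrC divfK// gt_eqF.
  by ring.
- have -> : method mu L a (fun x => 2^-1 * lam * x ^+ 2) x0 s.+2 =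
    e * p s.+1 / p s.+2 * method mu L a (fun x => 2^-1 * lam * x ^+ 2) x0 s.+1
    - a s.+1 ^+ 2 * p s / p s.+2 * method mu L a (fun x => 2^-1 * lam * x ^+ 2) x0 s
    - 2 * p s.+1 / (Delta mu L * p s.+2) * derive1 (fun x => 2^-1 * lam * x ^+ 2)
      (method mu L a (fun x => 2^-1 * lam * x ^+ 2) x0 s.+1) by [].
  rewrite derive1_quadratic IH0 ?IH1 ?(ltnW sN) ?(ltnW (ltnW sN))//.
  have := stepE lam sN; rewrite /gamma => st.
  rewrite [pseq (z lam) a s.+2]pseqSS; have [p1 p2 p3] : [/\ p s != 0, p s.+1 != 0 & p s.+2 != 0].
    by rewrite !pN0 ?(ltnW sN) ?(ltnW (ltnW sN)).
  set G := pseq (z lam) a s.+1; set G' := pseq (z lam) a s.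
  transitivity ((e * p s.+1 / p s.+2 - 2 * p s.+1 / (Delta mu L * p s.+2) * lam)
     * (G / p s.+1 * x0) - a s.+1 ^+ 2 * p s / p s.+2 * (G' / p s * x0)); first by ring.
  rewrite st; move: p1 p2 p3; move: (p s) (p s.+1) (p s.+2) => P1 P2 P3 *.
  by field; do ?(apply/andP; split).
Qed.

Lemma CprodS m q lam : (m <= q)%N ->
  Cprod mu L a m q.+1 lam = Cmx mu L a q lam * Cprod mu L a m q lam.
Proof.
move=> mq; rewrite /Cprod /index_iota subSn// -[(q - m).+1]addn1 iotaD rev_cat /= subnKC//.
by rewrite big_cons.
Qed.

Lemma Cprod_nil m lam : Cprod mu L a m m lam = 1.
Proof. by rewrite /Cprod /index_iota subnn big_nil. Qed.

Local Notation ord1 := (lift ord0 ord0 : 'I_2).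

Lemma mx22M_col (x y u v : R) (X : 'M[R]_2) :
  (mx22 x y u v * X) ord0 ord0 = x * X ord0 ord0 + y * X ord1 ord0 /\
  (mx22 x y u v * X) ord1 ord0 = u * X ord0 ord0 + v * X ord1 ord0.
Proof. by split; rewrite mxE !big_ord_recl big_ord0 addr0 !mxE. Qed.

(** The product acts on (1, 0), and the zero removes the coefficient a_(s+1); what runs from there
    on is the recurrence of the associated polynomials, with shifted coefficients. The lower entry
    keeps the previous iterate and is needed for the induction. *)
Lemma Cprod_tail s k lam : (s.+1 + k <= N)%N ->
  Cprod mu L a s.+1 (s.+1 + k) lam ord0 ord0
    = p s.+1 / p (s.+1 + k)%N * pseq (z lam) (fun i => a (s.+1 + i)%N) k /\
  Cprod mu L a s.+1 (s.+1 + k) lam ord1 ord0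
    = if k is k1.+1 then
        p s.+1 / p (s.+1 + k1)%N * pseq (z lam) (fun i => a (s.+1 + i)%N) k1
      else 0.
Proof.
elim: k => [|k IH] skN.
  have p1 : p s.+1 != 0 by rewrite pN0// -(addn0 s.+1).
  by rewrite addn0 Cprod_nil !mxE divff// mul1r; split.
have [IH0 IH1] := IH ltac:(lia).
rewrite addnS CprodS ?leq_addr//.
have Cm : Cmx mu L a (s.+1 + k) lam = mx22 (z lam * (p (s.+1 + k)%N / p (s.+1 + k).+1))
   (- (a (s.+1 + k)%N ^+ 2 * p (s + k)%N / p (s.+1 + k).+1)) 1 0.
  by rewrite -stepE//; lia.
rewrite Cm.
have [-> ->] := mx22M_col (z lam * (p (s.+1 + k)%N / p (s.+1 + k).+1))
   (- (a (s.+1 + k)%N ^+ 2 * p (s + k)%N / p (s.+1 + k).+1)) 1 0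
   (Cprod mu L a s.+1 (s.+1 + k) lam).
rewrite IH0 mul1r mul0r addr0; split => //.
have P1 : p (s.+1 + k)%N != 0 by rewrite pN0//; lia.
have P2 : p (s.+1 + k).+1 != 0 by rewrite pN0//; lia.
rewrite IH1; case: k {IH IH0 IH1 Cm} skN P1 P2 => [|k] skN P1 P2.
  rewrite addn0 in P1 P2; rewrite !addn0 mulr0 addr0.
  rewrite -[pseq (z lam) _ 0]/(1 : R) -[pseq (z lam) _ 1]/(z lam).
  move: P1 P2; move: (p s.+1) (p s.+2) => *.
  by field; do ?(apply/andP; split).
rewrite [pseq (z lam) _ k.+2]pseqSS.
have P3 : p (s.+1 + k)%N != 0 by rewrite pN0//; lia.
have -> : (s + k.+1 = s.+1 + k)%N by lia.
move: P1 P2 P3; move: (p (s.+1 + k)%N) (p (s.+1 + k.+1)%N) (p (s.+1 + k.+1).+1) => *.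
by field; do ?(apply/andP; split).
Qed.

Lemma Cprod_head s lam : (s <= N)%N ->
  Cprod mu L a 0 s lam ord0 ord0 = pseq (z lam) a s / p s /\
  Cprod mu L a 0 s lam ord1 ord0 =
    if s is s1.+1 then pseq (z lam) a s1 / p s1 else 0.
Proof.
elim: s => [|s IH] sN; first by rewrite Cprod_nil !mxE /= divr1.
have [IH0 IH1] := IH (ltnW sN); rewrite CprodS//.
case: s IH0 IH1 {IH} sN => [|s] IH0 IH1 sN.
  have [-> ->] := mx22M_col (1 - gamma mu L a 0 * lam) 0 1 0 (Cprod mu L a 0 0 lam).
  by rewrite IH0 step0E// /= divr1 !mul0r !addr0 mulr1 mul1r.
have Cm : Cmx mu L a s.+1 lam = mx22 (z lam * (p s.+1 / p s.+2))
   (- (a s.+1 ^+ 2 * p s / p s.+2)) 1 0 by rewrite -stepE.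
rewrite Cm; have [-> ->] := mx22M_col (z lam * (p s.+1 / p s.+2))
   (- (a s.+1 ^+ 2 * p s / p s.+2)) 1 0 (Cprod mu L a 0 s.+1 lam).
rewrite IH0 IH1 mul1r mul0r addr0; split => //.
have [p1 p2 p3] : [/\ p s != 0, p s.+1 != 0 & p s.+2 != 0].
  by rewrite !pN0 ?(ltnW sN) ?(ltnW (ltnW sN)).
rewrite [pseq (z lam) a s.+2]pseqSS; move: p1 p2 p3; move: (p s) (p s.+1) (p s.+2) => *.
by field; do ?(apply/andP; split).
Qed.

(** The normalizations p_s and p_(s+1) of the head, the tail and gamma_s cancel; only p_N is
    left. *)
Lemma kernelKE s lam nu : (s < N)%N ->
  kernelK mu L a N s lam nu = - (2 / (Delta mu L * p N)) *
    (pseq (z lam) (fun i => a (s.+1 + i)%N) (N - s.+1) * pseq (z nu) a s).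
Proof.
move=> sN; rewrite /kernelK.
have [-> _] := Cprod_head nu (ltnW sN).
have := @Cprod_tail s (N - s.+1) lam; rewrite subnKC// => /(_ (leqnn N))[-> _].
have D0 : Delta mu L != 0 by rewrite gt_eqF// Delta_gt0.
have [p1 p2 p3] : [/\ p s != 0, p s.+1 != 0 & p N != 0].
  by rewrite !pN0 ?(ltnW sN).
rewrite /gamma; move: p1 p2 p3; move: (p s) (p s.+1) (p N) => *.
by field; do ?(apply/andP; split).
Qed.

End Method.

(** * Jacobi matrices *)

(** Comparison of the coefficients of X^n in Lagrange's interpolation formula for r at the zeros of
    P. *)
Lemma lagrange_lead (F : fieldType) (n : nat) (P r : {poly F}) (z : 'I_n.+1 -> F) :
  P \is monic -> size P = n.+2 -> injective z ->
  (forall j, P.[z j] = 0) -> (forall j, (P^`()).[z j] != 0) ->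
  (size r <= n.+1)%N ->
  \sum_j r.[z j] / (P^`()).[z j] = r`_n.
Proof.
move=> mP sP zI Pz P'z sr.
have /choice [M PM] : forall j, exists M, P = M * ('X - (z j)%:P).
  by move=> j; apply/factor_theorem/rootP.
have Mneq0 j : M j != 0.
  by apply: contraTneq mP => M0; rewrite (PM j) M0 mul0r monicE lead_coef0 eq_sym oner_eq0.
have sM j : size (M j) = n.+1.
  by have := sP; rewrite (PM j) size_Mmonic ?monicXsubC// size_XsubC addn2; case.
have mM j : M j \is monic.
  by have := mP; rewrite (PM j) monicMr// monicXsubC.
have MP' j : (M j).[z j] = (P^`()).[z j].
  by rewrite (PM j) derivM derivXsubC !hornerE subrr mulr0 add0r.
have M0 j k : k != j -> (M j).[z k] = 0.
  move=> kj; have := Pz k; rewrite (PM j) hornerM hornerXsubC => /eqP.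
  by rewrite mulf_eq0 subr_eq0 (inj_eq zI) (negbTE kj) orbF => /eqP.
pose Q := \sum_j (r.[z j] / (P^`()).[z j]) *: M j.
have sQ : (size Q <= n.+1)%N.
  apply: (leq_trans (size_sum _ _ _)); apply/bigmax_leqP => j _.
  by rewrite (leq_trans (size_scale_leq _ _))// sM.
have QE : r = Q.
  apply/eqP; rewrite -subr_eq0; apply/eqP.
  apply: (@roots_geq_poly_eq0 _ _ [seq z j | j <- enum 'I_n.+1]).
  - apply/allP => _ /mapP[k _ ->]; rewrite rootE hornerD hornerN /Q horner_sum.
    rewrite (bigD1 k)//= big1 ?addr0 ?hornerZ ?MP' ?divfK ?subrr// => j jk.
    by rewrite hornerZ M0 ?mulr0// eq_sym.
  - by rewrite map_inj_uniq// enum_uniq.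
  - rewrite size_map size_enum_ord (leq_trans (size_polyD _ _))//.
    by rewrite size_polyN geq_max sr sQ.
rewrite [in RHS]QE /Q coef_sum; apply: eq_bigr => j _; rewrite coefZ.
by have := mM j; rewrite monicE lead_coefE sM => /eqP ->; rewrite mulr1.
Qed.

(** In the confluent Christoffel-Darboux formula this is a sum of squares whose last term is a
    positive constant. At a zero of p_N it shows that p_N' and p_(N-1) have the same sign, so the
    zero is simple and its weight positive. *)
Lemma christoffel_darboux_gt0 (R : realDomainType) (a : nat -> R) (x : R) (s : nat) :
  (forall i, (0 < i <= s)%N -> 0 < a i) ->
  0 < ((jpoly a s.+1)^`()).[x] * (jpoly a s).[x]
      - (jpoly a s.+1).[x] * ((jpoly a s)^`()).[x].
Proof.
elim: s => [|s IH] a0.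
  by rewrite derivX derivC !(hornerC, hornerX) mulr0 subr0 mulr1 ltr01.
rewrite jpolySS derivB derivZ derivM derivX mul1r.
rewrite !(hornerD, hornerN, hornerZ, hornerM, hornerX).
have {}IH := IH (fun i hi => a0 i ltac:(lia)).
move: IH; set p1 := (jpoly a s.+1).[x]; set p0 := (jpoly a s).[x].
set d1 := (_ ^`()).[x]; set d0 := ((jpoly a s) ^`()).[x] => IH.
have -> : (p1 + x * d1 - a s.+1 ^+ 2 * d0) * p1 - (x * p1 - a s.+1 ^+ 2 * p0) * d1
  = p1 ^+ 2 + a s.+1 ^+ 2 * (d1 * p0 - p1 * d0) by ring.
by rewrite ltr_wpDl ?sqr_ge0// mulr_gt0// exprn_gt0// a0 ?leqnn.
Qed.

Section Jacobi.
Variables (R : realType) (n : nat) (a : nat -> R).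
Hypothesis a_gt0 : forall s, (0 < s <= n)%N -> 0 < a s.
Hypothesis a_mirror : forall s, (0 < s <= n)%N -> a (n.+1 - s)%N = a s.

Definition jmx : 'M[R]_n.+1 :=
  \matrix_(i, j) if j == i.+1 :> nat then a j else
                 if i == j.+1 :> nat then a i else 0.

(** The norm of the monic polynomial p_s in the spectral measure at e_0, so that p_s / rprod s is
    orthonormal. *)
Definition rprod s : R := \prod_(0 <= j < s) a j.+1.

Local Notation P := (jpoly a).

Lemma rprod0 : rprod 0 = 1. Proof. by rewrite /rprod big_geq. Qed.

Lemma rprodS s : rprod s.+1 = rprod s * a s.+1.
Proof. by rewrite /rprod big_nat_recr. Qed.

Lemma rprod_gt0 s : (s <= n)%N -> 0 < rprod s.
Proof.
elim: s => [|s IH] sn; first by rewrite rprod0.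
by rewrite rprodS mulr_gt0 ?IH ?a_gt0// ltnW.
Qed.

Lemma rprod_mirror s : (s <= n)%N -> rprod s * rprod (n - s) = rprod n.
Proof.
elim: s => [|s IH] sn; first by rewrite rprod0 mul1r subn0.
have [m mE] : exists m, (n - s)%N = m.+1 by exists (n - s.+1)%N; lia.
rewrite -(IH (ltnW sn)) mE !rprodS.
have -> : (n - s.+1)%N = m by lia.
have -> : m.+1 = (n.+1 - s.+1)%N by lia.
by rewrite a_mirror ?mulrA; [ring | lia].
Qed.

Lemma jmx_tr : jmx^T = jmx.
Proof.
apply/matrixP => i j; rewrite !mxE.
case: eqVneq => [ij|ij]; case: eqVneq => [ji|ji] //.
by exfalso; lia.
Qed.

Lemma jmx_is_jacobi : is_jacobi jmx.
Proof.
split; first exact: jmx_tr.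
- move=> i j ij; rewrite mxE.
  have -> : (j == i.+1 :> nat) = false by lia.
  by have -> : (i == j.+1 :> nat) = false by lia.
- move=> i j ij; rewrite mxE ij eqxx a_gt0//.
  by have := ltn_ord j; rewrite ij; lia.
Qed.

Lemma sum_jmx (y : nat -> R) (i : 'I_n.+1) :
  \sum_(j < n.+1) jmx i j * y j =
  (if (0 < i)%N then a i * y i.-1 else 0) + (if (i < n)%N then a i.+1 * y i.+1 else 0).
Proof.
have E j : jmx i j * y j = (if j == i.+1 :> nat then a i.+1 * y i.+1 else 0)
   + (if i == j.+1 :> nat then a i * y i.-1 else 0).
  rewrite mxE; case: eqVneq => [ji|ji].
    have -> : (i == j.+1 :> nat) = false by lia.
    by rewrite ji addr0.
  case: eqVneq => [ij|ij]; last by rewrite mul0r addr0.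
  by rewrite add0r; do 2 f_equal; lia.
under eq_bigr do rewrite E.
rewrite big_split /= addrC; congr (_ + _).
- case: ltnP => i0.
    have i1n : (i.-1 < n.+1)%N by have := ltn_ord i; lia.
    rewrite (bigD1 (Ordinal i1n))//= prednK// eqxx big1 ?addr0// => j ji.
    case: eqVneq => // ij; exfalso; move/eqP: ji; apply; apply: val_inj => /=; lia.
  by rewrite big1// => j _; case: eqVneq => // ij; exfalso; lia.
- case: ltnP => i0.
    rewrite (bigD1 (Ordinal (i0 : (i.+1 < n.+1)%N)))//= eqxx big1 ?addr0// => j ji.
    case: eqVneq => // ij; exfalso; move/eqP: ji; apply; apply: val_inj => /=; lia.
  by rewrite big1// => j _; case: eqVneq => // ij; exfalso; have := ltn_ord j; lia.
Qed.

Lemma horner_mx_sym (J : 'M[R]_n.+1) (p : {poly R}) : J^T = J ->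
  (horner_mx J p)^T = horner_mx J p.
Proof.
move=> JT; elim/poly_ind: p => [|p c IH]; first by rewrite rmorph0 trmx0.
rewrite rmorphD rmorphM /= horner_mx_X horner_mx_C linearD /= tr_scalar_mx.
have C : horner_mx J p * J = J * horner_mx J p.
  by have := congr1 (horner_mx J) (mulrC p 'X); rewrite !rmorphM /= !horner_mx_X.
by congr (_ + _); rewrite -mulmxE trmx_mul IH JT !mulmxE C.
Qed.

Lemma horner_mxM_00 (J : 'M[R]_n.+1) (p q : {poly R}) : J^T = J ->
  horner_mx J (p * q) ord0 ord0 =
  \sum_i horner_mx J p i ord0 * horner_mx J q i ord0.
Proof.
move=> JT; rewrite rmorphM -mulmxE mxE; apply: eq_bigr => i _.
congr (_ * _); have /matrixP/(_ i ord0) := horner_mx_sym p JT.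
by rewrite mxE.
Qed.

Lemma horner_mx_jpolySS (J : 'M[R]_n.+1) s i :
  horner_mx J (P s.+2) i ord0 =
  \sum_j J i j * horner_mx J (P s.+1) j ord0 - a s.+1 ^+ 2 * horner_mx J (P s) i ord0.
Proof.
rewrite jpolySS rmorphB rmorphM /= horner_mx_X linearZ /= -mulmxE !mxE.
by [].
Qed.

Lemma horner_mx_jpoly0 (J : 'M[R]_n.+1) i :
  horner_mx J (P 0) i ord0 = (i == ord0)%:R.
Proof. by rewrite rmorph1 mxE. Qed.

Lemma horner_mx_jpoly1 (J : 'M[R]_n.+1) i :
  horner_mx J (P 1) i ord0 = J i ord0.
Proof. by rewrite /= horner_mx_X. Qed.

Lemma sum_delta (y : 'I_n.+1 -> R) (c : R) s (sn : (s < n.+1)%N) :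
  \sum_j y j * (if j == s :> nat then c else 0) = y (Ordinal sn) * c.
Proof.
rewrite (bigD1 (Ordinal sn))//= eqxx big1 ?addr0// => j js.
case: eqVneq => [e|]; last by rewrite mulr0.
by exfalso; move/eqP: js; apply; exact: val_inj.
Qed.

Lemma horner_jmx_jpoly s (i : 'I_n.+1) : (s <= n)%N ->
  horner_mx jmx (P s) i ord0 = if i == s :> nat then rprod s else 0.
Proof.
elim/nat_ind2: s i => [i _|i n0|s IH0 IH1 i sn].
- by rewrite horner_mx_jpoly0 rprod0 -val_eqE /=; case: eqP.
- rewrite horner_mx_jpoly1 mxE /= rprodS rprod0 mul1r.
  by case: eqVneq => [->|].
have s0 : (s < n.+1)%N by lia.
have s1 : (s.+1 < n.+1)%N by lia.
rewrite horner_mx_jpolySS IH0; last by lia.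
under eq_bigr do rewrite IH1 ?(ltnW sn)//.
rewrite (sum_delta (jmx i) (rprod s.+1) s1) mxE /= !rprodS.
case: (eqVneq (i : nat) s.+2) => [->|is2].
  have -> : (s.+1 == s.+3)%N = false by lia.
  have -> : (s.+2 == s)%N = false by lia.
  by rewrite mulr0 subr0 mulrC.
case: (eqVneq (i : nat) s) => [->|isn].
  by rewrite eqxx expr2; ring.
have -> : (s.+1 == i.+1)%N = false by lia.
by rewrite mul0r mulr0 subr0.
Qed.

(** The recurrence leads to site N, which the matrix does not have: Cayley-Hamilton applied to
    e_0. *)
Lemma horner_jmx_jpoly_last (i : 'I_n.+1) : horner_mx jmx (P n.+1) i ord0 = 0.
Proof.
have [n0|[m nm]] : n = 0%N \/ exists m, n = m.+1.
  by case: (n) => [|m]; [left | right; exists m].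
- have -> : P n.+1 = P 1 by rewrite n0.
  rewrite horner_mx_jpoly1 mxE /=.
  by have -> : (i == 1%N :> nat) = false by have := ltn_ord i; lia.
have mn : (m < n.+1)%N by lia.
have mn1 : (m.+1 < n.+1)%N by lia.
have -> : P n.+1 = P m.+2 by rewrite nm.
rewrite horner_mx_jpolySS horner_jmx_jpoly; last by lia.
have mn2 : (m.+1 <= n)%N by lia.
under eq_bigr do rewrite (horner_jmx_jpoly _ mn2).
rewrite (sum_delta (jmx i) (rprod m.+1) mn1) mxE /= rprodS.
have -> : (i == m.+2 :> nat) = false by have := ltn_ord i; lia.
have -> : (m.+1 == i.+1)%N = (i == m :> nat) by rewrite eqSS eq_sym.
by case: eqVneq => _; [ring | rewrite mul0r mulr0 subr0].
Qed.

Lemma horner_jmx_orthogonal s t : (s <= n)%N -> (t <= n)%N ->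
  horner_mx jmx (P s * P t) ord0 ord0 = if s == t then rprod s ^+ 2 else 0.
Proof.
move=> sn tn; rewrite (horner_mxM_00 _ _ jmx_tr).
under eq_bigr do rewrite (horner_jmx_jpoly _ tn).
rewrite (sum_delta (fun i => horner_mx jmx (P s) i ord0) (rprod t) (tn : (t < n.+1)%N)).
rewrite horner_jmx_jpoly//= eq_sym; case: eqVneq => [->|_]; last by rewrite mul0r.
by rewrite expr2.
Qed.

(** By induction p_s(J) e_0 = rprod s e_s: the band structure kills the entries beyond s, equality
    of moments makes the vector orthogonal to the earlier e_i and fixes its norm, and positivity of
    the off-diagonal entries fixes its sign. The entries of J are then read off from the moments of
    X p_t p_s. *)
Lemma jacobi_unique (J : 'M[R]_n.+1) : is_jacobi J ->
  (forall p, horner_mx J p ord0 ord0 = horner_mx jmx p ord0 ord0) -> J = jmx.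
Proof.
move=> [JT Jband Jpos] JE.
have V s : (s <= n)%N -> forall t, (t <= s)%N -> forall i,
    horner_mx J (P t) i ord0 = if i == t :> nat then rprod t else 0.
  elim: s => [_ t|s IH sn t]; rewrite ?leqn0.
    move=> /eqP -> i; rewrite horner_mx_jpoly0 rprod0 -val_eqE /=.
    by case: eqP.
  have {}IH := IH (ltnW sn).
  rewrite leq_eqVlt ltnS => /predU1P[->{t}|ts]; last exact: IH.
  have s0 : (s < n.+1)%N by lia.
  have step (i : 'I_n.+1) : (s < i)%N ->
      horner_mx J (P s.+1) i ord0 = J i (Ordinal s0) * rprod s.
    case: s s0 IH {sn} => [|s] s0 IH si.
      rewrite horner_mx_jpoly1 rprod0 mulr1; congr (J i _); exact: val_inj.
    rewrite horner_mx_jpolySS IH// [(i : nat) == s]gtn_eqF ?mulr0 ?subr0; last by lia.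
    under eq_bigr do rewrite IH//.
    by rewrite (sum_delta (J i) (rprod s.+1) s0).
  have big (i : 'I_n.+1) : (s.+1 < i)%N -> horner_mx J (P s.+1) i ord0 = 0.
    move=> si; rewrite step; last by lia.
    by have /matrixP/(_ i (Ordinal s0)) := JT; rewrite mxE => <-; rewrite Jband ?mul0r.
  have small (i : 'I_n.+1) : (i <= s)%N -> horner_mx J (P s.+1) i ord0 = 0.
    move=> si; have := JE (P s.+1 * P i).
    rewrite horner_jmx_orthogonal ?(leq_trans si (ltnW sn))//.
    have -> : (s.+1 == i)%N = false by lia.
    rewrite (horner_mxM_00 _ _ JT).
    under eq_bigr do rewrite (IH i si).
    rewrite (sum_delta (fun k => horner_mx J (P s.+1) k ord0) (rprod i) (ltn_ord i)).
    move/eqP; rewrite mulf_eq0 => /orP[/eqP|].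
      by move=> <-; congr (horner_mx J _ _ _); exact: val_inj.
    by rewrite gt_eqF// rprod_gt0//; have := ltn_ord i; lia.
  have off (i : 'I_n.+1) : i != s.+1 :> nat -> horner_mx J (P s.+1) i ord0 = 0.
    move=> is1; have [/small//|si] := leqP i s; apply: big; lia.
  move=> i; case: eqVneq => [is1|/off//].
  have pos : 0 < horner_mx J (P s.+1) i ord0.
    rewrite step ?is1// mulr_gt0 ?rprod_gt0 ?(ltnW sn)//.
    by have /matrixP/(_ i (Ordinal s0)) := JT; rewrite mxE => <-; exact: Jpos.
  have := JE (P s.+1 * P s.+1); rewrite horner_jmx_orthogonal// eqxx.
  rewrite (horner_mxM_00 _ _ JT) (bigD1 i)//= big1 ?addr0 => [|k ki]; last first.
    by rewrite off ?mul0r// -is1; apply: contraNneq ki => ki; apply/eqP/val_inj.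
  rewrite -expr2 => /eqP; rewrite eqrXn2 ?(ltW pos) ?ltW ?rprod_gt0// => /eqP.
  by [].
have {}V s i (sn : (s <= n)%N) := V s sn s (leqnn s) i.
apply/matrixP => s t.
have sn : (s <= n)%N by have := ltn_ord s; lia.
have tn : (t <= n)%N by have := ltn_ord t; lia.
have E (K : 'M[R]_n.+1) : K^T = K -> (forall s i, (s <= n)%N ->
    horner_mx K (P s) i ord0 = if i == s :> nat then rprod s else 0) ->
    horner_mx K (('X * P t) * P s) ord0 ord0 = K s t * rprod t * rprod s.
  move=> KT KV; rewrite (horner_mxM_00 _ _ KT).
  under eq_bigr do rewrite (KV s _ sn).
  rewrite (sum_delta (fun k => horner_mx K ('X * P t) k ord0) (rprod s) (ltn_ord s)).
  congr (_ * _); rewrite rmorphM /= horner_mx_X -mulmxE mxE.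
  under eq_bigr do rewrite (KV t _ tn).
  rewrite (sum_delta (K _) (rprod t) (ltn_ord t)).
  by congr (K _ _ * _); exact: val_inj.
have := JE (('X * P t) * P s).
rewrite (E J JT (fun s i sn => V s i sn)) (E jmx jmx_tr (fun s i sn => horner_jmx_jpoly i sn)).
by move/(mulIf _)/(mulIf _); apply; rewrite gt_eqF// rprod_gt0.
Qed.

(** Division by p_N, then expansion of the remainder in the basis p_0, ..., p_(N-1), on which both
    functionals are known. *)
Lemma jmx_functional (m : {poly R} -> R) :
  {morph m : p q / p + q} -> (forall c p, m (c *: p) = c * m p) ->
  (forall q, m (q * P n.+1) = 0) ->
  (forall s, (s <= n)%N -> m (P s) = (s == 0%N)%:R) ->
  forall p, horner_mx jmx p ord0 ord0 = m p.
Proof.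
move=> mD mZ mq mP.
have m0 : m 0 = 0 by have := mZ 0 0; rewrite scale0r mul0r.
have H k (r : {poly R}) : (k <= n.+1)%N -> (size r <= k)%N -> horner_mx jmx r ord0 ord0 = m r.
  elim: k r => [|k IH] r kn.
    by rewrite leqn0 size_poly_eq0 => /eqP ->; rewrite rmorph0 mxE m0.
  move=> sr; pose r' := r - r`_k *: P k.
  have sr' : (size r' <= k)%N.
    apply/leq_sizeP => j kj; rewrite coefB coefZ.
    move: kj; rewrite leq_eqVlt => /predU1P[<-|kj].
      have := jpoly_monic a k; rewrite monicE lead_coefE size_jpoly => /eqP ->.
      by rewrite mulr1 subrr.
    have Pj : (size (P k) <= j)%N by rewrite size_jpoly.
    by rewrite (nth_default 0 (leq_trans sr kj)) (nth_default 0 Pj) mulr0 subrr.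
  have -> : r = r' + r`_k *: P k by rewrite /r' subrK.
  rewrite mD mZ rmorphD /= linearZ mP; last by lia.
  rewrite -(IH r' (ltnW kn) sr') !mxE horner_jmx_jpoly; last by lia.
  rewrite [ord0 == _ :> nat]/= eq_sym; case: eqVneq => // ->; by rewrite rprod0.
move=> p; have mon := jpoly_monic a n.+1.
rewrite (Pdiv.RingMonic.rdivp_eq mon p).
set q := Pdiv.CommonRing.rdivp p _; set r := Pdiv.CommonRing.rmodp p _.
rewrite rmorphD mD /= mq add0r mxE (horner_mxM_00 _ _ jmx_tr) big1 ?add0r.
  apply: (H n.+1) => //; rewrite -ltnS -(size_jpoly a n.+1).
  by rewrite Pdiv.CommonRing.ltn_rmodpN0 // monic_neq0.
by move=> i _; rewrite horner_jmx_jpoly_last mulr0.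
Qed.

End Jacobi.

(** * Resolvent of a mirror-symmetric Jacobi matrix *)

Section Green.
Variables (R : realType) (n : nat) (a : nat -> R).
Hypothesis a_gt0 : forall s, (0 < s <= n)%N -> 0 < a s.
Hypothesis a_mirror : forall s, (0 < s <= n)%N -> a (n.+1 - s)%N = a s.
Variable x : R.
Local Notation p := (pseq x a).
Local Notation rp := (rprod a).

(** [u] solves (x - J) u = 0 in every row but the last, its reflection [v] in every row but the
    first; [w] is the defect in the exceptional row and also the Wronskian of the two. *)
Let u i := p i / rp i.
Let v i := u (n - i)%N.
Let w := p n.+1 / rp n.

Let uS i : (i <= n)%N ->
  p i.+1 / rp i = x * u i - (if (0 < i)%N then a i * u i.-1 else 0).
Proof.
case: i => [_|i si]; first by rewrite /u /= rprod0 !divr1 subr0 !mulr1.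
rewrite pseqSS /u /= rprodS mulrBl; congr (_ - _); first by rewrite mulrA.
have r0 : rp i != 0 by rewrite gt_eqF// (rprod_gt0 a_gt0)// ltnW.
have a0 : a i.+1 != 0 by rewrite gt_eqF// a_gt0.
by field; rewrite r0 a0.
Qed.

Let uS' i : (i < n)%N -> p i.+1 / rp i = a i.+1 * u i.+1.
Proof.
move=> si; rewrite /u rprodS.
have r0 : rp i != 0 by rewrite gt_eqF// (rprod_gt0 a_gt0)// ltnW.
have a0 : a i.+1 != 0 by rewrite gt_eqF// a_gt0.
by move: r0 a0; move: (p i.+1) (rp i) (a i.+1) => *; field; apply/andP; split.
Qed.

Let vS i : (i <= n)%N -> x * v i - (if (i < n)%N then a i.+1 * v i.+1 else 0) =
   if i is i1.+1 then a i * v i1 else w.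
Proof.
move=> si; have ni : (n - i <= n)%N by lia.
have := uS ni.
have -> : (0 < n - i)%N = (i < n)%N by lia.
have -> : (if (i < n)%N then a (n - i)%N * u (n - i).-1 else 0)
   = (if (i < n)%N then a i.+1 * v i.+1 else 0).
  case: ifP => // lt_in; rewrite /v -a_mirror; last by lia.
  by congr (a _ * u _); lia.
rewrite -/(v i) => <-; case: i si ni => [|i] si ni; first by rewrite subn0.
rewrite uS'; last by lia.
rewrite /v -(a_mirror (s := i.+1)); last by lia.
by congr (a _ * u _); lia.
Qed.

(** The usual expression a_(k+1) (u_(k+1) v_k - u_k v_(k+1)), with p_(k+1) / rprod k in place of
    a_(k+1) u_(k+1), so that k = n makes sense as well. *)
Let wronskian k : (k <= n)%N ->
  p k.+1 / rp k * v k - (if (k < n)%N then a k.+1 * u k * v k.+1 else 0) = w.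
Proof.
elim: k => [|k IH] kn.
  have := vS kn; rewrite /u /= rprod0 !divr1 !mulr1 => <-.
  by case: ifP => _; ring.
rewrite -(IH (ltnW kn)) kn uS// /= uS'//.
have := vS kn; rewrite mulrBl.
set c := (if (k.+1 < n)%N then a k.+2 * v k.+2 else 0).
have -> : (if (k.+1 < n)%N then a k.+2 * u k.+1 * v k.+2 else 0) = u k.+1 * c.
  by rewrite /c; case: ifP => _; ring.
move=> /(congr1 (fun t => u k.+1 * t)) /= e.
have -> : x * u k.+1 * v k.+1 - a k.+1 * u k * v k.+1 - u k.+1 * c =
   u k.+1 * (x * v k.+1 - c) - a k.+1 * u k * v k.+1 by ring.
by rewrite e; ring.
Qed.

Lemma jmx_green (s : 'I_n.+1) : p n.+1 != 0 ->
  invmx (x%:M - jmx n a) s s = p s * p (n - s)%N / p n.+1.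
Proof.
move=> pn0; have rn0 : rp n != 0 by rewrite gt_eqF// (rprod_gt0 a_gt0).
have w0 : w != 0 by rewrite mulf_neq0// invr_eq0.
(* The Green kernel u_min(i,k) v_max(i,k), to be divided by the Wronskian. *)
pose y (k i : nat) := if (i <= k)%N then u i * v k else u k * v i.
pose Y : 'M[R]_n.+1 := \matrix_(i, k) (w^-1 * y k i).
have AY : (x%:M - jmx n a) *m Y = 1%:M.
  apply/matrixP => i k; rewrite mulmxBl mul_scalar_mx !mxE.
  under eq_bigr => j _ do rewrite [Y j k]mxE mulrCA.
  rewrite -mulr_sumr (sum_jmx a (y k) i).
  have ni : (i <= n)%N by have := ltn_ord i; lia.
  have nk : (k <= n)%N by have := ltn_ord k; lia.
  have -> : x * (w^-1 * y k i) - w^-1 * ((if (0 < i)%N then a i * y k i.-1 else 0) +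
     (if (i < n)%N then a i.+1 * y k i.+1 else 0)) =
     w^-1 * (x * y k i - (if (0 < i)%N then a i * y k i.-1 else 0) -
     (if (i < n)%N then a i.+1 * y k i.+1 else 0)) by ring.
  rewrite -val_eqE /=.
  case: (ltngtP i k) => ik.
  - have -> : (i < n)%N by lia.
    have -> : y k i.-1 = u i.-1 * v k by rewrite /y ifT//; lia.
    rewrite /y (ltnW ik) ik.
    have := uS ni; rewrite uS'; last by lia.
    move=> e; rewrite (_ : _ - _ = 0) ?mulr0//.
    by rewrite [a i.+1 * _]mulrA e; case: ifP => _; ring.
  - have -> : (0 < i)%N by lia.
    have -> : y k i.-1 = u k * v i.-1.
      rewrite /y; case: ifP => // h; congr (u _ * v _); lia.
    rewrite /y (_ : (i <= k)%N = false); last by lia.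
    rewrite (_ : (i.+1 <= k)%N = false); last by lia.
    have := vS ni; have -> : (i : nat) = i.-1.+1 by lia.
    move=> e; rewrite (_ : _ - _ = 0) ?mulr0//=.
    have -> : x * (u k * v i.-1.+1) - a i.-1.+1 * (u k * v i.-1)
      = u k * (x * v i.-1.+1 - a i.-1.+1 * v i.-1) by ring.
    by rewrite -e; case: ifP => _; ring.
  - rewrite -ik /y leqnn ltnn; have -> : (i.-1 <= i)%N by lia.
    have := wronskian ni; rewrite uS// => e.
    rewrite -[RHS](mulVf w0); congr (_ * _); rewrite -e.
    by case: ifP => _; case: ifP => _; ring.
have AU := mulmx1_unit AY.
have -> : invmx (x%:M - jmx n a) = Y.
  by rewrite -[LHS]mulmx1 -AY mulmxA mulVmx ?mul1mx//; case: AU.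
rewrite mxE /y leqnn /v /u /w.
have sn : (s <= n)%N by have := ltn_ord s; lia.
have rm := rprod_mirror a_mirror sn; rewrite -rm.
have r1 : rp s != 0 by rewrite gt_eqF// (rprod_gt0 a_gt0).
have r2 : rp (n - s) != 0 by rewrite gt_eqF// (rprod_gt0 a_gt0)// leq_subr.
move: r1 r2 pn0; move: (p s) (p (n - s)%N) (p n.+1) (rp s) (rp (n - s)) => *.
by field; do ?(apply/andP; split).
Qed.

(* Variation of constants: differentiating the recurrence in X produces the
   source term p_s, which is then propagated by the mirrored solution. *)
Lemma deriv_jpoly_sum :
  ((jpoly a n.+1)^`()).[x] = \sum_(s < n.+1) p s * p (n - s)%N.
Proof.
pose d s := ((jpoly a s)^`()).[x].
have dS s : d s.+2 = p s.+1 + x * d s.+1 - a s.+1 ^+ 2 * d s.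
  rewrite /d jpolySS derivB derivZ derivM derivX mul1r.
  by rewrite !(hornerD, hornerN, hornerZ, hornerM, hornerX) horner_jpoly.
have H s : (s <= n)%N -> d s.+1 * p (n - s)%N
    - (if (s < n)%N then a s.+1 ^+ 2 * d s * p (n - s).-1 else 0)
    = \sum_(0 <= i < s.+1) p i * p (n - i)%N.
  elim: s => [_|s IH sn].
    rewrite big_nat1 subn0 /d derivX derivC !(hornerC, hornerX) /= !mul1r mulr0 mul0r.
    by case: ifP; rewrite subr0.
  have -> : \sum_(0 <= i < s.+2) p i * p (n - i)%N
      = \sum_(0 <= i < s.+1) p i * p (n - i)%N + p s.+1 * p (n - s.+1)%N.
    by rewrite big_nat_recr.
  rewrite -(IH (ltnW sn)) sn dS.
  have [m mE] : exists m, (n - s)%N = m.+1 by exists (n - s.+1)%N; lia.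
  have -> : (n - s.+1)%N = m by lia.
  rewrite mE [m.+1.-1]/=.
  have [m0|[k mk]] : m = 0%N \/ exists k, m = k.+1.
    by case: (m) => [|k]; [left | right; exists k].
  - rewrite m0; have -> : (s.+1 < n)%N = false by lia.
    by rewrite -[p 1%N]/x -[p 0%N]/(1 : R); ring.
  - have -> : (s.+1 < n)%N by lia.
    rewrite mk pseqSS [k.+1.-1]/= -(a_mirror (s := k.+1)); last by lia.
    have -> : (n.+1 - k.+1)%N = s.+2 by lia.
    by ring.
have := H n (leqnn n); rewrite ltnn subnn mulr1 subr0 => e.
by rewrite -[LHS]/(d n.+1) e big_mkord.
Qed.

End Green.

(** * The sine spectral measure *)

Lemma cos_halfD (R : realType) (j : nat) : cos ((j%:R + 2^-1) * pi) = 0 :> R.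
Proof.
elim: j => [|j IH]; first by rewrite add0r mulrC cos_pihalf.
have -> : (j.+1%:R + 2^-1) * pi = (j%:R + 2^-1) * pi + pi :> R.
  by rewrite -[j.+1]addn1 natrD; ring.
by rewrite cosDpi IH oppr0.
Qed.

Section SineSpectrum.
Variables (R : realType) (n : nat).
Local Notation N := n.+1.
Local Notation a := (acoef R N).
Local Notation theta := (@sine_angle R n).
Local Notation zeta := (@sine_node R n).

Lemma sine_angle_itv (j : 'I_N) : 0 < theta j < pi.
Proof.
have p0 := pi_gt0 R; rewrite /sine_angle.
have j1 : (1 : R) <= j.+1%:R by rewrite ler1n.
have jn : (j.+1%:R : R) <= N%:R by rewrite ler_nat.
have N0 : (0 : R) < 2 * N%:R by rewrite mulr_gt0 ?ltr0n.
apply/andP; split.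
  by rewrite divr_gt0// mulr_gt0//; lra.
by rewrite ltr_pdivrMr// mulrC ltr_pM2l//; lra.
Qed.

Lemma sine_angle_mulN (j : 'I_N) : N%:R * theta j = (j%:R + 2^-1) * pi.
Proof.
have N0 : (N%:R : R) != 0 by rewrite pnatr_eq0.
rewrite /sine_angle -[j.+1]addn1 natrD.
by move: N0; move: (N%:R : R) (pi : R) (j%:R : R) => x y z x0; field.
Qed.

Lemma cos_sine_angle (j : 'I_N) : cos (N%:R * theta j) = 0.
Proof. by rewrite sine_angle_mulN cos_halfD. Qed.

Lemma norm_sin_sine_angle (j : 'I_N) : `|sin (N%:R * theta j)| = 1.
Proof.
apply/eqP; rewrite -sqrp_eq1// real_normK ?num_real//.
by rewrite sin2cos2 cos_sine_angle expr0n subr0.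
Qed.

Lemma sine_node_inj : injective zeta.
Proof.
move=> j k /cos_inj; have [/andP[j0 jp] /andP[k0 kp]] := (sine_angle_itv j, sine_angle_itv k).
rewrite !in_itv /= !ltW// => /(_ isT isT) /(congr1 (fun t => N%:R * t)).
rewrite !sine_angle_mulN => /(mulIf (lt0r_neq0 (pi_gt0 R))) /addIr /eqP.
by rewrite eqr_nat => /eqP/val_inj.
Qed.

Lemma acoef_pos s : (0 < s <= n)%N -> 0 < a s.
Proof. by move=> /andP[s0 sn]; apply: acoef_gt0 => //; rewrite s0. Qed.

Lemma acoef_sym s : (0 < s <= n)%N -> a (N - s)%N = a s.
Proof.
move=> sn; apply/eqP; rewrite -(eqrXn2 (n := 2))// ?ltW ?acoef_pos//; [|lia].
by rewrite acoef_mirror//; lia.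
Qed.

Lemma jpoly_node (j : 'I_N) : (jpoly a N).[zeta j] = 0.
Proof. by rewrite horner_jpoly pseq_last// /sine_node chebyshevT_cos cos_sine_angle mulr0. Qed.

Lemma deriv_jpoly_node (j : 'I_N) :
  sin (theta j) * `|((jpoly a N)^`()).[zeta j]| = N%:R / 2 ^+ n.
Proof.
have s0 : 0 < sin (theta j) by apply: sin_gt0_pi; exact: sine_angle_itv.
rewrite jpoly_last// derivZ hornerZ -[N.-1]/n normrM mulrCA -{1}[sin _]gtr0_norm//.
rewrite -normrM /sine_node deriv_chebyshevT_cos normrM norm_sin_sine_angle mulr1.
by rewrite !ger0_norm ?invr_ge0 ?exprn_ge0 ?ler0n// mulrC.
Qed.

Lemma deriv_jpoly_node_gt0 (j : 'I_N) :
  0 < ((jpoly a N)^`()).[zeta j] * (jpoly a n).[zeta j].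
Proof.
have := christoffel_darboux_gt0 (zeta j) acoef_pos.
by rewrite jpoly_node mul0r subr0.
Qed.

Lemma deriv_jpoly_node_neq0 (j : 'I_N) : ((jpoly a N)^`()).[zeta j] != 0.
Proof. by apply: contraTneq (deriv_jpoly_node_gt0 j) => ->; rewrite mul0r ltxx. Qed.

(* Modulo p_N the recurrence can be run backwards from p_(N-1), and by the
   mirror symmetry it produces the same polynomials. *)
Lemma jpoly_node_mirror (j : 'I_N) s : (s <= n)%N ->
  (jpoly a n).[zeta j] * (jpoly a s).[zeta j]
  = rprod a s ^+ 2 * (jpoly a (n - s)).[zeta j].
Proof.
have z0 := jpoly_node j; move: z0; rewrite !horner_jpoly; set x := zeta j => z0.
elim/nat_ind2: s => [_|n0|s IH0 IH1 sn].
- by rewrite rprod0 subn0 expr1n mul1r /= mulr1.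
- have [m nm] : exists m, n = m.+1 by exists n.-1; lia.
  have -> : (n - 1)%N = m by lia.
  rewrite rprodS rprod0 mul1r -[pseq x a 1]/x.
  rewrite -(acoef_sym (s := 1))//; have -> : (N - 1)%N = m.+1 by lia.
  have z1 : x * pseq x a m.+1 - a m.+1 ^+ 2 * pseq x a m = 0 by rewrite -pseqSS -nm.
  have -> : pseq x a n = pseq x a m.+1 by rewrite nm.
  by apply/eqP; rewrite mulrC -subr_eq0 z1.
- have e1 := IH1 (ltnW sn); have e0 := IH0 (ltnW (ltnW sn)).
  rewrite pseqSS.
  transitivity (x * (pseq x a n * pseq x a s.+1)
    - a s.+1 ^+ 2 * (pseq x a n * pseq x a s)); first by ring.
  rewrite e1 e0; have [k nk] : exists k, (n - s.+2)%N = k by eexists.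
  have -> : (n - s.+1)%N = k.+1 by lia.
  have -> : (n - s)%N = k.+2 by lia.
  rewrite nk pseqSS !rprodS -[a s.+2](acoef_sym (s := s.+2)); last by lia.
  have -> : (N - s.+2)%N = k.+1 by lia.
  by ring.
Qed.
End SineSpectrum.

Lemma integral_sum_dirac (R : realType) (N : nat) (w : nat -> {nonneg R})
    (z : nat -> R) (g : R -> R) :
  measurable_fun setT g ->
  (\int[msum (fun k => mscale (w k) (dirac (z k))) N]_(x in setT) (g x)%:E)%E
  = (\sum_(k < N) (w k)%:num * g (z k))%:E.
Proof.
move=> mg; have mT := @measurableT _ (measurableTypeR R).
have H (h : R -> R) : measurable_fun setT h -> (forall x, 0 <= h x) ->
  (\int[msum (fun k => mscale (w k) (dirac (z k))) N]_(x in setT) (h x)%:E)%E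
  = (\sum_(k < N) (w k)%:num * h (z k))%:E.
  move=> mh h0; rewrite ge0_integral_measure_sum//; last 2 first.
  - by move=> x _; rewrite lee_fin.
  - exact/measurable_EFinP.
  rewrite -sumEFin; apply: eq_bigr => k _.
  rewrite ge0_integral_mscale//; last 2 first.
  - exact/measurable_EFinP.
  - by move=> x _; rewrite lee_fin.
  rewrite integral_dirac//; last exact/measurable_EFinP.
  by rewrite diracE mem_set// mul1e EFinM.
rewrite integralE.
have -> : ((fun x => (g x)%:E)^\+)%E = (fun x => (Num.max (g x) 0)%:E).
  by apply/funext => x; rewrite funeposE EFin_max.
have -> : ((fun x => (g x)%:E)^\-)%E = (fun x => (Num.max (- g x) 0)%:E).
  by apply/funext => x; rewrite funenegE EFin_max EFinN.
rewrite !H; last 4 first.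
- by apply: measurable_maxr => //; apply: measurableT_comp.
- by move=> x; rewrite le_max lexx orbT.
- by apply: measurable_maxr.
- by move=> x; rewrite le_max lexx orbT.
rewrite -EFinB -sumrB; congr EFin; apply: eq_bigr => k _.
rewrite -mulrBr; congr (_ * _); case: (leP 0 (g (z k))) => g0.
  by rewrite max_r ?subr0// oppr_le0.
by rewrite max_l ?opprK ?add0r// oppr_ge0 ltW.
Qed.

Lemma measurable_horner (R : realType) (p : {poly R}) :
  measurable_fun setT (fun x : R => p.[x]).
Proof.
elim/poly_ind: p => [|p c IH].
  by rewrite (_ : (fun _ => _) = cst 0)//; apply/funext => y; rewrite hornerC.
rewrite (_ : (fun y => _) = (fun y => p.[y] * y + c)); last first.
  by apply/funext => y; rewrite hornerMXaddC.
by apply: measurable_funD => //; apply: measurable_funM.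
Qed.

(** * Identification of the sine-Jacobi matrix, exactness and gain *)

Section SineJacobi.
Variables (R : realType) (n : nat).
Local Notation N := n.+1.
Local Notation a := (acoef R N).
Local Notation theta := (@sine_angle R n).
Local Notation zeta := (@sine_node R n).
Local Notation r := (rprod a).

(** The Christoffel number at a node is rprod n ^ 2 / (p_N' p_n); since p_n^2 = rprod n ^ 2 there,
    it can be written with p_n in the numerator. *)
Let W j := (jpoly a n).[zeta j] / ((jpoly a N)^`()).[zeta j].

(** The mirror relation replaces p_n p_s by a multiple of p_(n-s), so the sum is a multiple of the
    coefficient of X^n in p_(n-s), which is zero unless s = 0. *)
Lemma christoffel_sum s : (s <= n)%N ->
  \sum_j W j * (jpoly a s).[zeta j] = (s == 0%N)%:R.
Proof.
move=> sn.
transitivity (r s ^+ 2 * \sum_j (jpoly a (n - s)).[zeta j] / ((jpoly a N)^`()).[zeta j]).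
  rewrite mulr_sumr; apply: eq_bigr => j _.
  by rewrite /W mulrAC jpoly_node_mirror// mulrA.
rewrite (@lagrange_lead _ n (jpoly a N)) ?jpoly_monic ?size_jpoly//; last 4 first.
- exact: sine_node_inj.
- exact: jpoly_node.
- exact: deriv_jpoly_node_neq0.
- by lia.
case: s sn => [|s] sn.
  rewrite rprod0 expr1n mul1r subn0.
  by have := jpoly_monic a n; rewrite monicE lead_coefE size_jpoly => /eqP.
by rewrite nth_default ?mulr0// size_jpoly; lia.
Qed.

(** [W] is positive by Christoffel-Darboux, |p_n| = r n at the nodes, and sin(theta) |p_N'| is
    constant; so [W] is proportional to sin(theta), and the case s = 0 of [christoffel_sum] fixes
    the factor. *)
Lemma sine_weightE j : sine_weight R j = W j.
Proof.
have C k : W k = (r n * 2 ^+ n / N%:R) * sin (theta k).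
  have d0 := deriv_jpoly_node_neq0 R k; have dP := deriv_jpoly_node_gt0 R k.
  have Pn : `|(jpoly a n).[zeta k]| = r n.
    apply/eqP; rewrite -(eqrXn2 (n := 2))// ?ltW ?(rprod_gt0 (@acoef_pos R n))//.
    rewrite real_normK ?num_real// expr2 jpoly_node_mirror// subnn.
    by rewrite hornerC mulr1.
  have W0 : 0 < W k.
    move: d0 dP; rewrite /W; move: (_.[_]) (_.[_]) => A B d0 dP.
    have -> : A / B = (B * A) / B ^+ 2 by field.
    by rewrite divr_gt0// exprn_even_gt0.
  rewrite -[W k]gtr0_norm// /W normrM normfV Pn.
  have s0 : sin (theta k) != 0 by rewrite gt_eqF// sin_gt0_pi// sine_angle_itv.
  have -> : `|((jpoly a N)^`()).[zeta k]| = N%:R / 2 ^+ n / sin (theta k).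
    by rewrite -(deriv_jpoly_node R k) mulrAC mulfV// mul1r.
  have N0 : (N%:R : R) != 0 by rewrite pnatr_eq0.
  have p0 : (2 ^+ n : R) != 0 by rewrite expf_neq0.
  by move: N0 p0 s0; move: (N%:R : R) (2 ^+ n : R) (sin _) (r n) => *; field; do ?(apply/andP; split).
have := christoffel_sum (leq0n n).
under eq_bigr do rewrite hornerC mulr1 C.
rewrite -mulr_sumr /sine_weight C => e.
have S0 : \sum_(k < N) sin (theta k) != 0.
  by apply: contra_eqN e => /eqP ->; rewrite mulr0 eq_sym oner_eq0.
by apply: (canLR (mulfK S0)); rewrite mulrAC e mul1r.
Qed.

Lemma sine_measure_integral (p : {poly R}) :
  (\int[sine_measure R n]_(x in setT) (p.[x])%:E)%E
  = (\sum_j W j * p.[zeta j])%:E.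
Proof.
rewrite /sine_measure integral_sum_dirac; last exact: measurable_horner.
by congr EFin; apply: eq_bigr => j _; rewrite /= inord_val sine_weightE.
Qed.

Lemma jmx_spectral : is_spectral_measure (jmx n a) (sine_measure R n).
Proof.
move=> p; rewrite sine_measure_integral; congr EFin.
apply: (@jmx_functional _ _ _ (fun p : {poly R} => \sum_j W j * p.[zeta j])).
- by move=> f g; rewrite -big_split; apply: eq_bigr => j _; rewrite hornerD mulrDr.
- by move=> c f; rewrite mulr_sumr; apply: eq_bigr => j _; rewrite hornerZ mulrCA.
- by move=> q; apply: big1 => j _; rewrite hornerM jpoly_node !mulr0.
- exact: christoffel_sum.
Qed.

Lemma sine_jacobiE : sine_jacobi R n = jmx n a.
Proof.
have [Jj Js] : [set J : 'M[R]_N | is_jacobi J /\ is_spectral_measure J (sine_measure R n)]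
    (sine_jacobi R n).
  rewrite /sine_jacobi; apply: xgetPex; exists (jmx n a); split.
    exact: jmx_is_jacobi (@acoef_pos R n).
  exact: jmx_spectral.
apply: (jacobi_unique (@acoef_pos R n) Jj) => p.
have e1 := Js p; have e2 := jmx_spectral p; rewrite -e2 in e1.
by case: e1.
Qed.

Lemma sine_coefE s : (0 < s <= n)%N -> sine_coef R n s = a s.
Proof.
move=> sn; rewrite /sine_coef sine_jacobiE mxE !inordK; [|lia..].
by rewrite prednK ?eqxx//; case/andP: sn.
Qed.

Lemma pseq_sine_coef x s : (s <= N)%N -> pseq x (@sine_coef R n) s = pseq x a s.
Proof. by move=> sN; apply: pseq_ext => i isn; rewrite sine_coefE//; lia. Qed.

Lemma green_profileE (s : 'I_N) :
  green_profile R s = pseq 1 a s * pseq 1 a (n - s) / pseq 1 a N.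
Proof.
rewrite /green_profile sine_jacobiE (jmx_green (@acoef_pos R n) (@acoef_sym R n))//.
by rewrite gt_eqF// pseq_gt0.
Qed.

Lemma green_profile_sum : \sum_(s < N) green_profile R s = N%:R ^+ 2.
Proof.
under eq_bigr do rewrite green_profileE.
rewrite -mulr_suml -(deriv_jpoly_sum (@acoef_sym R n)).
rewrite jpoly_last// pseq_last// derivZ hornerZ deriv_chebyshevT_at1 chebyshevT_at1.
by rewrite mulr1 mulrAC divff ?mul1r// invr_neq0// expf_neq0.
Qed.

Variables (mu L : R).
Hypotheses (hmu : 0 < mu) (hL : mu < L).
Local Notation e := (Defs.eta mu L).

Lemma pseq_sine_eta_neq0 s : (s <= N)%N -> pseq e (@sine_coef R n) s != 0.
Proof. by move=> sN; rewrite pseq_sine_coef// gt_eqF// pseq_gt0// ltW// eta_gt1. Qed.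

Lemma sine_method_exact : final_chebyshev_exact mu L N (sine_method mu L n).
Proof.
move=> lam x0 lamI; rewrite /sine_method (method_quadratic hmu hL pseq_sine_eta_neq0)//.
rewrite !pseq_sine_coef// !pseq_last// /pstar; congr (_ * _).
by rewrite invfM invrK mulrACA mulVf ?mul1r// expf_neq0.
Qed.

Lemma norm_kernel_sine s lam nu : (s <= n)%N ->
  `|kernelK mu L (@sine_coef R n) N s lam nu| =
  2 * epsstar mu L N / Delta mu L *
  `|pseq (zmap mu L lam) a (n - s) * pseq (zmap mu L nu) a s / pseq 1 a N|.
Proof.
move=> sn; rewrite (kernelKE hmu hL pseq_sine_eta_neq0)//.
rewrite !pseq_sine_coef//; [|lia..].
rewrite (@pseq_ext _ _ (fun i => sine_coef R n (s.+1 + i)) (fun i => a (s.+1 + i)%N)); last first.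
  by move=> i isn; rewrite sine_coefE//; lia.
(* The factor 2^(1-N) common to p_N(eta) and p_N(1) cancels, which leaves 1/T_N(eta). *)
rewrite subSS (pseq_acoef_mirror _ _ sn)// !pseq_last// chebyshevT_at1 mulr1.
have D0 := Delta_gt0 hL; have p2 : 0 < (2 ^+ N.-1 : R) by rewrite exprn_gt0.
set A := pseq _ _ _; set B := pseq _ _ _.
rewrite /epsstar; set T := (chebyshevT R N).[_].
have T0 : 0 < T by rewrite (lt_le_trans ltr01)// chebyshevT_ge1// ltW// eta_gt1.
rewrite (gtr0_norm T0).
have -> : - (2 / (Delta mu L * ((2 ^+ N.-1)^-1 * T))) * (A * B)
    = - (2 * T^-1 / Delta mu L * (A * B / (2 ^+ N.-1)^-1)).
  move: (lt0r_neq0 T0) (lt0r_neq0 D0) (lt0r_neq0 p2).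
  by move: (2 ^+ N.-1) => P *; field; do ?(apply/andP; split).
rewrite normrN normrM ger0_norm// divr_ge0 ?(ltW D0)// mulr_ge0// invr_ge0 ltW//.
Qed.

Lemma sine_gainE :
  sine_gain mu L n = 2 * epsstar mu L N / Delta mu L
    * Num.sqrt (\sum_(s < N) green_profile R s ^+ 2).
Proof.
have D0 := Delta_gt0 hL.
have c0 : 0 <= 2 * epsstar mu L N / Delta mu L.
  by rewrite divr_ge0 ?(ltW D0)// mulr_ge0// /epsstar invr_ge0.
set c := (X in X * _).
have p0 : 0 < pseq 1 a N by rewrite pseq_gt0.
pose K lam nu := Num.sqrt (\sum_(0 <= s < N) `|kernelK mu L (@sine_coef R n) N s lam nu| ^+ 2).
have K1 : K mu mu = c * Num.sqrt (\sum_(s < N) green_profile R s ^+ 2).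
  rewrite -{1}[c]ger0_norm// -sqrtr_sqr -sqrtrM ?sqr_ge0//; congr Num.sqrt.
  rewrite big_mkord mulr_sumr; apply: eq_bigr => s _.
  have sn : (s <= n)%N by have := ltn_ord s; lia.
  rewrite norm_kernel_sine// exprMn zmap_mu// green_profileE real_normK ?num_real//.
  by rewrite [pseq 1 a (n - s) * _]mulrC.
have Kle lam nu : mu <= lam <= L -> mu <= nu <= L -> K lam nu <= K mu mu.
  move=> lI nI; apply: ler_wsqrtr; rewrite big_nat [leRHS]big_nat.
  apply: ler_sum => s /andP[_ sn]; rewrite lerXn2r ?nnegrE//.
  rewrite !norm_kernel_sine// ler_wpM2l// zmap_mu// !normrM ler_wpM2r//.
  have le1 m x : (m <= N)%N -> -1 <= x <= 1 -> `|pseq x a m| <= `|pseq 1 a m|.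
    by move=> mN x1; rewrite [leRHS]ger0_norm ?pseq_norm_le// ltW// pseq_gt0.
  by rewrite ler_pM// le1 ?zmap_itv//; lia.
rewrite -K1 /sine_gain /gain; set S := [set _ | _ in _ & _ in _].
have muI : mu <= mu <= L by rewrite lexx ltW.
have SK : S (K mu mu).
  by exists mu; rewrite /= ?in_itv//; exists mu; rewrite /= ?in_itv.
have ub : ubound S (K mu mu).
  move=> _ [lam /= lI [nu /= nI <-]]; rewrite !in_itv/= in lI nI; exact: Kle.
apply/eqP; rewrite eq_le; apply/andP; split.
  by apply: ge_sup => //; exists (K mu mu).
by apply: ub_le_sup => //; exists (K mu mu).
Qed.

End SineJacobi.

(** * The discrete Legendre equation at the endpoint *)

Lemma sin_le_id (R : realType) (x : R) : 0 <= x -> sin x <= x.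
Proof.
move=> x0; have [c _] := @MVT_segment R sin cos 0 x x0 (fun c _ => is_derive_sin c)
  (continuous_subspaceT (@continuous_sin R)).
rewrite sin0 !subr0 => ->; by rewrite ler_piMl// cos_le1.
Qed.

Lemma onem_cos_le (R : realType) (x : R) : 0 <= x -> 2 * (1 - cos x) <= x ^+ 2.
Proof.
move=> x0; have x20 : 0 <= x / 2 by rewrite divr_ge0.
have -> : cos x = 1 - 2 * sin (x / 2) ^+ 2.
  rewrite {1}(splitr x) cosD -!expr2 sin2cos2; ring.
have h := sin_le_id x20.
have h' : - (x / 2) <= sin (x / 2).
  have [c _] := @MVT_segment R sin cos 0 (x / 2) x20 (fun c _ => is_derive_sin c)
    (continuous_subspaceT (@continuous_sin R)).
  rewrite sin0 !subr0 => ->; have := cos_geN1 c; nra.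
by nra.
Qed.

Lemma pi_lt4 (R : realType) : pi < 4 :> R.
Proof. by have := pihalf_lt2 R; lra. Qed.

Lemma expRK_le (R : realType) (x : R) (s N : nat) : 0 <= x -> (s <= N)%N ->
  (1 + x / N%:R) ^+ s <= expR x.
Proof.
move=> x0; case: N => [|N]; first by rewrite leqn0 => /eqP ->; rewrite expr0 -expR0 ler_expR.
move=> sN; have N0 : 0 < N.+1%:R :> R by rewrite ltr0n.
have y0 : 0 <= x / N.+1%:R by rewrite divr_ge0// ltW.
apply: (@le_trans _ _ ((1 + x / N.+1%:R) ^+ N.+1)).
  by rewrite ler_weXn2l// lerDl.
apply: (@le_trans _ _ (expR (x / N.+1%:R) ^+ N.+1)).
  by rewrite lerXn2r ?nnegrE ?addr_ge0 ?expR_ge0// expR_ge1Dx.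
by rewrite -expRM_natr -mulrA mulVf ?mulr1// gt_eqF.
Qed.

Section DiscreteLegendre.
Variables (R : realType) (n : nat).
Local Notation N := n.+1.
Local Notation S := (@sg R N).
Local Notation a := (acoef R N).
Local Notation q := (qprod R N).
Let y : R := pi / N%:R / 2.

(* At x = 1, with p_s rescaled by 2^s / q_s, the three-term recurrence becomes
   a discretization of (sin(pi t) v')' = (pi^2/4) sin(pi t) v, the Legendre
   equation of degree -1/2 on t = s/N. *)
Definition Gseq s : R := 2 ^+ s * pseq 1 a s / q s.

(** Close to y^2 = (pi^2/4)/N^2, the coefficient of the Legendre equation times the square of the
    step. *)
Definition eps_step : R := 2 * (1 - cos y).

Lemma y_bounds : 0 < y <= 2 / N%:R.
Proof.
have N0 : 0 < N%:R :> R by rewrite ltr0n.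
rewrite /y !divr_gt0 ?pi_gt0//= mulrAC ler_pM2r ?invr_gt0//.
by have := pi_lt4 R; lra.
Qed.

Lemma eps_ge0 : 0 <= eps_step.
Proof. by rewrite /eps_step mulr_ge0// subr_ge0 cos_le1. Qed.

Lemma eps_le : eps_step * N%:R <= 4 / N%:R.
Proof.
have N0 : 0 < N%:R :> R by rewrite ltr0n.
have /andP[y0 yN] := y_bounds.
apply: (@le_trans _ _ (y ^+ 2 * N%:R)); first by rewrite ler_pM2r// onem_cos_le// ltW.
apply: (@le_trans _ _ ((2 / N%:R) ^+ 2 * N%:R)).
  by rewrite ler_pM2r// lerXn2r ?nnegrE ?(ltW y0)// divr_ge0.
rewrite le_eqVlt; apply/orP; left; apply/eqP.
by move: (lt0r_neq0 N0); move: (N%:R : R) => z *; field.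
Qed.

Lemma sg_halfstep s : S s.+1%:R + S s%:R = 2 * S (s%:R + 2^-1) * cos y.
Proof.
rewrite /sg; set u := pi / N%:R.
have -> : s.+1%:R * u = (s%:R + 2^-1) * u + y by rewrite -[s.+1]addn1 natrD /y -/u; lra.
have -> : s%:R * u = (s%:R + 2^-1) * u - y by rewrite /y -/u; lra.
by rewrite sinD sinB; ring.
Qed.

Lemma Gseq0 : Gseq 0 = 1.
Proof. by rewrite /Gseq qprod0 /= expr0 mulr1 divr1. Qed.

Lemma Gseq_rec s : (s.+1 < N)%N ->
  S s.+1%:R * (Gseq s.+1 - Gseq s) =
  (if s is s1.+1 then S s%:R * (Gseq s - Gseq s1) else 0)
  + eps_step * S (s%:R + 2^-1) * Gseq s.
Proof.
move=> sN; have hs := sg_halfstep s.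
have eE : eps_step * S (s%:R + 2^-1) = 2 * S (s%:R + 2^-1) - S s.+1%:R - S s%:R.
  by rewrite /eps_step; have := hs; nra.
rewrite eE.
have S1 : S s.+1%:R != 0 by rewrite gt_eqF// sg_ord_gt0.
have Sh : S (s%:R + 2^-1) != 0 by rewrite gt_eqF// sg_half_gt0// ltnW.
case: s sN S1 Sh {hs eE} => [|s] sN S1 Sh.
  rewrite add0r in Sh *; rewrite Gseq0 sg0 /Gseq qprodS qprod0 add0r expr1 -[pseq 1 a 1]/(1 : R).
  by move: S1 Sh; move: (S 1) (S 2^-1) => A B *; field; apply/andP; split.
have S2 : S (s%:R + 2^-1) != 0 by rewrite gt_eqF// sg_half_gt0//; lia.
have S3 : S s.+1%:R != 0 by rewrite gt_eqF// sg_ord_gt0//; lia.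
have q0 : q s != 0 by rewrite gt_eqF// qprod_gt0//; lia.
rewrite /Gseq pseqSS acoef_sqr//; last by lia.
have -> : s.+1%:R - 2^-1 = s%:R + 2^-1 :> R by rewrite -[s.+1]addn1 natrD; lra.
rewrite !qprodS !exprS.
move: S1 Sh S2 S3 q0; move: (S s.+2%:R) (S (s.+1%:R + 2^-1)) (S (s%:R + 2^-1)) (S s.+1%:R) (q s).
move: (pseq 1 a s.+1) (pseq 1 a s) (2 ^+ s) => *.
by field; do ?(apply/andP; split).
Qed.

Lemma Gseq_diff s : (s.+1 < N)%N ->
  S s.+1%:R * (Gseq s.+1 - Gseq s) =
  eps_step * \sum_(0 <= i < s.+1) S (i%:R + 2^-1) * Gseq i.
Proof.
elim: s => [|s IH] sN; rewrite Gseq_rec//; first by rewrite add0r big_nat1 mulrA.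
by rewrite IH ?(ltnW sN)// [in RHS]big_nat_recr//= mulrDr mulrA.
Qed.

Lemma Gseq_gt0 s : (s < N)%N -> 0 < Gseq s.
Proof.
move=> sN; rewrite /Gseq divr_gt0 ?qprod_gt0// mulr_gt0 ?exprn_gt0//.
by rewrite pseq_gt0// ltnW.
Qed.

Lemma Gseq_nondecr s : (s.+1 < N)%N -> Gseq s <= Gseq s.+1.
Proof.
move=> sN; rewrite -subr_ge0 -(pmulr_rge0 _ (sg_ord_gt0 R (ltn0Sn n) (s := s.+1) sN)) Gseq_diff//.
rewrite mulr_ge0 ?eps_ge0// big_nat sumr_ge0// => i /andP[_ iS].
rewrite mulr_ge0// ltW ?Gseq_gt0 ?sg_half_gt0//; lia.
Qed.

Lemma Gseq_ge1 s : (s < N)%N -> 1 <= Gseq s.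
Proof.
elim: s => [|s IH] sN; first by rewrite Gseq0.
by rewrite (le_trans (IH (ltnW sN)))// Gseq_nondecr.
Qed.

Lemma sg_le1 (x : R) : S x <= 1. Proof. exact: sin_le1. Qed.

Lemma sg_incr (x z : R) : 0 <= x -> x <= z -> 2 * z <= N%:R -> S x <= S z.
Proof.
move=> x0 xz zN; have N0 : 0 < N%:R :> R by rewrite ltr0n.
have p0 := pi_gt0 R; have u0 : 0 < pi / N%:R :> R by rewrite divr_gt0.
have zh : z * (pi / N%:R) <= pi / 2.
  by rewrite mulrCA ler_pM2l// ler_pdivrMr//; lra.
have xh : x * (pi / N%:R) <= z * (pi / N%:R) by rewrite ler_pM2r.
have xl : 0 <= x * (pi / N%:R) by rewrite mulr_ge0// ltW.
rewrite /sg; move: zh xh xl; move: (x * _) (z * _) => X Z zh xh xl.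
have XI : X \in `[(- (pi / 2)), (pi / 2)] by rewrite in_itv/=; apply/andP; split; lra.
have ZI : Z \in `[(- (pi / 2)), (pi / 2)] by rewrite in_itv/=; apply/andP; split; lra.
by rewrite leNgt ltr_sin// -leNgt.
Qed.

Lemma sg_decr (x z : R) : N%:R <= 2 * x -> x <= z -> z <= N%:R -> S z <= S x.
Proof.
move=> xN xz zN; rewrite -(sgB (ltn0Sn n) z) -(sgB (ltn0Sn n) x).
by apply: sg_incr; lra.
Qed.

(** The growth factor of one step: N terms weighted by [eps_step] add up to at most 4/N times their
    bound. *)
Let b : R := 1 + 4 / N%:R.

Let b_ge1 : 1 <= b.
Proof. by rewrite lerDl divr_ge0. Qed.

Let b_mono i s : (i <= s)%N -> b ^+ i <= b ^+ s.
Proof. by move=> ls; rewrite ler_weXn2l. Qed.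

(** On the left half the sine increases, so every weight in the sum of [Gseq_diff] is at most the
    factor S_(s+1) on its left side, and the two cancel. *)
Lemma Gseq_le_left s : (2 * s <= N)%N -> Gseq s <= b ^+ s.
Proof.
elim/ltn_ind: s => -[|s] IH sN; first by rewrite Gseq0 expr0.
have s1N : (s.+1 < N)%N by lia.
have S0 := sg_ord_gt0 R (ltn0Sn n) (s := s.+1) s1N.
have sNR : 2 * s.+1%:R <= N%:R :> R by rewrite -natrM ler_nat.
have : \sum_(0 <= i < s.+1) S (i%:R + 2^-1) * Gseq i <= N%:R * (S s.+1%:R * b ^+ s).
  apply: (@le_trans _ _ (\sum_(0 <= i < s.+1) S s.+1%:R * b ^+ s)).
    rewrite big_nat [leRHS]big_nat; apply: ler_sum => i /andP[_ iS].
    apply: ler_pM.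
    - by rewrite ltW// sg_half_gt0//; lia.
    - by rewrite ltW// Gseq_gt0//; lia.
    - apply: sg_incr => //.
      have : (i.+1%:R : R) <= s.+1%:R by rewrite ler_nat.
      by rewrite -[i.+1]addn1 natrD; lra.
    - by apply: le_trans (b_mono _); [apply: IH; lia | lia].
  rewrite sumr_const_nat subn0 -[_ *+ s.+1]mulr_natl ler_wpM2r//; last by rewrite ler_nat; lia.
  by rewrite mulr_ge0 ?ltW// (lt_le_trans ltr01)// exprn_ege1.
move=> /(ler_wpM2l eps_ge0); rewrite -Gseq_diff//.
have -> : eps_step * (N%:R * (S s.+1%:R * b ^+ s)) = S s.+1%:R * (eps_step * N%:R * b ^+ s) by ring.
rewrite ler_pM2l// => H.
have Hs : Gseq s <= b ^+ s by apply: IH; lia.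
have bs : 0 <= b ^+ s by rewrite (le_trans ler01)// exprn_ege1.
have -> : b ^+ s.+1 = b ^+ s + 4 / N%:R * b ^+ s by rewrite exprSr /b; ring.
by rewrite -(subrK (Gseq s) (Gseq s.+1)) addrC lerD// (le_trans H)// ler_wpM2r// eps_le.
Qed.

(** Near s = N the quotient by S_(s+1) is no longer harmless, and only the product with the sine
    stays bounded. There the sine decreases, so moving S_(s+3/2) down to S_(s+1) or S_(s+1/2) costs
    nothing. *)
Lemma sg_Gseq_le s : (s < N)%N -> S (s%:R + 2^-1) * Gseq s <= b ^+ s.
Proof.
elim/ltn_ind: s => s IH sN.
have [sl|sr] := leqP (2 * s) N.
  apply: le_trans (Gseq_le_left sl).
  by rewrite ler_piMl ?sg_le1// ltW// Gseq_gt0.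
case: s IH sN sr => [|s] IH sN sr; first by lia.
have S0 := sg_ord_gt0 R (ltn0Sn n) (s := s.+1) sN.
(* The extra 1 puts s + 1/2, not only s + 1, in the right half. *)
have srR : N%:R + 1 <= 2 * s.+1%:R :> R by rewrite -natrM -[1]/(1%:R) -natrD ler_nat; lia.
have sNR : s.+2%:R <= N%:R :> R by rewrite ler_nat.
have s2E : s.+2%:R = s.+1%:R + 1 :> R by rewrite -[s.+2]addn1 natrD.
have s1E : s.+1%:R = s%:R + 1 :> R by rewrite -[s.+1]addn1 natrD.
have G0 : 0 <= Gseq s by rewrite ltW// Gseq_gt0// ltnW.
have D0 : 0 <= Gseq s.+1 - Gseq s by rewrite subr_ge0 Gseq_nondecr.
have h1 : S (s.+1%:R + 2^-1) <= S (s%:R + 2^-1) by apply: sg_decr; lra.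
have h2 : S (s.+1%:R + 2^-1) <= S s.+1%:R by apply: sg_decr; lra.
have : \sum_(0 <= i < s.+1) S (i%:R + 2^-1) * Gseq i <= N%:R * b ^+ s.
  apply: (@le_trans _ _ (\sum_(0 <= i < s.+1) b ^+ s)).
    rewrite big_nat [leRHS]big_nat; apply: ler_sum => i /andP[_ iS].
    by apply: le_trans (b_mono _); [apply: IH; lia | lia].
  rewrite sumr_const_nat subn0 -[_ *+ s.+1]mulr_natl ler_wpM2r//; last by rewrite ler_nat; lia.
  by rewrite (le_trans ler01)// exprn_ege1.
move=> /(ler_wpM2l eps_ge0); rewrite -Gseq_diff// => H.
have Hs : S (s%:R + 2^-1) * Gseq s <= b ^+ s by apply: IH; lia.
have bs : 0 <= b ^+ s by rewrite (le_trans ler01)// exprn_ege1.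
have -> : b ^+ s.+1 = b ^+ s + 4 / N%:R * b ^+ s by rewrite exprSr /b; ring.
rewrite -(subrK (Gseq s) (Gseq s.+1)) mulrDr addrC lerD//.
  exact: le_trans (ler_wpM2r G0 h1) Hs.
rewrite (le_trans (ler_wpM2r D0 h2))// (le_trans H)// mulrA.
by rewrite ler_wpM2r// eps_le.
Qed.

Definition Dseq s : R := S (s%:R + 2^-1) * Gseq s * Gseq (n - s)%N.

Lemma sg_half_mirror s : (s <= n)%N -> S ((n - s)%N%:R + 2^-1) = S (s%:R + 2^-1).
Proof.
move=> sn; rewrite -(sgB (ltn0Sn n) (s%:R + _)); congr (S _).
by rewrite natrB// -[N]addn1 natrD; lra.
Qed.

Lemma Dseq_mirror s : (s <= n)%N -> Dseq (n - s) = Dseq s.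
Proof. by move=> sn; rewrite /Dseq sg_half_mirror// subKn// mulrAC. Qed.

Lemma Dseq_ge s : (s <= n)%N -> S (s%:R + 2^-1) <= Dseq s.
Proof.
move=> sn; have S0 : 0 < S (s%:R + 2^-1) by rewrite sg_half_gt0.
have g1 := Gseq_ge1 (s := s) sn.
have g2 : 1 <= Gseq (n - s) by rewrite Gseq_ge1//; lia.
rewrite /Dseq -mulrA -[leLHS]mulr1 ler_pM2l//; nra.
Qed.

Lemma Dseq_gt0 s : (s <= n)%N -> 0 < Dseq s.
Proof. by move=> sn; rewrite (lt_le_trans _ (Dseq_ge sn))// sg_half_gt0. Qed.

(** The dominating constant for the Riemann sums. By symmetry s may be taken in the left half: G_s
    is bounded there and the sine is spent on G_(n-s). Each factor is at most (1 + 4/N)^N <= e^4,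
    hence the 8. *)
Lemma Dseq_le s : (s <= n)%N -> Dseq s <= expR 8.
Proof.
have H k : (2 * k <= n)%N -> Dseq k <= expR 8.
  move=> kn; have kk : (k <= n)%N by lia.
  have g1 : Gseq k <= b ^+ k by apply: Gseq_le_left; lia.
  have g2 : S (k%:R + 2^-1) * Gseq (n - k) <= b ^+ (n - k).
    by rewrite -sg_half_mirror// sg_Gseq_le//; lia.
  have e1 : b ^+ k <= expR 4 by apply: expRK_le => //; lia.
  have e2 : b ^+ (n - k) <= expR 4 by apply: expRK_le => //; lia.
  have -> : (8 : R) = 4 + 4 by lra.
  rewrite expRD /Dseq mulrAC ler_pM//.
  - by rewrite mulr_ge0 ?ltW// ?sg_half_gt0 ?Gseq_gt0//; lia.
  - by rewrite ltW// Gseq_gt0//; lia.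
  - exact: le_trans e2.
  - exact: le_trans e1.
move=> sn; have [|h] := leqP (2 * s) n; first exact: H.
by rewrite -Dseq_mirror// H//; lia.
Qed.

(** This turns the denominators hidden in G_s G_(n-s) into the sine weight of [Dseq]; it follows
    step by step from sin(pi - x) = sin x. *)
Lemma qprod_mirror s : (s <= n)%N ->
  q s * q (n - s) = q n / S 2^-1 * S (s%:R + 2^-1).
Proof.
have S0 : S 2^-1 != 0 by have := sg_half_gt0 R (ltn0Sn n) (ltn0Sn n); rewrite add0r => /gt_eqF ->.
elim: s => [_|s IH sn]; first by rewrite qprod0 mul1r subn0 add0r divfK.
have [m mE] : exists m, (n - s)%N = m.+1 by exists (n - s.+1)%N; lia.
have nsm : (n - s.+1)%N = m by lia.
have := IH (ltnW sn); rewrite mE nsm !qprodS.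
have -> : S (m%:R + 2^-1) = S (s.+1%:R + 2^-1) by rewrite -nsm sg_half_mirror.
have -> : S m.+1%:R = S s.+1%:R.
  rewrite -(sgB (ltn0Sn n) s.+1%:R); congr (S _).
  have -> : m.+1 = (N - s.+1)%N by lia.
  by rewrite natrB//; lia.
have A : S (s.+1%:R + 2^-1) != 0 by rewrite gt_eqF// sg_half_gt0.
have B : S (s%:R + 2^-1) != 0 by rewrite gt_eqF// sg_half_gt0//; lia.
move: A B; move: (S (s.+1%:R + 2^-1)) (S (s%:R + 2^-1)) => A B A0 B0 e.
apply: (mulIf B0); apply: (mulIf (invr_neq0 A0)).
rewrite [RHS](_ : _ = q n / S 2^-1 * B); last by field; rewrite A0 S0.
by rewrite -e; field; rewrite A0 B0.
Qed.

Lemma green_profile_Dseq : exists2 C : R, 0 < C &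
  forall s : 'I_N, green_profile R s = C * Dseq s.
Proof.
exists (q n / S 2^-1).
  have := sg_half_gt0 R (ltn0Sn n) (ltn0Sn n); rewrite add0r => S0.
  by rewrite divr_gt0// qprod_gt0.
move=> s; have sn : (s <= n)%N by have := ltn_ord s; lia.
rewrite green_profileE /Dseq !mulrA -qprod_mirror// /Gseq pseq_last// chebyshevT_at1 mulr1.
have q1 : q s != 0 by rewrite gt_eqF// qprod_gt0.
have q2 : q (n - s) != 0 by rewrite gt_eqF// qprod_gt0//; lia.
rewrite invrK -[N.-1]/n.
have -> : (2 ^+ n : R) = 2 ^+ s * 2 ^+ (n - s) by rewrite -exprD subnKC.
move: q1 q2; move: (q s) (q (n - s)) (2 ^+ s) (2 ^+ (n - s)) (pseq 1 a s) (pseq 1 a (n - s)) => *.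
by field; apply/andP; split.
Qed.

Lemma sum_sg_half : \sum_(0 <= s < N) S (s%:R + 2^-1) * (2 * sin y) = 2.
Proof.
have H k : \sum_(0 <= s < k) S (s%:R + 2^-1) * (2 * sin y) = 1 - cos (k%:R * (pi / N%:R)).
  elim: k => [|k IH]; first by rewrite big_geq// mul0r cos0 subrr.
  rewrite big_nat_recr//= IH /sg; set u := pi / N%:R.
  have -> : k.+1%:R * u = (k%:R + 2^-1) * u + y by rewrite -[k.+1]addn1 natrD /y -/u; lra.
  have -> : k%:R * u = (k%:R + 2^-1) * u - y by rewrite /y -/u; lra.
  by rewrite cosB cosD; ring.
rewrite H mulrCA divff ?mulr1 ?pnatr_eq0// cospi; ring.
Qed.

(** Since G >= 1, the sum is at least that of the sines, 1/sin y >= 1/y >= N/2. It keeps the mean of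
    D away from 0, and with it [Isin]. *)
Lemma sum_Dseq_ge : N%:R / 2 <= \sum_(0 <= s < N) Dseq s.
Proof.
have /andP[y0 y2] := y_bounds; have N0 : 0 < N%:R :> R by rewrite ltr0n.
have e : \sum_(0 <= s < N) S (s%:R + 2^-1) <= \sum_(0 <= s < N) Dseq s.
  by rewrite big_nat [leRHS]big_nat; apply: ler_sum => s /andP[_ sN]; exact: Dseq_ge.
have s0 : 0 <= \sum_(0 <= s < N) S (s%:R + 2^-1).
  by rewrite big_nat sumr_ge0// => s /andP[_ sN]; rewrite ltW// sg_half_gt0.
apply: le_trans e; have := sum_sg_half; rewrite -mulr_suml.
set X := \sum_(_ <= _ < _) _ in s0 * => XE.
have : 2 <= X * (2 * (2 / N%:R)).
  rewrite -[leLHS]XE ler_wpM2l// ler_pM2l//.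
  by apply: le_trans y2; apply: sin_le_id; exact: ltW.
rewrite -(ler_pM2r N0).
have -> : X * (2 * (2 / N%:R)) * N%:R = 4 * X by field; rewrite gt_eqF.
by lra.
Qed.

End DiscreteLegendre.

(** * The Legendre equation on ]0, 1[ *)

Lemma MVT_in (R : realType) (f df : R -> R) (a b : R) : a < b ->
  (forall t, a <= t <= b -> is_derive t 1 f (df t)) ->
  exists2 c, a < c < b & f b - f a = df c * (b - a).
Proof.
move=> ab fD; have [||c cI ->] := @MVT R f df a b ab.
- by move=> x; rewrite in_itv/= => /andP[ax xb]; apply: fD; rewrite !ltW.
- apply: continuous_in_subspaceT => x; rewrite inE/= in_itv/= => xI.
  apply: differentiable_continuous; apply/derivable1_diffP.
  by have [] := fD x xI.
- by exists c => //; move: cI; rewrite in_itv.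
Qed.

Lemma deriv_ge0_le (R : realType) (f df : R -> R) (a b : R) : a <= b ->
  (forall t, a <= t <= b -> is_derive t 1 f (df t)) ->
  (forall t, a <= t <= b -> 0 <= df t) -> f a <= f b.
Proof.
rewrite le_eqVlt => /predU1P[->//|ab] fD df0.
have [c /andP[ac cb] e] := MVT_in ab fD.
by rewrite -subr_ge0 e mulr_ge0 ?subr_ge0 ?(ltW ab)// df0// (ltW ac) (ltW cb).
Qed.

Lemma sin_ge_cos (R : realType) (x : R) : 0 <= x <= pi -> x * cos x <= sin x.
Proof.
move=> /andP[]; rewrite le_eqVlt => /predU1P[<-|x0 xp]; first by rewrite mul0r sin0.
have [z /andP[z0 zx]] := MVT_in x0 (fun t _ => is_derive_sin t).
rewrite sin0 !subr0 => ->; rewrite [leLHS]mulrC ler_pM2r//.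
have zI : z \in `[0, pi] by rewrite in_itv/=; apply/andP; split; lra.
have xI : x \in `[0, pi] by rewrite in_itv/=; apply/andP; split; lra.
by rewrite leNgt ltr_cos// -leNgt ltW.
Qed.

(* This is what excludes the solutions of the ODE with a logarithmic term. *)
Lemma log_divergence (R : realType) (f df : R -> R) (k t0 d M : R) :
  0 < k -> 0 < t0 -> 0 < d ->
  (forall t, 0 < t <= t0 -> is_derive t 1 f (df t)) ->
  (forall t, 0 < t <= t0 -> k / t <= df t) ->
  (forall t, 0 < t < d -> - M <= f t) -> False.
Proof.
move=> k0 t00 d0 fD dfk fM.
pose K := `|f t0| + `|M| + 1.
have K0 : 0 < K by rewrite ltr_wpDl// addr_ge0.
(* At this point f(s) <= f(t0) - k (ln t0 - ln s) <= f(t0) - K, which is below - M by the choice of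
   [K]. *)
pose s := Num.min (d / 2) (t0 * expR (- (K / k))).
have s0 : 0 < s by rewrite lt_min divr_gt0// mulr_gt0// expR_gt0.
have sd : s < d by rewrite /s gt_min; apply/orP; left; lra.
have e1 : expR (- (K / k)) <= 1 by rewrite -expR0 ler_expR oppr_le0 divr_ge0// ltW.
have st : s <= t0 by rewrite /s ge_min; apply/orP; right; rewrite ler_piMr// ltW.
have ls : ln s <= ln t0 - K / k.
  rewrite -[- (K / k)]expRK -lnM ?posrE ?expR_gt0//.
  by rewrite ler_ln ?posrE ?mulr_gt0 ?expR_gt0// ge_min lexx orbT.
have : (f s - k * ln s) <= (f t0 - k * ln t0).
  apply: (@deriv_ge0_le _ (fun x => f x - k * ln x) (fun x => df x - k / x)) => //.
  - move=> t /andP[stt tt]; have tp : 0 < t by exact: lt_le_trans stt.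
    have Df := fD t ltac:(rewrite tp tt; done).
    have Dl := is_derive1_ln tp.
    apply: is_derive_eq; rewrite /GRing.scale /=; ring.
  - move=> t /andP[stt tt]; have tp : 0 < t by exact: lt_le_trans stt.
    by rewrite subr_ge0 dfk// tp.
have := fM s; rewrite s0 sd => /(_ isT) h1 h2.
have h3 : k * ln s <= k * ln t0 - K.
  by have := ler_wpM2l (ltW k0) ls; rewrite mulrBr mulrCA divff ?mulr1// gt_eqF.
have := ler_norm (f t0); have := ler_norm M; rewrite /K in h3; lra.
Qed.

Section LegendreODE.
Variables (R : realType) (v w : R -> R).
Hypothesis vD : forall t : R, 0 < t < 1 -> is_derive t 1 v (w t / sin (pi * t)).
Hypothesis wD : forall t : R, 0 < t < 1 ->
  is_derive t 1 w (pi ^+ 2 / 4 * sin (pi * t) * v t).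
Hypothesis v_gt0 : forall t : R, 0 < t < 1 -> 0 < v t.
Hypothesis v_lim : v t @[t --> 0^'+] --> (1 : R).

Lemma sin_pi_gt0 (t : R) : 0 < t < 1 -> 0 < sin (pi * t).
Proof.
move=> /andP[t0 t1]; apply: sin_gt0_pi; have p0 := pi_gt0 R.
by rewrite mulr_gt0//= -[ltRHS]mulr1 ltr_pM2l.
Qed.

Lemma v_near1 (e : R) : 0 < e -> exists2 d, 0 < d & forall t, 0 < t < d -> `|1 - v t| < e.
Proof.
move=> e0; have /cvgrPdist_lt/(_ _ e0)[d/= d0 H] := v_lim.
exists d => // t /andP[t0 td]; apply: H => //=.
by rewrite sub0r normrN gtr0_norm.
Qed.

Lemma w_nondecr a b : 0 < a -> a <= b -> b < 1 -> w a <= w b.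
Proof.
move=> a0 ab b1; apply: deriv_ge0_le ab _ _.
  by move=> t /andP[at_ tb]; apply: wD; rewrite (lt_le_trans a0)// (le_lt_trans tb).
move=> t /andP[at_ tb]; have tI : 0 < t < 1 by rewrite (lt_le_trans a0)// (le_lt_trans tb).
by rewrite mulr_ge0// ?(ltW (v_gt0 tI))// mulr_ge0 ?divr_ge0 ?sqr_ge0// ltW// sin_pi_gt0.
Qed.

(** If w(t) < 0, monotonicity keeps w below w(t) on ]0, t], so v' <= w(t)/(pi x) and v would grow
    like a logarithm at 0, against v -> 1. *)
Lemma w_ge0 t : 0 < t < 1 -> 0 <= w t.
Proof.
move=> /andP[t0 t1]; rewrite leNgt; apply/negP => wt.
have p0 := pi_gt0 R.
have [d d0 dP] := v_near1 ltr01.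
apply: (@log_divergence _ (fun x => - v x) (fun x => - (w x / sin (pi * x)))
  (- w t / pi) t d 2) => //.
- by rewrite divr_gt0// oppr_gt0.
- move=> x /andP[x0 xt]; apply: is_deriveN; apply: vD.
  by rewrite x0 (le_lt_trans xt).
- move=> x /andP[x0 xt]; have x1 : x < 1 by exact: le_lt_trans t1.
  have s0 : 0 < sin (pi * x) by rewrite sin_pi_gt0// x0.
  have sx : sin (pi * x) <= pi * x by rewrite sin_le_id// mulr_ge0// ltW.
  have wx : w x <= w t by exact: w_nondecr.
  rewrite -mulNr -mulrA -invfM.
  apply: (@le_trans _ _ (- w t / sin (pi * x))).
    by rewrite ler_pM2l ?oppr_gt0// lef_pV2// posrE mulr_gt0.
  by rewrite ler_pM2r ?invr_gt0// lerN2.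
- move=> x /dP; rewrite ltr_norml => /andP[]; lra.
Qed.

Lemma v_nondecr a b : 0 < a -> a <= b -> b < 1 -> v a <= v b.
Proof.
move=> a0 ab b1; apply: deriv_ge0_le ab _ _.
  by move=> t /andP[at_ tb]; apply: vD; rewrite (lt_le_trans a0)// (le_lt_trans tb).
move=> t /andP[at_ tb]; have tI : 0 < t < 1 by rewrite (lt_le_trans a0)// (le_lt_trans tb).
by rewrite divr_ge0 ?w_ge0// ltW// sin_pi_gt0.
Qed.

Lemma v_ge1 t : 0 < t < 1 -> 1 <= v t.
Proof.
move=> /andP[t0 t1]; apply/ler_addgt0Pr => e e0.
have [d d0 dP] := v_near1 e0.
pose s := Num.min (d / 2) t.
have s0 : 0 < s by rewrite lt_min t0 divr_gt0.
have sd : s < d by rewrite /s gt_min; apply/orP; left; lra.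
have st : s <= t by rewrite /s ge_min lexx orbT.
have := v_nondecr s0 st t1; have := dP s; rewrite s0 sd => /(_ isT).
by rewrite ltr_norml => /andP[]; lra.
Qed.

(** Minus an antiderivative of the weight (pi^2/4) sin(pi t). *)
Let cpi (t : R) : R := pi / 4 * cos (pi * t).

Let cpiD (c t : R) : is_derive t 1 (fun t => c * cpi t) (- (pi ^+ 2 / 4 * sin (pi * t) * c)).
Proof.
rewrite /cpi; apply: is_derive_eq.
  by rewrite /GRing.scale /=; lra.
Qed.

Lemma w_increment a b : 0 < a -> a <= b -> b < 1 ->
  v a * (cpi a - cpi b) <= w b - w a <= v b * (cpi a - cpi b).
Proof.
move=> a0 ab b1.
have D c t : a <= t <= b -> is_derive t 1 (fun t => w t + c * cpi t)
    (pi ^+ 2 / 4 * sin (pi * t) * (v t - c)).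
  move=> /andP[at_ tb]; have tI : 0 < t < 1 by rewrite (lt_le_trans a0)// (le_lt_trans tb).
  have := is_deriveD (wD tI) (cpiD c t); rewrite -mulrBr.
  by [].
have P t : a <= t <= b -> 0 <= pi ^+ 2 / 4 * sin (pi * t).
  move=> /andP[at_ tb]; have tI : 0 < t < 1 by rewrite (lt_le_trans a0)// (le_lt_trans tb).
  by rewrite mulr_ge0 ?divr_ge0 ?sqr_ge0// ltW// sin_pi_gt0.
apply/andP; split.
- have := deriv_ge0_le ab (D (v a)); rewrite mulrBr => H.
  suff : w a + v a * cpi a <= w b + v a * cpi b by lra.
  apply: H => t tI; rewrite mulr_ge0 ?P// subr_ge0.
  by case/andP: tI => at_ tb; apply: v_nondecr => //; exact: le_lt_trans b1.
- have D' t : a <= t <= b -> is_derive t 1 (fun t => - (w t + v b * cpi t))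
    (- (pi ^+ 2 / 4 * sin (pi * t) * (v t - v b))).
    by move=> tI; apply: is_deriveN; exact: D.
  have := deriv_ge0_le ab D'; rewrite mulrBr => H.
  suff : - (w a + v b * cpi a) <= - (w b + v b * cpi b) by lra.
  apply: H => t tI; rewrite -mulrN opprB mulr_ge0 ?P// subr_ge0.
  by case/andP: tI => at_ tb; apply: v_nondecr => //; exact: lt_le_trans at_.
Qed.

Let cpi0 : cpi 0 = pi / 4. Proof. by rewrite /cpi mulr0 cos0 mulr1. Qed.

Let cpi_le t : cpi t <= pi / 4.
Proof. by rewrite /cpi ler_piMr ?divr_ge0 ?pi_ge0// cos_le1. Qed.

(** The upper bound of [w_increment] taken from 0. An excess k > 0 would force w >= k on all of ]0,
    t], and v would go to minus infinity at 0, against its positivity. *)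
Lemma w_le t : 0 < t < 1 -> w t <= v t * (pi / 4 - cpi t).
Proof.
move=> /andP[t0 t1]; rewrite leNgt; apply/negP => wt.
have p0 := pi_gt0 R; have tI : 0 < t < 1 by rewrite t0.
set k := w t - v t * (pi / 4 - cpi t).
have k0 : 0 < k by rewrite subr_gt0.
have wk x : 0 < x -> x <= t -> k <= w x.
  move=> x0 xt; have /andP[_] := w_increment x0 xt t1.
  have := v_gt0 tI; have := cpi_le x; rewrite /k => h1 h2 h3.
  have := ler_wpM2l (ltW h2) h1; lra.
apply: (@log_divergence _ v (fun x => w x / sin (pi * x)) (k / pi) t 1 0) => //.
- by rewrite divr_gt0.
- by move=> x /andP[x0 xt]; apply: vD; rewrite x0 (le_lt_trans xt).
- move=> x /andP[x0 xt]; have x1 : x < 1 by exact: le_lt_trans t1.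
  have s0 : 0 < sin (pi * x) by rewrite sin_pi_gt0// x0.
  have sx : sin (pi * x) <= pi * x by rewrite sin_le_id// mulr_ge0// ltW.
  rewrite -mulrA -invfM.
  apply: (@le_trans _ _ (k / sin (pi * x))).
    by rewrite ler_pM2l// lef_pV2// posrE mulr_gt0.
  by rewrite ler_pM2r ?invr_gt0// wk.
- by move=> x xI; rewrite oppr0 ltW// v_gt0.
Qed.

(** The lower bound of [w_increment] with w >= 0 and v >= 1 at the left end, which then tends to
    0. *)
Lemma w_ge t : 0 < t < 1 -> pi / 4 - cpi t <= w t.
Proof.
move=> /andP[t0 t1]; have c0 := cpi_le t.
have C x : 0 < x -> x <= t -> cpi x - cpi t <= w t.
  move=> x0 xt; have /andP[h _] := w_increment x0 xt t1.
  have xI : 0 < x < 1 by rewrite x0 (le_lt_trans xt).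
  have wx := w_ge0 xI; have vx := v_ge1 xI.
  have p0 := pi_gt0 R.
  have cx : cpi t <= cpi x.
    have I (z : R) : 0 <= z -> z <= 1 -> pi * z \in `[0, pi].
      move=> z0 z1; rewrite in_itv/=; apply/andP; split.
        by rewrite mulr_ge0// ltW.
      by rewrite ler_piMr ?(ltW p0).
    rewrite /cpi ler_pM2l ?divr_gt0// leNgt ltr_cos ?I ?(ltW x0) ?(ltW t0) ?(ltW t1)//.
      by rewrite -leNgt ler_pM2l.
    exact: le_trans xt (ltW t1).
  by nra.
have cc : cpi x @[x --> (0:R)] --> cpi 0.
  apply: (differentiable_continuous); apply/derivable1_diffP.
  by have := cpiD 1 0; rewrite (_ : (fun t => 1 * cpi t) = cpi);
    [case | apply/funext => z; rewrite mul1r].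
apply/ler_addgt0Pr => e e0.
have /cvgrPdist_lt/(_ _ e0)[d/= d0 H] := cc.
pose s := Num.min (d / 2) t.
have s0 : 0 < s by rewrite lt_min t0 divr_gt0.
have sd : s < d by rewrite /s gt_min; apply/orP; left; lra.
have st : s <= t by rewrite /s ge_min lexx orbT.
have := H s; rewrite /= sub0r normrN gtr0_norm// => /(_ sd).
rewrite cpi0 ltr_norml => /andP[h1 h2]; have := C s s0 st; lra.
Qed.

(** Convexity of v. The derivative of w / sin has the sign of (pi^2/4) sin^2 v - pi w cos. For cos
    <= 0 both terms are nonnegative; for cos > 0, [w_le] bounds it below by (pi^2/4) v (1 - cos). *)
Lemma dv_nondecr a b : 0 < a -> a <= b -> b < 1 ->
  w a / sin (pi * a) <= w b / sin (pi * b).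
Proof.
move=> a0 ab b1; have p0 := pi_gt0 R.
pose g t := ((pi ^+ 2 / 4 * sin (pi * t) * v t) * sin (pi * t)
   - w t * (pi * cos (pi * t))) / sin (pi * t) ^+ 2.
apply: (@deriv_ge0_le _ (fun t => w t / sin (pi * t)) g) => // t /andP[at_ tb];
  have tI : 0 < t < 1 by rewrite (lt_le_trans a0)// (le_lt_trans tb).
- have s0 := sin_pi_gt0 tI; have w' := wD tI.
  have Ds : is_derive t 1 (fun x => sin (pi * x)) (pi * cos (pi * t)).
    by apply: is_derive_eq; rewrite /GRing.scale /=; ring.
  apply: (is_derive_eq (is_deriveM w' (is_deriveV (lt0r_neq0 s0) Ds))).
  rewrite /g /GRing.scale /=.
  by move: (lt0r_neq0 s0); move: (sin _) (cos _) => S0 C0 *; field.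
- have s0 := sin_pi_gt0 tI; rewrite /g divr_ge0 ?sqr_ge0// subr_ge0.
  have wl := w_le tI; have w0 := w_ge0 tI; have vt := v_gt0 tI.
  have c1 := cos_le1 (pi * t); have s2 : sin (pi * t) ^+ 2 = 1 - cos (pi * t) ^+ 2 by rewrite sin2cos2.
  have -> : pi ^+ 2 / 4 * sin (pi * t) * v t * sin (pi * t) = pi ^+ 2 / 4 * v t * (1 - cos (pi * t) ^+ 2).
    by rewrite -s2; ring.
  have r0 : 0 <= pi ^+ 2 / 4 * v t * (1 - cos (pi * t)).
    by rewrite mulr_ge0 ?mulr_ge0 ?divr_ge0 ?sqr_ge0 ?subr_ge0// ltW.
  have [cn|cp] := leP (cos (pi * t)) 0.
    apply: (@le_trans _ _ 0).
      by rewrite mulr_ge0_le0// mulr_ge0_le0// ltW.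
    have := cos_geN1 (pi * t).
    by rewrite mulr_ge0 ?mulr_ge0 ?divr_ge0 ?sqr_ge0 ?(ltW vt)//; nra.
  have : w t * (pi * cos (pi * t)) <= v t * (pi / 4 - cpi t) * (pi * cos (pi * t)).
    by rewrite ler_wpM2r// mulr_ge0// ltW.
  move/le_trans; apply; rewrite /cpi.
  have -> : v t * (pi / 4 - pi / 4 * cos (pi * t)) * (pi * cos (pi * t)) =
     pi ^+ 2 / 4 * v t * (1 - cos (pi * t)) * cos (pi * t) by ring.
  have -> : pi ^+ 2 / 4 * v t * (1 - cos (pi * t) ^+ 2) =
     pi ^+ 2 / 4 * v t * (1 - cos (pi * t)) * (1 + cos (pi * t)) by ring.
  by rewrite ler_wpM2l// lerDr.
Qed.

End LegendreODE.

Ltac nlia :=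
  repeat match goal with
  | H : is_true (leq _ _) |- _ => revert H
  | H : is_true (andb (leq _ _) (leq _ _)) |- _ => revert H
  end; clear; intros; lia.

(** * Comparison of the discrete and the continuous Legendre solutions *)

Section Sandwich.
Variables (R : realType) (v w : R -> R).
Hypothesis vD : forall t : R, 0 < t < 1 -> is_derive t 1 v (w t / sin (pi * t)).
Hypothesis wD : forall t : R, 0 < t < 1 ->
  is_derive t 1 w (pi ^+ 2 / 4 * sin (pi * t) * v t).
Hypothesis v_gt0 : forall t : R, 0 < t < 1 -> 0 < v t.
Hypothesis v_lim : v t @[t --> 0^'+] --> (1 : R).

Section FixedN.
Variable n : nat.
Local Notation N := n.+1.
Local Notation S := (@sg R N).
Local Notation G := (@Gseq R n).
Let h : R := N%:R^-1.
Let y : R := pi / N%:R / 2.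
Let t_ (s : nat) : R := s%:R * h.
Let V s := v (t_ s).
Let W s := w (t_ s).
(** The exact integral of (pi^2/4) sin(pi t) over the i-th step. Being a multiple of S_(i+1/2), it
    gives the sums for w the same weights as those for G, up to a constant. *)
Let c i : R := pi / 2 * sin y * S (i%:R + 2^-1).

Let N0 : 0 < N%:R :> R. Proof. by rewrite ltr0n. Qed.
Let h0 : 0 < h. Proof. by rewrite /h invr_gt0. Qed.
Let h1 : h <= 1. Proof. by rewrite /h invf_le1// ler1n. Qed.
Let y0 : 0 < y. Proof. by have /andP[] := y_bounds R n. Qed.

Let tI s : (0 < s < N)%N -> 0 < t_ s < 1.
Proof.
move=> /andP[s0 sN]; rewrite /t_ mulr_gt0 ?ltr0n//= ltr_pdivrMr// mul1r ltr_nat//.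
Qed.

Let tS s : t_ s.+1 = t_ s + h.
Proof. by rewrite /t_ -[s.+1]addn1 natrD mulrDl mul1r. Qed.

Let t0 : t_ 0 = 0. Proof. by rewrite /t_ mul0r. Qed.

Let sinS s : sin (pi * t_ s) = S s%:R.
Proof. by rewrite /sg /t_ mulrCA. Qed.

Let cE i : c i = pi / 4 * cos (pi * t_ i) - pi / 4 * cos (pi * t_ i.+1).
Proof.
have -> : pi * t_ i = (i%:R + 2^-1) * (pi / N%:R) - y.
  by rewrite /t_ /y /h; move: (lt0r_neq0 N0); move: (N%:R : R) => z z0; field.
have -> : pi * t_ i.+1 = (i%:R + 2^-1) * (pi / N%:R) + y.
  rewrite /t_ /y /h -[i.+1]addn1 [(i + 1)%:R]natrD.
  by move: (lt0r_neq0 N0); move: (N%:R : R) => z z0; field.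
by rewrite /c /sg cosB cosD; field.
Qed.

Let c_ge0 i : (i < N)%N -> 0 <= c i.
Proof.
move=> iN; rewrite /c mulr_ge0 ?(ltW (sg_half_gt0 _ _ iN))// mulr_ge0 ?divr_ge0 ?pi_ge0//.
rewrite ltW// sin_gt0_pi// y0/= /y; have p0 := pi_gt0 R.
rewrite -mulrA gtr_pMr//.
have : N%:R^-1 <= 1 :> R by rewrite invf_le1// ler1n.
by rewrite -/h; lra.
Qed.

(** By convexity the increment lies between h v' at the two ends of the step. *)
Lemma V_step s : (0 < s)%N -> (s.+1 < N)%N ->
  h * (W s / S s%:R) <= V s.+1 - V s <= h * (W s.+1 / S s.+1%:R).
Proof.
move=> s0 sN; have /andP[a0 a1] := tI (s := s) ltac:(nlia).
have /andP[b0 b1] := tI (s := s.+1) ltac:(nlia).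
have ab : t_ s < t_ s.+1 by rewrite tS ltrDl.
have [|x /andP[ax xb] e] := MVT_in ab (f := v) (df := fun t => w t / sin (pi * t)).
  by move=> t /andP[at_ tb]; apply: vD; rewrite (lt_le_trans a0)// (le_lt_trans tb).
have -> : V s.+1 - V s = h * (w x / sin (pi * x)).
  by rewrite /V e mulrC tS; congr (_ * _); ring.
rewrite !ler_pM2l// -!sinS /W; apply/andP; split.
- by apply: (dv_nondecr vD wD v_gt0 v_lim) => //; [exact: ltW | exact: lt_trans b1].
- by apply: (dv_nondecr vD wD v_gt0 v_lim) => //; [exact: lt_trans ax | exact: ltW].
Qed.

Lemma W_upper s : (s.+1 < N)%N -> W s.+1 <= \sum_(0 <= i < s.+1) c i * V i.+1.
Proof.
elim: s => [|s IH] sN.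
  have H := w_le vD wD v_gt0 v_lim (tI (s := 1) ltac:(nlia)).
  rewrite big_nat1 [leRHS]mulrC cE t0 mulr0 cos0 mulr1; exact: H.
rewrite big_nat_recr//=; have := IH (ltnW sN).
have /andP[a0 a1] := tI (s := s.+1) ltac:(nlia).
have /andP[b0 b1] := tI (s := s.+2) ltac:(nlia).
have ab : t_ s.+1 <= t_ s.+2 by rewrite [leRHS]tS lerDl ltW.
have /andP[_] := w_increment vD wD v_gt0 v_lim a0 ab b1.
by rewrite -cE [_ * c _]mulrC -/(V _) -/(W _) -/(W _); lra.
Qed.

(** Only the values of v inside ]0, 1[ are controlled, so at i = 0 its limit 1 stands in for
    [V 0]. *)
Lemma W_lower s : (s.+1 < N)%N ->
  \sum_(0 <= i < s.+1) c i * (if i is 0 then 1 else V i) <= W s.+1.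
Proof.
elim: s => [|s IH] sN.
  have H := w_ge vD wD v_gt0 v_lim (tI (s := 1) ltac:(nlia)).
  rewrite big_nat1 cE t0 mulr0 cos0 !mulr1; exact: H.
rewrite big_nat_recr//=; have := IH (ltnW sN).
have /andP[a0 a1] := tI (s := s.+1) ltac:(nlia).
have /andP[b0 b1] := tI (s := s.+2) ltac:(nlia).
have ab : t_ s.+1 <= t_ s.+2 by rewrite [leRHS]tS lerDl ltW.
have /andP[H _] := w_increment vD wD v_gt0 v_lim a0 ab b1; move: H.
by rewrite -cE [_ * c _]mulrC -/(V _) -/(W _) -/(W _); lra.
Qed.

(** The continuous counterpart of [eps_step]: y sin y against 2 (1 - cos y), both close to y^2. *)
Let kappa : R := y * sin y.

Let hc i : h * c i = kappa * S (i%:R + 2^-1).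
Proof. 
rewrite /c /kappa; set X := sin y; set Z := S _; rewrite /y /h.
by move: (lt0r_neq0 N0); move: (N%:R : R) => z z0; field.
 Qed.

(** This factor absorbs cos y: cos y >= 1 - 2 h^2, and (1 + 4h)(1 - 2h^2) >= 1 as soon as h <= 1/2,
    that is n > 0. *)
Let r' : R := 1 + 4 * h.

Hypothesis n0 : (0 < n)%N.

Let h2 : h <= 2^-1.
Proof. by rewrite /h lef_pV2 ?posrE// ler_nat. Qed.

Let cosy : 1 <= r' * cos y.
Proof.
have := onem_cos_le (ltW y0); have /andP[_] := y_bounds R n.
rewrite -/y -/h => yh cy.
have y2 : y ^+ 2 <= (2 * h) ^+ 2 by rewrite lerXn2r ?nnegrE ?(ltW y0)// mulr_ge0// ltW.
have : 1 - 2 * h ^+ 2 <= cos y by nra.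
have r'0 : 0 <= r' by rewrite /r'; have := h0; lra.
move=> /(ler_wpM2l r'0); apply: le_trans.
rewrite /r'; have := h2; have := h0; nra.
Qed.

Let y1 : y <= 1.
Proof. by have /andP[_] := y_bounds R n; rewrite -/y -/h; have := h2; lra. Qed.

Let kappa_eps : kappa <= r' * eps_step R n.
Proof.
have k1 : kappa <= y ^+ 2 by rewrite /kappa expr2 ler_pM2l// sin_le_id// ltW.
(* From tan(y/2) >= y/2 and cos(y/2)^2 = (1 + cos y)/2 >= cos y. *)
have e1 : y ^+ 2 * cos y <= eps_step R n.
  have yh0 : 0 <= y / 2 by rewrite divr_ge0// ltW.
  have y0' := y0; have y1' := y1; have p2 := pi_ge2 R.
  have sy : y / 2 * cos (y / 2) <= sin (y / 2).
    by apply: sin_ge_cos; rewrite yh0/=; lra.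
  have c2 : cos y = 1 - 2 * sin (y / 2) ^+ 2.
    by rewrite {1}(splitr y) cosD -!expr2 cos2sin2; ring.
  have c3 : cos y = 2 * cos (y / 2) ^+ 2 - 1.
    by rewrite {1}(splitr y) cosD -!expr2 sin2cos2; ring.
  have ch : 0 <= cos (y / 2).
    by rewrite cos_ge0_pihalf//; have := pi_ge2 R; lra.
  have sq : (y / 2 * cos (y / 2)) ^+ 2 <= sin (y / 2) ^+ 2.
    have p1 : 0 <= y / 2 * cos (y / 2) by rewrite mulr_ge0.
    by rewrite lerXn2r ?nnegrE// (le_trans p1 sy).
  have -> : eps_step R n = 4 * sin (y / 2) ^+ 2 by rewrite /eps_step -/y c2; ring.
  have : y ^+ 2 * cos y <= y ^+ 2 * cos (y / 2) ^+ 2.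
    by rewrite ler_wpM2l ?sqr_ge0//; have := cos_le1 y; lra.
  by move: sq; rewrite exprMn; lra.
have r'0 : 0 <= r' by rewrite /r'; have := h0; lra.
apply: (le_trans k1); apply: le_trans (ler_wpM2l r'0 e1).
by rewrite mulrCA ler_peMr ?sqr_ge0.
Qed.

Let eps_kappa : eps_step R n <= r' * kappa.
Proof.
have r'0 : 0 <= r' by rewrite /r'; have := h0; lra.
apply: (@le_trans _ _ (y ^+ 2)); first exact: onem_cos_le (ltW y0).
apply: (@le_trans _ _ (r' * (y * (y * cos y)))).
  have -> : r' * (y * (y * cos y)) = y ^+ 2 * (r' * cos y) by ring.
  by rewrite ler_peMr ?sqr_ge0.
rewrite ler_wpM2l// ler_pM2l// sin_ge_cos// (ltW y0)/=.
by have := y1; have := pi_ge2 R; lra.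
Qed.

Let V_ge1 s : (0 < s < N)%N -> 1 <= V s.
Proof. by move=> sI; apply: (v_ge1 vD wD v_gt0 v_lim); exact: tI. Qed.

Variables (m : nat) (A : R).
Hypothesis mN : (m.+1 < N)%N.
Hypothesis A0 : 0 <= A.
Hypothesis VA : forall i, (i <= m)%N -> V i.+1 - (if i is 0 then 1 else V i) <= h * A.

Let r : R := 1 + h * A.

Let V_ratio i : (i <= m)%N -> V i.+1 <= r * (if i is 0 then 1 else V i).
Proof.
move=> im; have := VA im; rewrite /r; set X := (if i is _.+1 then _ else _).
have : 1 <= X by rewrite /X; case: (i) im => // k km; apply: V_ge1; nlia.
have := mulr_ge0 (ltW h0) A0; nra.
Qed.

(** From r r' - 1 = h (A + 4 + 4 h A) and h <= 1. *)
Let C1 : R := 5 * A + 4.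

Let rr : r * r' - 1 <= h * C1.
Proof.
rewrite /r /r' /C1; have := mulr_ge0 (ltW h0) A0; have := h0; have := h1; nra.
Qed.

Let r_ge1 : 1 <= r. Proof. by rewrite /r lerDl mulr_ge0// ltW. Qed.
Let r'_ge1 : 1 <= r'. Proof. by rewrite /r' lerDl mulr_ge0// ltW. Qed.

(* Up to a factor 1 + O(h) the increments of G and V are given by the same sum
   over the past, and an increment is itself O(h); so each step costs a factor
   1 + O(h^2), which leaves 1 + O(h) after N steps. *)
Let b : R := 1 + C1 * A * h ^+ 2.

Let b_ge1 : 1 <= b.
Proof. by rewrite /b lerDl mulr_ge0 ?sqr_ge0// mulr_ge0// /C1; have := A0; lra. Qed.

(** The quotient by S_(s+1) in [Gseq_diff] matches the lower bound of [V_step] for V_(s+2) -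
    V_(s+1), hence the index shift between G and V. The factor r passes from V_(i+1) back to V_i in
    the sum, and r' exchanges [eps_step] for [kappa]. *)
Let G_increment s : (s < m)%N -> (forall i, (i <= s)%N -> G i <= b ^+ i * V i.+1) ->
  G s.+1 - G s <= r * r' * b ^+ s * (V s.+2 - V s.+1).
Proof.
move=> sm IH; have S0 := sg_ord_gt0 R (ltn0Sn n) (s := s.+1) ltac:(nlia).
have bs : 1 <= b ^+ s by rewrite exprn_ege1.
rewrite -(ler_pM2l S0) Gseq_diff; last by nlia.
have /andP[H1 _] := V_step (s := s.+1) isT ltac:(nlia).
have H2 : S s.+1%:R * (h * (W s.+1 / S s.+1%:R)) = h * W s.+1 by field; rewrite gt_eqF.
have H3 : h * W s.+1 <= S s.+1%:R * (V s.+2 - V s.+1) by rewrite -H2 ler_pM2l.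
have H4 := ler_wpM2l (ltW h0) (W_lower (s := s) ltac:(nlia)).
have H5 := le_trans H4 H3.
have sum0 : 0 <= \sum_(0 <= i < s.+1) S (i%:R + 2^-1) * G i.
  rewrite big_nat sumr_ge0// => i /andP[_ iS].
    rewrite mulr_ge0// ltW ?sg_half_gt0 ?Gseq_gt0//; nlia.
have H6 : kappa * \sum_(0 <= i < s.+1) S (i%:R + 2^-1) * G i <=
   r * b ^+ s * (h * \sum_(0 <= i < s.+1) c i * (if i is 0 then 1 else V i)).
  rewrite !mulr_sumr big_nat [leRHS]big_nat; apply: ler_sum => i /andP[_ iS].
  have k0 : 0 <= S (i%:R + 2^-1) by rewrite ltW// sg_half_gt0//; nlia.
  have kap0 : 0 <= kappa.
    have hc0 : 0 <= h * c i by rewrite mulr_ge0 ?(ltW h0)// c_ge0//; nlia.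
    have k1 : 0 < S (i%:R + 2^-1) by rewrite sg_half_gt0//; nlia.
    by move: hc0; rewrite hc pmulr_lge0.
  have vi := V_ratio (i := i) ltac:(nlia); have gi := IH i ltac:(nlia).
  have bi : b ^+ i <= b ^+ s by rewrite ler_weXn2l//; nlia.
  have V1 : 0 <= V i.+1 by rewrite (le_trans ler01)// V_ge1//; nlia.
  have gi2 : G i <= b ^+ s * (r * (if i is 0 then 1 else V i)).
    apply: (le_trans gi); apply: (@le_trans _ _ (b ^+ s * V i.+1)).
      by rewrite ler_wpM2r.
    by rewrite ler_wpM2l// (le_trans ler01).
  set X := (if i is _.+1 then _ else _) in gi2 *.
  rewrite [leLHS](_ : _ = (S (i%:R + 2^-1) * kappa) * G i); last by ring.
  rewrite [leRHS](_ : _ = (h * c i) * (b ^+ s * (r * X))); last by ring.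
  rewrite hc [kappa * _]mulrC.
  by rewrite ler_wpM2l// mulr_ge0.
apply: (le_trans (ler_wpM2r sum0 eps_kappa)); rewrite -[leLHS]mulrA.
have r'0 : 0 <= r' by rewrite (le_trans ler01).
apply: (le_trans (ler_wpM2l r'0 H6)).
have rb0 : 0 <= r' * (r * b ^+ s).
  by rewrite mulr_ge0// mulr_ge0// (le_trans ler01).
rewrite [leLHS]mulrA; apply: (le_trans (ler_wpM2l rb0 H5)).
by rewrite le_eqVlt; apply/orP; left; apply/eqP; ring.
Qed.

Let dV s : (s < m)%N -> 0 <= V s.+2 - V s.+1 <= h * A.
Proof.
move=> sm; have := VA (i := s.+1) sm => ->; rewrite andbT subr_ge0.
have /andP[a0 a1] := tI (s := s.+1) ltac:(nlia).
have /andP[b0 b1] := tI (s := s.+2) ltac:(nlia).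
by apply: (v_nondecr vD wD v_gt0 v_lim) => //; rewrite [leRHS]tS lerDl ltW.
Qed.

Lemma G_le_V s : (s <= m)%N -> G s <= b ^+ s * V s.+1.
Proof.
elim/ltn_ind: s => -[|s] IH sm.
  by rewrite Gseq0 expr0 mul1r V_ge1//; nlia.
have IH' i : (i <= s)%N -> G i <= b ^+ i * V i.+1 by move=> is_; apply: IH; nlia.
have inc := G_increment sm IH'; have gs := IH' s (leqnn s).
have /andP[d0 dA] := dV sm.
have bs : 1 <= b ^+ s by rewrite exprn_ege1.
have V2 : 1 <= V s.+2 by rewrite V_ge1//; nlia.
set D := V s.+2 - V s.+1 in inc d0 dA.
have E : V s.+1 = V s.+2 - D by rewrite /D; ring.
have key : (r * r' - 1) * D <= C1 * A * h ^+ 2 * V s.+2.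
  apply: (@le_trans _ _ (h * C1 * (h * A))).
    apply: ler_pM => //; rewrite subr_ge0.
    by rewrite -[leLHS]mulr1 ler_pM.
  have -> : h * C1 * (h * A) = C1 * A * h ^+ 2 by ring.
  have C10 : 0 <= C1 by rewrite /C1; have := A0; lra.
  by rewrite ler_peMr// mulr_ge0 ?sqr_ge0// mulr_ge0.
rewrite exprSr -mulrA.
have -> : G s.+1 = G s + (G s.+1 - G s) by ring.
apply: (@le_trans _ _ (b ^+ s * V s.+1 + r * r' * b ^+ s * D)); first exact: lerD.
have -> : b ^+ s * V s.+1 + r * r' * b ^+ s * D = b ^+ s * (V s.+2 + (r * r' - 1) * D).
  by rewrite E; ring.
rewrite ler_pM2l; last by rewrite (lt_le_trans ltr01).
by rewrite /b [leRHS]mulrDl mul1r lerD2l.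
Qed.

Let b_exp s : (s <= N)%N -> b ^+ s <= expR (C1 * A * h).
Proof.
move=> sN; have C0 : 0 <= C1 * A * h.
  by rewrite mulr_ge0 ?(ltW h0)// mulr_ge0// /C1; have := A0; lra.
have := expRK_le C0 sN; rewrite -/h.
by rewrite -mulrA -expr2.
Qed.

Lemma G_upper s : (s <= m)%N -> G s <= expR (C1 * A * h) * V s.+1.
Proof.
move=> sm; apply: (le_trans (G_le_V sm)); rewrite ler_wpM2r ?b_exp//; last by nlia.
by rewrite (le_trans ler01)// V_ge1//; nlia.
Qed.

(** A Lipschitz constant for G, from [G_increment] with r <= 1 + A, r' <= 5, b^s <= e^(C1 A) and
    increments of V at most h A. The reverse comparison needs it. *)
Let C2 : R := (1 + A) * 5 * expR (C1 * A) * A.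

Let C10 : 0 <= C1. Proof. by rewrite /C1; have := A0; lra. Qed.

Let dG s : (s < m)%N -> G s.+1 - G s <= h * C2.
Proof.
move=> sm; have := G_increment sm (fun i hi => G_le_V (s := i) ltac:(nlia)).
move/le_trans; apply; have /andP[d0 dA] := dV sm.
have bE : b ^+ s <= expR (C1 * A).
  apply: (@le_trans _ _ (expR (C1 * A * h))); first by apply: b_exp; nlia.
  by rewrite ler_expR ler_piMr// mulr_ge0.
have bs : 1 <= b ^+ s by rewrite exprn_ege1.
rewrite /C2 [leRHS](_ : _ = (1 + A) * 5 * expR (C1 * A) * (h * A)); last by ring.
have r1 : r <= 1 + A by rewrite /r lerD2l ler_piMl.
have r2 : r' <= 5 by rewrite /r'; have := h1; lra.
have rp := le_trans ler01 r_ge1; have rp' := le_trans ler01 r'_ge1.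
have bp := le_trans ler01 bs.
by apply: ler_pM => //; [rewrite !mulr_ge0 | apply: ler_pM => //; [rewrite mulr_ge0 | apply: ler_pM]].
Qed.

Let b' : R := 1 + C1 * C2 * h ^+ 2.

Let C20 : 0 <= C2.
Proof. by rewrite /C2 !mulr_ge0 ?expR_ge0// addr_ge0. Qed.

Let b'_ge1 : 1 <= b'.
Proof. by rewrite /b' lerDl mulr_ge0 ?sqr_ge0// mulr_ge0. Qed.

(** The upper bound of [V_step] has S_(s+2) as denominator, like the increment from G_(s+1) to
    G_(s+2), so no shift occurs here. The factor [V 1] starts the induction and tends to 1 as N
    grows. *)
Lemma V_le_G s : (s < m)%N -> V s.+1 <= V 1 * b' ^+ s.+1 * G s.+1.
Proof.
have V10 : 1 <= V 1 by rewrite V_ge1//; nlia.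
elim/ltn_ind: s => -[|s] IH sm.
  rewrite -mulrA ler_peMr//; first by rewrite (le_trans ler01).
  have g1 : 1 <= G 1 by rewrite Gseq_ge1//; nlia.
  by rewrite expr1 -[leLHS]mulr1 ler_pM.
have IH' i : (i <= s)%N -> V i.+1 <= V 1 * b' ^+ i.+1 * G i.+1 by move=> is_; apply: IH; nlia.
have S0 := sg_ord_gt0 R (ltn0Sn n) (s := s.+2) ltac:(nlia).
have /andP[_ H1] := V_step (s := s.+1) isT ltac:(nlia).
have H4 := ler_wpM2l (ltW h0) (W_upper (s := s.+1) ltac:(nlia)).
have V1p : 0 <= V 1 by rewrite (le_trans ler01).
have bp k : 0 <= b' ^+ k by rewrite (le_trans ler01)// exprn_ege1.
have rp := le_trans ler01 r_ge1; have rp' := le_trans ler01 r'_ge1.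
pose B := V 1 * b' ^+ s.+1.
have B0 : 0 <= B by rewrite mulr_ge0.
have H6 : h * \sum_(0 <= i < s.+2) c i * V i.+1 <=
   r * B * (kappa * \sum_(0 <= i < s.+2) S (i%:R + 2^-1) * G i).
  rewrite !mulr_sumr big_nat [leRHS]big_nat; apply: ler_sum => i /andP[_ iS].
  rewrite mulrA hc.
  have k1 : 0 < S (i%:R + 2^-1) by rewrite sg_half_gt0//; nlia.
  have hc0 : 0 <= kappa * S (i%:R + 2^-1).
    by rewrite -hc mulr_ge0 ?(ltW h0)// c_ge0//; nlia.
  rewrite [leRHS](_ : _ = kappa * S (i%:R + 2^-1) * (r * (B * G i))); last by ring.
  rewrite ler_wpM2l//; apply: (le_trans (V_ratio (i := i) ltac:(nlia))).
  rewrite ler_wpM2l//; case: i iS {k1 hc0} => [|i] iS.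
    by rewrite Gseq0 mulr1 /B -[leLHS]mulr1 ler_pM// exprn_ege1.
  apply: (le_trans (IH' i ltac:(nlia))).
  rewrite ler_wpM2r//; first by rewrite ltW// Gseq_gt0//; nlia.
  by rewrite ler_wpM2l// ler_weXn2l//; nlia.
have sum0 : 0 <= \sum_(0 <= i < s.+2) S (i%:R + 2^-1) * G i.
  rewrite big_nat sumr_ge0// => i /andP[_ iS].
    rewrite mulr_ge0// ltW ?sg_half_gt0 ?Gseq_gt0//; nlia.
have H7 : V s.+2 - V s.+1 <= r * r' * B * (G s.+2 - G s.+1).
  apply: (le_trans H1); rewrite mulrA ler_pdivrMr//.
  apply: (le_trans H4); apply: (le_trans H6).
  have rB : 0 <= r * B by rewrite mulr_ge0.
  apply: (le_trans (ler_wpM2l rB (ler_wpM2r sum0 kappa_eps))).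
  rewrite -(mulrA r') -Gseq_diff; last by nlia.
  by rewrite le_eqVlt; apply/orP; left; apply/eqP; ring.
have g1 : 1 <= G s.+2 by rewrite Gseq_ge1//; nlia.
have gd : 0 <= G s.+2 - G s.+1 by rewrite subr_ge0 Gseq_nondecr//; nlia.
have key : (r * r' - 1) * (G s.+2 - G s.+1) <= C1 * C2 * h ^+ 2 * G s.+2.
  apply: (@le_trans _ _ (h * C1 * (h * C2))).
    apply: ler_pM => //; first by rewrite subr_ge0 -[leLHS]mulr1 ler_pM.
    by apply: dG; nlia.
  have -> : h * C1 * (h * C2) = C1 * C2 * h ^+ 2 by ring.
  by rewrite ler_peMr// mulr_ge0 ?sqr_ge0// mulr_ge0.
have -> : V s.+2 = V s.+1 + (V s.+2 - V s.+1) by ring.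
apply: (@le_trans _ _ (B * G s.+1 + r * r' * B * (G s.+2 - G s.+1))).
  by apply: lerD => //; exact: IH'.
have -> : B * G s.+1 + r * r' * B * (G s.+2 - G s.+1) =
  B * (G s.+2 + (r * r' - 1) * (G s.+2 - G s.+1)) by ring.
rewrite exprSr mulrA -/B -mulrA ler_wpM2l//.
by rewrite /b' [leRHS]mulrDl mul1r lerD2l.
Qed.

Lemma V_upper s : (s < m)%N -> V s.+1 <= V 1 * expR (C1 * C2 * h) * G s.+1.
Proof.
move=> sm; apply: (le_trans (V_le_G sm)).
rewrite ler_wpM2r//; first by rewrite ltW// Gseq_gt0//; nlia.
rewrite ler_wpM2l//; first by rewrite (le_trans ler01)// V_ge1//; nlia.
have C0 : 0 <= C1 * C2 * h by rewrite mulr_ge0 ?(ltW h0)// mulr_ge0.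
have := @expRK_le _ _ s.+1 N C0 ltac:(nlia); rewrite -/h.
by rewrite -mulrA -expr2.
Qed.

End FixedN.

Lemma Gseq_sandwich (T : R) : 0 < T < 1 ->
  exists2 K : R, 0 <= K & forall n s, (0 < n)%N -> (0 < s)%N ->
    s.+2%:R <= T * n.+1%:R ->
    v (s%:R / n.+1%:R) <= v (n.+1%:R^-1) * expR (K / n.+1%:R) * Gseq R n s /\
    Gseq R n s <= expR (K / n.+1%:R) * v (s.+1%:R / n.+1%:R).
Proof.
move=> TI; pose A := w T / sin (pi * T).
have A0 : 0 <= A.
  by rewrite divr_ge0 ?(w_ge0 vD wD v_gt0 v_lim)// ltW// sin_pi_gt0.
have /andP[T0 T1] := TI.
pose C1 : R := 5 * A + 4; pose C2 : R := (1 + A) * 5 * expR (C1 * A) * A.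
have C10 : 0 <= C1 by rewrite /C1; lra.
have C20 : 0 <= C2.
  apply: (mulr_ge0 _ A0); apply: mulr_ge0; last exact: expR_ge0.
  by apply: mulr_ge0 => //; exact: addr_ge0 ler01 A0.
have lip a b : 0 < a -> a <= b -> b <= T -> v b - v a <= (b - a) * A.
  move=> a0; rewrite le_eqVlt => /predU1P[<-|ab] bT; first by rewrite !subrr mul0r.
  have [|x /andP[ax xb] ->] := MVT_in ab (f := v) (df := fun t => w t / sin (pi * t)).
    move=> t /andP[at_ tb]; apply: vD; rewrite (lt_le_trans a0)//=.
    by rewrite (le_lt_trans (le_trans tb bT)).
  rewrite mulrC ler_pM2l ?subr_gt0//.
  apply: (dv_nondecr vD wD v_gt0 v_lim) => //; first exact: lt_trans ax.
  exact: le_trans (ltW xb) bT.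
have lip0 b : 0 < b -> b <= T -> v b - 1 <= b * A.
  move=> b0 bT; apply/ler_addgt0Pr => e e0.
  have [d d0 dP] := v_near1 v_lim e0.
  pose a := Num.min (d / 2) b.
  have a0 : 0 < a by rewrite lt_min b0 divr_gt0.
  have ad : a < d by rewrite /a gt_min; apply/orP; left; lra.
  have ab : a <= b by rewrite /a ge_min lexx orbT.
  have := lip a b a0 ab bT; have := dP a; rewrite a0 ad => /(_ isT).
  rewrite ltr_norml => /andP[h1 h2]; have := mulr_ge0 (ltW a0) A0; nra.
exists (C1 * A + C1 * C2); first by rewrite addr_ge0// mulr_ge0.
move=> n s n0 s0 sT.
have N0 : 0 < n.+1%:R :> R by rewrite ltr0n.
have h0 : 0 < n.+1%:R^-1 :> R by rewrite invr_gt0.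
(* The comparison is applied with m = s + 1, so the last grid point it meets is (s + 2)/N <= T. *)
have mN : (s.+2 < n.+1)%N.
  by rewrite -(ltr_nat R) (le_lt_trans sT)// gtr_pMl.
have VA i : (i <= s.+1)%N ->
    v (i.+1%:R * n.+1%:R^-1) - (if i is 0 then 1 else v (i%:R * n.+1%:R^-1)) <= n.+1%:R^-1 * A.
  move=> is_; have iT : i.+1%:R * n.+1%:R^-1 <= T.
    by rewrite ler_pdivrMr// (le_trans _ sT)// ler_nat; nlia.
  case: i is_ iT => [|i] is_ iT; first by rewrite mul1r lip0// -[leLHS]mul1r.
  have hE : n.+1%:R^-1 = i.+2%:R * n.+1%:R^-1 - i.+1%:R * n.+1%:R^-1 :> R.
    by rewrite -mulrBl -natrB// subSnn mul1r.
  rewrite [X in _ <= X * _]hE; apply: lip => //.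
  by rewrite ler_pM2r// ler_nat.
have ex (x z : R) : 0 <= z -> expR (x / n.+1%:R) <= expR ((x + z) / n.+1%:R).
  by move=> z0; rewrite ler_expR ler_pM2r// lerDl.
split.
- case: s s0 mN VA {sT} => // s _ mN VA.
  have := @V_upper n n0 s.+2 A mN A0 VA s ltac:(nlia); move/le_trans; apply.
  rewrite mul1r ler_wpM2r//; first by rewrite ltW// Gseq_gt0//; nlia.
  rewrite ler_wpM2l//; first by rewrite ltW// v_gt0// h0 invf_lt1// ltr1n; nlia.
  by rewrite [_ + C1 * C2]addrC ex// mulr_ge0.
- have := @G_upper n n0 s.+1 A mN A0 VA s ltac:(nlia); move/le_trans; apply.
  rewrite ler_wpM2r//; last by rewrite ex// mulr_ge0.
  rewrite ltW// v_gt0// mulr_gt0//= ltr_pdivrMr// mul1r ltr_nat; nlia.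
Qed.

End Sandwich.

(** * From the equation of f to the Legendre equation *)

Lemma sinc_cvg (R : realType) :
  sin (pi * t) / (pi * t) @[t --> 0^'+] --> (1 : R).
Proof.
have p0 := pi_gt0 R.
have c1 : cos (pi * t) @[t --> (0:R)^'+] --> (1 : R).
  have : cos (pi * t) @[t --> (0:R)] --> cos (pi * 0).
    apply: differentiable_continuous; apply/derivable1_diffP.
    exact: ex_derive.
  by rewrite mulr0 cos0; exact: cvg_at_right_filter.
apply: (@squeeze_cvgr _ _ _ _ (fun t => cos (pi * t)) (fun=> 1)) c1 (cvg_cst _).
near=> t; have t0 : 0 < t by near: t; exact: nbhs_right_gt.
have t1 : t < 1 by near: t; exact: nbhs_right_lt.
have pt : 0 < pi * t by rewrite mulr_gt0.
rewrite ler_pdivlMr// ler_pdivrMr// mul1r [cos _ * _]mulrC.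
rewrite (sin_le_id (ltW pt)) andbT; apply: sin_ge_cos.
by rewrite (ltW pt) /= ler_piMr ?ltW.
Unshelve. all: by end_near. Qed.

Section SineSolution.
Variables (R : realType) (f : R -> R).
Hypothesis hf : is_sine_solution f.

(* This substitution turns the equation of f into (sin(pi t) v')' =
   (pi^2/4) sin(pi t) v and the normalization f ~ sqrt t into v -> 1; wsol is
   sin(pi t) v'. *)
Definition vsol (t : R) : R := Num.sqrt pi * (f t * (Num.sqrt (sin (pi * t)))^-1).

Definition wsol (t : R) : R :=
  Num.sqrt pi * (derive1 f t * Num.sqrt (sin (pi * t))
    - pi / 2 * (cos (pi * t) * (f t * (Num.sqrt (sin (pi * t)))^-1))).

Lemma vsol_gt0 (t : R) : 0 < t < 1 -> 0 < vsol t.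
Proof.
move=> tI; have [f0 _ _ _] := hf.
by rewrite mulr_gt0 ?sqrtr_gt0 ?pi_gt0// mulr_gt0 ?f0// invr_gt0 sqrtr_gt0 sin_pi_gt0.
Qed.

Lemma vsol_cvg : vsol t @[t --> 0^'+] --> (1 : R).
Proof.
have [_ _ _ fl] := hf; have p0 := pi_gt0 R.
have s1 : Num.sqrt (sin (pi * t) / (pi * t)) @[t --> 0^'+] --> (1 : R).
  rewrite -[X in _ --> (X : R)]sqrtr1.
  by apply: continuous_cvg; [exact: sqrt_continuous | exact: sinc_cvg].
have : (f t / Num.sqrt t) * (Num.sqrt (sin (pi * t) / (pi * t)))^-1 @[t --> 0^'+] --> (1 : R).
  have H := cvgM fl (cvgV (oner_neq0 _) s1).
  by rewrite invr1 mulr1 in H; exact: H.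
apply: cvg_trans; apply: near_eq_cvg; near=> t.
have t0 : 0 < t by near: t; exact: nbhs_right_gt.
have t1 : t < 1 by near: t; exact: nbhs_right_lt.
have s0 : 0 < sin (pi * t) by rewrite sin_pi_gt0// t0.
rewrite sqrtrM ?ltW// sqrtrV ?mulr_ge0 ?ltW// sqrtrM ?ltW//.
have a : Num.sqrt t != 0 by rewrite gt_eqF// sqrtr_gt0.
have b : Num.sqrt pi != 0 :> R by rewrite gt_eqF// sqrtr_gt0.
have c : Num.sqrt (sin (pi * t)) != 0 by rewrite gt_eqF// sqrtr_gt0.
rewrite /vsol; move: a b c.
move: (Num.sqrt t) (Num.sqrt pi) (Num.sqrt (sin (pi * t))) (f t) => A B C F *.
by field; do ?(apply/andP; split).
Unshelve. all: by end_near. Qed.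

Let Dsin (t : R) : is_derive t 1 (fun x : R => sin (pi * x)) (pi * cos (pi * t)).
Proof. by apply: is_derive_eq; rewrite /GRing.scale /=; ring. Qed.

Let Dcos (t : R) : is_derive t 1 (fun x : R => cos (pi * x)) (- (pi * sin (pi * t))).
Proof. by apply: is_derive_eq; rewrite /GRing.scale /=; ring. Qed.

Let Dsqrt (t : R) : 0 < t < 1 ->
  is_derive t 1 (fun x : R => Num.sqrt (sin (pi * x)))
    ((2 * Num.sqrt (sin (pi * t)))^-1 * (pi * cos (pi * t))).
Proof.
move=> tI; have s0 := sin_pi_gt0 tI.
exact: (@is_derive1_comp _ Num.sqrt (fun x => sin (pi * x)) t _ _
  (is_derive1_sqrt s0) (Dsin t)).
Qed.

Let Df (t : R) : 0 < t < 1 -> is_derive t 1 f (derive1 f t).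
Proof.
move=> tI; have [_ /(_ t tI)[d1 _] _ _] := hf.
by apply: DeriveDef => //; rewrite derive1E.
Qed.

Let Df' (t : R) : 0 < t < 1 ->
  is_derive t 1 (derive1 f) (- (pi ^+ 2 / (4 * sin (pi * t) ^+ 2) * f t)).
Proof.
move=> tI; have [_ /(_ t tI)[_ d2] /(_ t tI) e _] := hf.
apply: DeriveDef => //; rewrite -derive1E.
by apply/eqP; rewrite -addr_eq0; apply/eqP.
Qed.

Let quotient_deriv (t : R) : 0 < t < 1 ->
  is_derive t 1 (fun x => f x * (Num.sqrt (sin (pi * x)))^-1)
    (derive1 f t * (Num.sqrt (sin (pi * t)))^-1
     - f t * (pi * cos (pi * t)) / (2 * Num.sqrt (sin (pi * t)) ^+ 3)).
Proof.
move=> tI; have s0 := sin_pi_gt0 tI.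
have r0 : Num.sqrt (sin (pi * t)) != 0 by rewrite gt_eqF// sqrtr_gt0.
apply: (is_derive_eq (is_deriveM (Df tI) (@is_deriveV _ (fun x => Num.sqrt (sin (pi * x))) t _ _ r0 (Dsqrt tI)))).
rewrite /GRing.scale /=; move: r0.
by move: (Num.sqrt _) (cos _) (f t) (derive1 f t) => *; field.
Qed.

Lemma vsol_deriv (t : R) : 0 < t < 1 -> is_derive t 1 vsol (wsol t / sin (pi * t)).
Proof.
move=> tI; have s0 := sin_pi_gt0 tI.
have r0 : Num.sqrt (sin (pi * t)) != 0 by rewrite gt_eqF// sqrtr_gt0.
apply: (is_derive_eq (is_deriveZ (Num.sqrt pi) (quotient_deriv tI))).
rewrite /wsol /GRing.scale /= -{5}(sqr_sqrtr (ltW s0)); move: r0.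
by move: (Num.sqrt (sin _)) (cos _) (f t) (derive1 f t) => *; field.
Qed.

Lemma wsol_deriv (t : R) : 0 < t < 1 ->
  is_derive t 1 wsol (pi ^+ 2 / 4 * sin (pi * t) * vsol t).
Proof.
move=> tI; have s0 := sin_pi_gt0 tI.
have r0 : Num.sqrt (sin (pi * t)) != 0 by rewrite gt_eqF// sqrtr_gt0.
have D1 := is_deriveM (Df' tI) (Dsqrt tI).
have D2 := is_deriveZ (pi / 2) (is_deriveM (Dcos t) (quotient_deriv tI)).
apply: (is_derive_eq (is_deriveZ (Num.sqrt pi) (is_deriveB D1 D2))).
rewrite /vsol /GRing.scale /=.
have c2 : cos (pi * t) ^+ 2 = 1 - (Num.sqrt (sin (pi * t)) ^+ 2) ^+ 2.
  by rewrite sqr_sqrtr ?(ltW s0)// cos2sin2.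
have e : sin (pi * t) = Num.sqrt (sin (pi * t)) ^+ 2 by rewrite sqr_sqrtr// ltW.
move: c2 r0 e; move: (Num.sqrt (sin _)) (cos _) => r c c2 r0 ->.
transitivity (Num.sqrt pi * f t * pi ^+ 2 * (r / 2 + (c ^+ 2 - 1) / (4 * r ^+ 3))).
  by field.
by rewrite c2; field.
Qed.

End SineSolution.

(** * Riemann sums and the asymptotics *)

Section RiemannStep.
Variable R : realType.
Local Notation mu := (@lebesgue_measure R).

Definition node_itv (n s : nat) : set R :=
  `[s%:R / n.+1%:R, s.+1%:R / n.+1%:R[%classic.

Definition stepf (n : nat) (d : nat -> R) (t : R) : R :=
  \sum_(s < n.+1) d s * \1_(node_itv n s) t.

Lemma measurable_stepf n d (A : set R) : measurable_fun A (stepf n d).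
Proof.
apply: measurable_funTS; apply: measurable_sum => s.
by apply: measurable_funM => //; apply: measurable_indic; exact: measurable_itv.
Qed.

Lemma stepfE n d (t : R) : 0 < t < 1 ->
  (Num.truncn (t * n.+1%:R) <= n)%N /\ stepf n d t = d (Num.truncn (t * n.+1%:R)).
Proof.
move=> /andP[t0 t1]; have N0 : 0 < n.+1%:R :> R by rewrite ltr0n.
have tN : 0 <= t * n.+1%:R by rewrite mulr_ge0// ltW.
have /andP[ta tb] := truncn_itv tN; set s := Num.truncn _ in ta tb *.
have sn : (s < n.+1)%N by rewrite -(ltr_nat R) (le_lt_trans ta)// gtr_pMl.
split; first by [].
rewrite /stepf /node_itv (bigD1 (Ordinal sn))//= big1 ?addr0.
  rewrite indicE mem_set ?mulr1//= in_itv/= ler_pdivrMr// ltr_pdivlMr//.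
  by rewrite ta.
move=> i; rewrite -val_eqE /= => si; rewrite indicE memNset ?mulr0//= in_itv/=.
rewrite ler_pdivrMr// ltr_pdivlMr// => /andP[ia ib].
have h1 : (i < s.+1)%N by rewrite -(ltr_nat R) (le_lt_trans ia tb).
have h2 : (s < i.+1)%N by rewrite -(ltr_nat R) (le_lt_trans ta ib).
by move/eqP: si; apply; apply/eqP; rewrite eqn_leq; apply/andP; split.
Qed.

Lemma integral_stepf n d : (forall s, (s <= n)%N -> 0 <= d s) ->
  (\int[mu]_(t in `]0%R, 1%R[) (stepf n d t)%:E)%E
  = ((\sum_(s < n.+1) d s) / n.+1%:R)%:E.
Proof.
move=> d0; have N0 : 0 < n.+1%:R :> R by rewrite ltr0n.
rewrite integral_itv_obnd_cbnd; last first.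
  by apply/measurable_EFinP; exact: measurable_stepf.
under eq_integral do rewrite /stepf -sumEFin.
have m01 : measurable (`[0%R, 1%R[%classic : set R) by exact: measurable_itv.
have mI s : measurable_fun setT (\1_(node_itv n s) : R -> R).
  by apply: measurable_indic; exact: measurable_itv.
rewrite ge0_integral_sum//; last 2 first.
- move=> s; apply/measurable_EFinP; apply: measurable_funM => //.
  by apply: measurable_funTS; exact: mI.
- by move=> s t _; rewrite lee_fin mulr_ge0 ?d0// -ltnS.
rewrite mulr_suml -sumEFin; apply: eq_bigr => s _.
under eq_integral do rewrite EFinM.
rewrite ge0_integralZl; [ | exact: m01 | | | ]; last 3 first.
- by apply/measurable_EFinP; apply: measurable_funTS; exact: mI.
- by move=> t _; rewrite lee_fin.
- by rewrite lee_fin d0// -ltnS.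
rewrite EFinM; congr (_ * _)%E.
rewrite integral_indic//; last exact: measurable_itv.
rewrite (_ : node_itv n s `&` _ = node_itv n s); last first.
  apply: setIidl => x; rewrite /node_itv /= !in_itv/= => /andP[xa xb].
  apply/andP; split; first by rewrite (le_trans _ xa)// divr_ge0.
  rewrite (lt_le_trans xb)// ler_pdivrMr// mul1r ler_nat.
  exact: ltn_ord.
have lt_s : s%:R / n.+1%:R < s.+1%:R / n.+1%:R :> R by rewrite ltr_pM2r ?invr_gt0// ltr_nat.
apply: (etrans (lebesgue_measure_itv `[s%:R / n.+1%:R, s.+1%:R / n.+1%:R[)).
by rewrite /= lte_fin lt_s -EFinB -mulrBl -natrB// subSnn mul1r.
Qed.

(** Dominated convergence for the step functions. Integrability of the limit is part of the
    conclusion, so nothing has to be shown about f near the singular endpoints. *)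
Lemma stepf_riemann_cvg (d : nat -> nat -> R) (F : R -> R) (C : R) :
  (forall n s, (s <= n)%N -> 0 <= d n s <= C) ->
  (forall t : R, 0 < t < 1 -> d n (Num.truncn (t * n.+1%:R)) @[n --> \oo] --> F t) ->
  mu.-integrable `]0%R, 1%R[ (EFin \o F) /\
  (\sum_(s < n.+1) d n s) / n.+1%:R @[n --> \oo] --> \int[mu]_(t in `]0, 1[) F t.
Proof.
move=> dC dF.
have m01 : measurable (`]0%R, 1%R[%classic : set R) by exact: measurable_itv.
have st (t : R) : `]0%R, 1%R[%classic t -> (stepf n (d n) t)%:E @[n --> \oo] --> (F t)%:E.
  rewrite /= in_itv/= => tI; apply: cvg_EFin; first exact: nearW.
  rewrite (_ : _ \o _ = fun n => d n (Num.truncn (t * n.+1%:R))); first exact: dF.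
  by apply/funext => n; have [_ /= ->] := stepfE n (d n) tI.
have ms n : measurable_fun (`]0%R, 1%R[%classic : set R) (fun t => (stepf n (d n) t)%:E).
  by apply/measurable_EFinP; exact: measurable_stepf.
have mF : measurable_fun (`]0%R, 1%R[%classic : set R) (EFin \o F) by exact: emeasurable_fun_cvg ms st.
have [| | |iF _ cF] := @dominated_convergence _ _ R mu `]0%R, 1%R[%classic m01
  (fun n t => (stepf n (d n) t)%:E) (EFin \o F) (cst C%:E) ms mF.
- by apply: aeW => t; exact: st.
- apply/integrableP; split => //.
  have mu01 : mu `]0%R, 1%R[%classic = 1%E.
    by apply: (etrans (lebesgue_measure_itv `]0%R, 1%R[)); rewrite /= lte_fin ltr01 oppr0 adde0.
  under eq_integral do rewrite /=.
  by rewrite integral_cst// [X in (_ * X)%E]mu01 mule1 ltry.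
- apply: aeW => t n /= tI; rewrite in_itv/= in tI.
  have [sn ->] := stepfE n (d n) tI.
  by have /andP[d0 dc] := dC n _ sn; rewrite ger0_norm// lee_fin.
split => //.
have iFf : (\int[mu]_(t in `]0%R, 1%R[) (F t)%:E)%E \is a fin_num by exact: integrable_fin_num.
rewrite -[X in _ --> X]fineK// in cF.
move/fine_cvg: cF.
apply: cvg_trans; apply: near_eq_cvg; apply: nearW => n /=.
by rewrite integral_stepf// => s sn; have /andP[] := dC n s sn.
Qed.

End RiemannStep.

Lemma natV_cvg0 (R : realType) (c : R) : c / n.+1%:R @[n --> \oo] --> (0 : R).
Proof.
rewrite -[X in _ --> X](mulr0 c); apply: cvgM; first exact: cvg_cst.
exact: cvg_harmonic.
Qed.

Lemma truncn_ratio_cvg (R : realType) (t : R) : 0 <= t ->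
  (Num.truncn (t * n.+1%:R))%:R / n.+1%:R @[n --> \oo] --> t.
Proof.
move=> t0; have c1 : t - 1 / n.+1%:R @[n --> \oo] --> t.
  by rewrite -[X in _ --> X]subr0; apply: cvgB; [exact: cvg_cst | exact: natV_cvg0].
apply: (@squeeze_cvgr _ _ _ _ (fun n => t - 1 / n.+1%:R) (fun=> t)) c1 (cvg_cst _).
apply: nearW => n; have N0 : 0 < n.+1%:R :> R by rewrite ltr0n.
have tN : 0 <= t * n.+1%:R by rewrite mulr_ge0// ltW.
have /andP[ta tb] := truncn_itv tN; set s := Num.truncn _ in ta tb *.
rewrite ler_pdivrMr// ta andbT ler_pdivlMr// mulrBl divfK ?gt_eqF//.
by move: tb; rewrite -[s.+1]addn1 natrD lerBlDr => /ltW.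
Qed.

Section Asymptotics.
Variables (R : realType) (f : R -> R).
Hypothesis hf : is_sine_solution f.
Local Notation v := (vsol f).

Lemma vsol_continuous (t : R) : 0 < t < 1 -> v x @[x --> t] --> v t.
Proof.
move=> tI; apply: differentiable_continuous; apply/derivable1_diffP.
by have [] := vsol_deriv hf tI.
Qed.

Lemma vsol_natV_cvg1 : v n.+1%:R^-1 @[n --> \oo] --> (1 : R).
Proof.
have /cvg_at_rightP := vsol_cvg hf; apply; split; first by move=> n; rewrite invr_gt0.
exact: cvg_harmonic.
Qed.

Lemma Gseq_cvg (s : nat -> nat) (t : R) : 0 < t < 1 ->
  (s n)%:R / n.+1%:R @[n --> \oo] --> t -> Gseq R n (s n) @[n --> \oo] --> v t.
Proof.
move=> tI st; have /andP[t0 t1] := tI.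
have shift k : (s n + k)%:R / n.+1%:R @[n --> \oo] --> t.
  rewrite -[X in _ --> X]addr0 (_ : (fun n => _) =
    (fun n => (s n)%:R / n.+1%:R + k%:R / n.+1%:R)); last first.
    by apply/funext => n; rewrite natrD mulrDl.
  by apply: cvgD => //; exact: natV_cvg0.
(* Any T strictly between t and 1 works: eventually (s n + 2)/N <= T. *)
pose T := (1 + t) / 2; have TI : 0 < T < 1 by rewrite /T; lra.
have tT : t < T by rewrite /T; lra.
have [K K0 HK] := Gseq_sandwich (vsol_deriv hf) (wsol_deriv hf)
  (vsol_gt0 hf) (vsol_cvg hf) TI.
have eK : expR (K / n.+1%:R) @[n --> \oo] --> (1 : R).
  rewrite -[X in _ --> X](@expR0 R); apply: continuous_cvg; first exact: continuous_expR.
  exact: natV_cvg0.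
have vs k : v ((s n + k)%:R / n.+1%:R) @[n --> \oo] --> v t.
  by apply: continuous_cvg (shift k); exact: vsol_continuous.
pose lo n := v ((s n + 0)%:R / n.+1%:R) * (v n.+1%:R^-1 * expR (K / n.+1%:R))^-1.
pose up n := expR (K / n.+1%:R) * v ((s n + 1)%:R / n.+1%:R).
have clo : lo n @[n --> \oo] --> v t.
  rewrite -[X in _ --> X]mulr1; apply: cvgM => //.
  rewrite -[X in _ --> X]invr1; apply: cvgV; first exact: oner_neq0.
  by rewrite -[X in _ --> X]mulr1; apply: cvgM => //; exact: vsol_natV_cvg1.
have cup : up n @[n --> \oo] --> v t.
  by rewrite -[X in _ --> X]mul1r; apply: cvgM.
apply: (@squeeze_cvgr _ _ _ _ lo up) clo cup.
near=> n.
have N0 : 0 < n.+1%:R :> R by rewrite ltr0n.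
have n0 : (0 < n)%N by near: n; exact: nbhs_infty_gt.
have s0 : (0 < s n)%N.
  have : 0 < (s n)%:R / n.+1%:R :> R by near: n; exact: (cvgr_gt t st).
  by rewrite pmulr_lgt0 ?invr_gt0// ltr0n.
have s2 : (s n).+2%:R <= T * n.+1%:R :> R.
  rewrite -ler_pdivrMr// -[(s n).+2]addn2 ltW//.
  by near: n; exact: (cvgr_lt t (shift 2%N)).
have [h1 h2] := HK n (s n) n0 s0 s2.
have v0 : 0 < v n.+1%:R^-1.
  by apply: (vsol_gt0 hf); rewrite invr_gt0 N0 invf_lt1// ltr1n.
rewrite /lo /up addn0 addn1 h2 andbT ler_pdivrMr; last exact: mulr_gt0 v0 (expR_gt0 _).
by rewrite [leRHS]mulrC.
Unshelve. all: by end_near. Qed.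

(** The square roots of sin(pi t) in v(t) and v(1 - t) cancel the sine weight, and the two factors
    sqrt(pi) leave pi. *)
Lemma Dseq_cvg (t : R) : 0 < t < 1 ->
  Dseq R n (Num.truncn (t * n.+1%:R)) @[n --> \oo] --> pi * (f t * f (1 - t)).
Proof.
move=> tI; have /andP[t0 t1] := tI.
pose s n := Num.truncn (t * n.+1%:R).
have tI' : 0 < 1 - t < 1 by lra.
have st := truncn_ratio_cvg (ltW t0).
have sn n : (s n <= n)%N by have [] := stepfE n (fun=> 0) tI.
have st' : (n - s n)%N%:R / n.+1%:R @[n --> \oo] --> 1 - t.
  (* As n = N - 1, the ratio (n - s)/N is 1 - (s/N + 1/N). *)
  have -> : 1 - t = 1 - (t + 0) by rewrite addr0.
  rewrite (_ : (fun n => _) =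
    (fun n => 1 - ((s n)%:R / n.+1%:R + 1 / n.+1%:R))); last first.
    apply/funext => n; rewrite natrB//.
    have -> : n%:R = n.+1%:R - 1 :> R by rewrite -[n.+1]addn1 natrD addrK.
    have : (n.+1%:R : R) != 0 by rewrite pnatr_eq0.
    by move: (n.+1%:R : R) => z z0; field.
  apply: cvgB; first exact: cvg_cst.
  by apply: cvgD => //; exact: natV_cvg0.
have G1 := Gseq_cvg tI st; have G2 := Gseq_cvg tI' st'.
have S1 : sg n.+1 ((s n)%:R + 2^-1) @[n --> \oo] --> sin (pi * t).
  rewrite (_ : (fun n => _) =
    (fun n => sin (pi * ((s n)%:R / n.+1%:R + 2^-1 / n.+1%:R)))); last first.
    by apply/funext => n; rewrite /sg -mulrDl mulrCA.
  apply: continuous_cvg; first exact: continuous_sin.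
  apply: cvgM; first exact: cvg_cst.
  by rewrite -[X in _ --> X]addr0; apply: cvgD => //; exact: natV_cvg0.
have s0 := sin_pi_gt0 tI.
have -> : pi * (f t * f (1 - t)) = sin (pi * t) * v t * v (1 - t).
  rewrite /vsol mulrBr mulr1 sinB sinpi cospi mul0r mulN1r sub0r opprK.
  have p2 : (pi : R) = Num.sqrt pi ^+ 2 by rewrite sqr_sqrtr// pi_ge0.
  have s2 : sin (pi * t) = Num.sqrt (sin (pi * t)) ^+ 2 by rewrite sqr_sqrtr// ltW.
  have r0 : Num.sqrt (sin (pi * t)) != 0 by rewrite gt_eqF// sqrtr_gt0.
  rewrite [LHS](_ : _ = Num.sqrt pi ^+ 2 * (f t * f (1 - t))); last by rewrite -p2.
  rewrite [X in _ = X * _ * _]s2; move: r0.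
  by move: (Num.sqrt (sin _)) (Num.sqrt pi) (f t) (f (1 - t)) => *; field.
by apply: cvgM => //; exact: cvgM.
Qed.

End Asymptotics.

(** Cauchy-Schwarz, as nonnegativity of a variance. Applied to D, it bounds the second moment below
    by the square of the first. *)
Lemma sum_sqr_le (R : realFieldType) (n : nat) (d : nat -> R) :
  (\sum_(s < n.+1) d s) ^+ 2 <= n.+1%:R * \sum_(s < n.+1) d s ^+ 2.
Proof.
set A := \sum_(s < n.+1) d s; set B := \sum_(s < n.+1) d s ^+ 2.
have N0 : 0 < n.+1%:R :> R by rewrite ltr0n.
have : 0 <= \sum_(s < n.+1) (n.+1%:R * d s - A) ^+ 2 by rewrite sumr_ge0// => s _; rewrite sqr_ge0.
have -> : \sum_(s < n.+1) (n.+1%:R * d s - A) ^+ 2 = n.+1%:R * (n.+1%:R * B - A ^+ 2).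
  rewrite (eq_bigr (fun s : 'I_n.+1 => n.+1%:R ^+ 2 * d s ^+ 2 - 2 * n.+1%:R * A * d s + A ^+ 2)); last first.
    by move=> s _; ring.
  rewrite big_split/= sumr_const card_ord -[A ^+ 2 *+ _]mulr_natl sumrB -!mulr_sumr -/A -/B.
  by ring.
by rewrite pmulr_rge0// subr_ge0.
Qed.

(** * Moments of D and the norm of the Green profile *)

Section Limit.
Variables (R : realType) (f : R -> R).
Hypothesis hf : is_sine_solution f.

Let Y : R := \int[@lebesgue_measure R]_(t in `]0, 1[) (f t * f (1 - t)) ^+ 2.
Let m1 n : R := (\sum_(s < n.+1) Dseq R n s) / n.+1%:R.
Let m2 n : R := (\sum_(s < n.+1) Dseq R n s ^+ 2) / n.+1%:R.

Let m01 : measurable (`]0%R, 1%R[%classic : set R).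
Proof. exact: measurable_itv. Qed.

Let first_moment : m1 n @[n --> \oo] --> pi * Isin f.
Proof.
have [|t tI|iF cF] := @stepf_riemann_cvg R (@Dseq R) (fun t => pi * (f t * f (1 - t))) (expR 8).
- by move=> n s sn; rewrite Dseq_le// ltW// Dseq_gt0.
- exact: Dseq_cvg.
have p0 := lt0r_neq0 (pi_gt0 R).
have i1 : (@lebesgue_measure R).-integrable `]0%R, 1%R[ (EFin \o (fun t => f t * f (1 - t))).
  have := @integrableZl _ (measurableTypeR R) R (@lebesgue_measure R) _ m01 pi^-1 _ iF.
  rewrite (_ : (fun x => _) = EFin \o (fun t => f t * f (1 - t)))//.
  by apply/funext => t /=; rewrite -EFinM mulKf.
by have := @RintegralZl _ (measurableTypeR R) R (@lebesgue_measure R) _ _ pi m01 i1 => <-.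
Qed.

Let second_moment : (@lebesgue_measure R).-integrable `]0%R, 1%R[
    (EFin \o (fun t => (f t * f (1 - t)) ^+ 2)) /\ m2 n @[n --> \oo] --> pi ^+ 2 * Y.
Proof.
have [|t tI|iF cF] := @stepf_riemann_cvg R (fun n s => Dseq R n s ^+ 2)
  (fun t => pi ^+ 2 * (f t * f (1 - t)) ^+ 2) (expR 8 ^+ 2).
- move=> n s sn; have d0 := Dseq_gt0 R sn; rewrite sqr_ge0/=.
  by rewrite lerXn2r ?nnegrE ?expR_ge0 ?Dseq_le// ltW.
- rewrite -exprMn; have c := Dseq_cvg hf tI.
  rewrite expr2 (_ : (fun n => _) = (fun n => Dseq R n (Num.truncn (t * n.+1%:R)) *
     Dseq R n (Num.truncn (t * n.+1%:R)))); last by apply/funext => n; rewrite expr2.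
  exact: cvgM.
have p0 : pi ^+ 2 != 0 :> R by rewrite expf_neq0// lt0r_neq0// pi_gt0.
have i1 : (@lebesgue_measure R).-integrable `]0%R, 1%R[
    (EFin \o (fun t => (f t * f (1 - t)) ^+ 2)).
  have := @integrableZl _ (measurableTypeR R) R (@lebesgue_measure R) _ m01 (pi ^+ 2)^-1 _ iF.
  rewrite (_ : (fun x => _) = EFin \o (fun t => (f t * f (1 - t)) ^+ 2))//.
  by apply/funext => t /=; rewrite -EFinM mulKf.
by split => //; have := @RintegralZl _ (measurableTypeR R) R (@lebesgue_measure R) _ _ (pi ^+ 2) m01 i1 => <-.
Qed.

Let m1_ge n : 2^-1 <= m1 n.
Proof.
have := sum_Dseq_ge R n; rewrite big_mkord /m1 ler_pdivlMr ?ltr0n//.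
by rewrite mulrC.
Qed.

Let Isin_gt0 : 0 < Isin f.
Proof.
have h : 2^-1 <= pi * Isin f.
  by apply: (ler_cvg_to (cvg_cst _) first_moment); apply: nearW => n; exact: m1_ge.
by rewrite -(pmulr_rgt0 _ (pi_gt0 R)); apply: lt_le_trans h; rewrite invr_gt0.
Qed.

Let csinE : csin f = Y / Isin f ^+ 2.
Proof.
rewrite /csin /phisin; have [i2 _] := second_moment.
rewrite -(@RintegralZr _ (measurableTypeR R) R (@lebesgue_measure R) _ _ (Isin f ^+ 2)^-1 m01 i2).
by apply: eq_Rintegral => t _; rewrite expr_div_n.
Qed.

Let m1_m2 n : m1 n ^+ 2 <= m2 n.
Proof.
have N0 : 0 < n.+1%:R :> R by rewrite ltr0n.
rewrite /m1 /m2 expr_div_n ler_pdivrMr ?exprn_gt0//.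
rewrite [leRHS](_ : _ = n.+1%:R * \sum_(s < n.+1) Dseq R n s ^+ 2); first exact: sum_sqr_le.
by move: (lt0r_neq0 N0); move: (n.+1%:R : R) => z z0; field.
Qed.

(** The limit of [m1_m2]. Positivity is required because the relative error is a quotient by the
    square root of [csin f]. *)
Lemma csin_gt0 : 0 < csin f.
Proof.
have [_ c2] := second_moment.
have h : (pi * Isin f) ^+ 2 <= pi ^+ 2 * Y.
  apply: (ler_cvg_to _ c2); last by apply: nearW => n; exact: m1_m2.
  by rewrite expr2; exact: cvgM.
rewrite csinE divr_gt0 ?exprn_gt0//.
rewrite -(pmulr_rgt0 _ (exprn_gt0 2 (pi_gt0 R))); apply: lt_le_trans h.
by rewrite exprn_gt0// mulr_gt0// pi_gt0.
Qed.

(** The trace identity gives C = N / m1, so the square root is C (m2 N)^(1/2) = N^(3/2) m2^(1/2) /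
    m1, whose limit no longer involves C; the factors pi of the two moments cancel. *)
Lemma green_profile_norm_cvg :
  Num.sqrt (\sum_(s < n.+1) green_profile R s ^+ 2) / n.+1%:R `^ (3 / 2)
    @[n --> \oo] --> Num.sqrt (csin f).
Proof.
have [_ c2] := second_moment.
have I0 := Isin_gt0; have p0 := pi_gt0 R.
have -> : Num.sqrt (csin f) = Num.sqrt (pi ^+ 2 * Y) * (pi * Isin f)^-1.
  have -> : Num.sqrt (pi ^+ 2 * Y) = pi * Num.sqrt Y.
    by rewrite sqrtrM ?sqr_ge0// sqrtr_sqr gtr0_norm.
  have -> : Num.sqrt (csin f) = (Isin f)^-1 * Num.sqrt Y.
    rewrite csinE mulrC -exprVn sqrtrM ?sqr_ge0// sqrtr_sqr gtr0_norm//.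
    by rewrite invr_gt0.
  by rewrite invfM mulrACA divff ?(lt0r_neq0 p0)// mul1r mulrC.
rewrite (_ : (fun n => _) = (fun n => Num.sqrt (m2 n) * (m1 n)^-1)); last first.
  apply/funext => n; have N0 : 0 < n.+1%:R :> R by rewrite ltr0n.
  have [C C0 dE] := green_profile_Dseq R n.
  have m1p : 0 < m1 n by apply: lt_le_trans (m1_ge n); rewrite invr_gt0.
  have CE : C * (m1 n * n.+1%:R) = n.+1%:R ^+ 2.
    by rewrite /m1 divfK ?gt_eqF// -green_profile_sum mulr_sumr; apply: eq_bigr.
  have {}CE : C = n.+1%:R / m1 n.
    have N1 := lt0r_neq0 N0; have M1 := lt0r_neq0 m1p.
    apply: (mulIf M1); apply: (mulIf N1); rewrite -mulrA CE divfK//.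
  have -> : \sum_(s < n.+1) green_profile R s ^+ 2 = C ^+ 2 * (m2 n * n.+1%:R).
    rewrite /m2 divfK ?gt_eqF// mulr_sumr; apply: eq_bigr => s _.
    by rewrite dE exprMn.
  have m2p : 0 <= m2 n by rewrite (le_trans _ (m1_m2 n))// sqr_ge0.
  move: (m2 n) m2p => M2 m2p.
  have -> : (3 / 2 : R) = 1 + 2^-1 by lra.
  rewrite powRD ?(gt_eqF N0)// ?implybT// powRr1 ?ltW// powR12_sqrt ?ltW//.
  rewrite sqrtrM ?sqr_ge0// sqrtr_sqr gtr0_norm// CE.
  rewrite sqrtrM//.
  have s0 : Num.sqrt (n.+1%:R : R) != 0 by rewrite gt_eqF// sqrtr_gt0.
  move: (lt0r_neq0 N0) (lt0r_neq0 m1p) s0.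
  move: (n.+1%:R : R) (m1 n) (Num.sqrt M2) (Num.sqrt n.+1%:R) => *.
  by field; do ?(apply/andP; split).
apply: cvgM.
  by apply: continuous_cvg c2; exact: sqrt_continuous.
by apply: cvgV first_moment; rewrite gt_eqF// mulr_gt0.
Qed.

End Limit.

(* The horizon is N = n.+1. *)
Theorem theorem5p2 (R : realType) (mu L : R) (hmu : 0 < mu) (hL : mu < L) :
  (forall n : nat,
     final_chebyshev_exact mu L n.+1 (sine_method mu L n) /\
     sine_gain mu L n =
       2 * epsstar mu L n.+1 / Delta mu L
       * Num.sqrt (\sum_(s < n.+1) green_profile R s ^+ 2)) /\
  (forall f : R -> R, is_sine_solution f ->
     exists o : nat -> R,
       o n @[n --> \oo] --> (0 : R) /\
       forall n : nat,
         sine_gain mu L n =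
           2 * Num.sqrt (csin f) * (n.+1%:R `^ (3 / 2) / Delta mu L)
           * epsstar mu L n.+1 * (1 + o n)).
Proof.
split=> [n|f hf]; first by split; [exact: sine_method_exact | exact: sine_gainE].
have c0 : Num.sqrt (csin f) != 0 by rewrite gt_eqF// sqrtr_gt0 csin_gt0.
pose q n := Num.sqrt (\sum_(s < n.+1) green_profile R s ^+ 2) / n.+1%:R `^ (3 / 2).
exists (fun n => q n / Num.sqrt (csin f) - 1); split.
  rewrite -[X in _ --> X](subrr 1); apply: cvgB; last exact: cvg_cst.
  rewrite -[X in _ --> X](divff c0); apply: cvgM; last exact: cvg_cst.
  exact: green_profile_norm_cvg.
move=> n; rewrite sine_gainE// addrC subrK /q.
have p0 : n.+1%:R `^ (3 / 2) != 0 :> R by rewrite gt_eqF// powR_gt0.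
have D0 := lt0r_neq0 (Delta_gt0 hL); move: c0 p0 D0.
move: (Num.sqrt _) (Num.sqrt _) (_ `^ _) (Delta _ _) (epsstar _ _ _) => *.
by field; do ?(apply/andP; split).
Qed.
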